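(* Consider the interference limited regime $\sigma=0$, and let $\alpha\ge 2$ and $B>0$. For each $*\in\{\mathcal V,S,I,\mathcal I,t\}$, the average data rates $\mathcal R_*=\mathbb E^0[B\ln(1+\mathcal S_* )]$ and $\mathcal R_{*;\mathcal T}=\mathbb E^0[B\ln(1+\mathcal S_{*;\mathcal T})]$ (additive and tropical interference) are scale invariant with respect to the intensity $\lambda$, i.e. they do not depend on $\lambda>0$, both with and without fading; in the case with fading they also do not depend on the fading parameter $\mu>0$.
   Context: Model. Let $\lambda,v>0$. $\Phi=\sum_i\delta_{X_i}$ is a homogeneous Poisson point process of intensity $\lambda$ on $\mathbb R^2$ and $(\Theta_i)$ are i.i.d. uniform angles on $[-\pi,\pi)$, independent of $\Phi$. Base station (BS) $i$ is at $X_i^t=X_i+vt(\cos\Theta_i,\sin\Theta_i)$ at time $t\in\mathbb R$; the user is at the origin; $d_i(t)=\|X_i^t\|$. The serving BS at time $t$ is the nearest one. Palm expectation. For a point process $N$ on the time axis $\mathbb R$ that is a time-shift-compatible function of the moving configuration and has intensity $\lambda_N\in(0,\infty)$, $\mathbb E^0_N[f]=\lambda_N^{-1}\,\mathbb E\big[\sum_{t\in N\cap[0,1]}f_t\big]$, where $f_t$ is the quantity $f$ observed at time $t$. $\mathbb E^0$ denotes the Palm expectation of the relevant epoch process. Epochs. Let $T_i$ be the time at which $d_i$ is minimal and $H_i=d_i(T_i)$. - $\mathcal V$ (handover, min-signal/max-interference): times $s$ at which $d_i(s)=d_j(s)=h$ for some $i\neq j$ and no BS is at distance $<h$. $H_{\mathcal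 V}=h$; $\{D_k\}$: distances of all BSs other than $i,j$. - $S$ (max-signal): times $s=T_i$ at which BS $i$ is the nearest BS. $H_S=H_i$; $\{D_k\}$: distances of all other BSs. - $I$ (max-interference): times $s=T_i$ such that exactly one BS $j$ satisfies $d_j(s)<H_i$. $H_I=H_i$, $R_I=d_j(s)$; $\{D_k\}$: distances of all BSs other than $i,j$. - $\mathcal I$ (min-interference, tropical interference handover): times $s$ at which $d_i(s)=d_j(s)=h$ for some $i\ne j$ and exactly one BS $l$ satisfies $d_l(s)<h$. $H_{\mathcal I}=h$, $R_{\mathcal I}=d_l(s)$; $\{D_k\}$: distances of all BSs other than $i,j,l$. - $t$ (typical time): an arbitrary fixed time ($\mathbb P^0=\mathbb P$). $R$: distance to the nearest BS; $\{D_k\}$: distances of all other BSs. Performance metrics with fading: $\rho,\rho',\rho'',\rho_k$ are i.i.d. exponential with parameter $\mu$, independent of BS positions, and noise power is $\sigma^2$. With $\bar I=\sum_k\rho_kD_k^{-\alpha}$ and $\bar M=\max_k\rho_kD_k^{-\alpha}$: SINR: $\mathcal S_{\mathcal V}=\frac{\rho H_{\mathcal V}^{-\alpha}}{\sigma^2+\rho'H_{\mathcal V}^{-\alpha}+\bar I}$, $\mathcal S_S=\frac{\rho H_S^{-\alpha}}{\sigma^2+\bar I}$, $\mathcal S_I=\frac{\rho R_I^{-\alpha}}{\sigma^2+\rho'H_I^{-\alpha}+\bar I}$, $\mathcal S_{\mathcal I}=\frac{\rho R_{\mathcal I}^{-\alpha}}{\sigma^2+(\rho'+\rho'')H_{\mathcal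 I}^{-\alpha}+\bar I}$, $\mathcal S_t=\frac{\rho R^{-\alpha}}{\sigma^2+\bar I}$. STINR ($\mathcal S_{*;\mathcal T}$): the same expressions with the sum of all interfering powers replaced by their maximum, e.g. $\mathcal S_{\mathcal I;\mathcal T}=\frac{\rho R_{\mathcal I}^{-\alpha}}{\sigma^2+\max(\rho'H_{\mathcal I}^{-\alpha},\rho''H_{\mathcal I}^{-\alpha},\bar M)}$. Without fading: the same with all fading variables equal to $1$. Infinite interference is allowed, with the metric equal to $0$ in that case. $B=b/\ln 2$ is a constant, $b$ being the bandwidth. *)

(* Defs.v *)
From HB Require Import structures.
From mathcomp Require Import all_boot all_order all_algebra finmap.
From mathcomp Require Import all_classical all_reals all_analysis.

Set Implicit Arguments.
Unset Strict Implicit.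
Unset Printing Implicit Defensive.

Import Order.TTheory GRing.Theory Num.Theory.
Import numFieldNormedType.Exports.

Local Open Scope classical_set_scope.
Local Open Scope ring_scope.
Local Open Scope ereal_scope.

Section independence.
Context d (T : measurableType d) (R : realType) (P : probability T R).

Definition mutually_independent (G : nat -> set (set T)) : Prop :=
  forall (J : {fset nat}) (E : nat -> set T),
    (forall j, j \in J -> G j (E j)) ->
    P (\bigcap_(j in [set` J]) E j) = \prod_(j <- J) P (E j).

Definition independent2 (G H : set (set T)) : Prop :=
  forall A B, G A -> H B -> P (A `&` B) = P A * P B.

Definition events_of d' (T' : measurableType d') (Y : T -> T') : set (set T) :=
  preimage_set_system setT Y measurable.

Definition sigma_of_family d' (T' : measurableType d') (Y : nat -> T -> T') :
    set (set T) :=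
  <<s \bigcup_i events_of (Y i) >>.

Definition iid_with_law d' (T' : measurableType d')
    (Y : nat -> {RV P >-> T'}) (law : set T' -> \bar R) : Prop :=
  (forall i A, measurable A -> distribution P (Y i) A = law A) /\
  mutually_independent (fun i => events_of (Y i)).

End independence.

Section network.
Context d (T : measurableType d) (R : realType) (P : probability T R).

Definition area : set (R * R) -> \bar R :=
  (@lebesgue_measure R \x @lebesgue_measure R).

Definition point_count (X : nat -> T -> R * R) (w : T) (A : set (R * R)) :
    \bar R :=
  \sum_(0 <= i <oo) \d_(X i w) A.

(* [poisson_pmf] is not used here because it is 1 at rate 0, and sets of area 0
   are allowed. *)
Definition poisson_weight (m : R) (n : nat) : R :=
  (m ^+ n / n`!%:R * expR (- m))%R.

(* The points are enumerated by nat: a homogeneous Poisson process of positive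
   intensity on the plane has infinitely many points almost surely. *)
Definition is_poisson_process (lam : R) (X : nat -> T -> R * R) : Prop :=
  forall (m : nat) (A : 'I_m -> set (R * R)) (n : 'I_m -> nat),
    (forall j, measurable (A j)) ->
    (forall j, area (A j) < +oo) ->
    (forall j k, j != k -> A j `&` A k = set0) ->
    P [set w | forall j, point_count X w (A j) = (n j)%:R%:E] =
    \prod_(j < m) (poisson_weight (lam * fine (area (A j))) (n j))%:E.

Lemma ltNpipi : (- pi < pi :> R)%R.
Proof. by rewrite gtrN// pi_gt0. Qed.

(* The uniform law on the closed interval [-pi, pi] is also the uniform law on
   [-pi, pi[. *)
Record moving_network (lam : R) (X : nat -> {RV P >-> (R * R)%type})
    (Theta : nat -> {RV P >-> R}) : Prop := MovingNetwork {
  network_poisson : is_poisson_process lam (fun i => X i : T -> R * R) ;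
  network_angles : iid_with_law Theta (uniform_prob ltNpipi) ;
  network_indep : independent2 P (sigma_of_family (fun i => X i : T -> R * R))
                                 (sigma_of_family (fun i => Theta i : T -> R)) }.

(* [F 0], [F 1], [F 2] are the fading variables rho, rho', rho'' and
   [F (k + 3)] is rho_k. *)
Record fading_model (mu : R) (X : nat -> {RV P >-> (R * R)%type})
    (Theta F : nat -> {RV P >-> R}) : Prop := FadingModel {
  fading_law : iid_with_law F (exponential_prob mu) ;
  fading_indep :
    independent2 P (sigma_of_family (fun i w => (X i w, Theta i w)))
                   (sigma_of_family (fun i => F i : T -> R)) }.

(* The product type R * R carries the sup norm in the library, so the Euclidean
   distance is written out. *)
Definition dist (v : R) (X : nat -> T -> R * R) (Theta : nat -> T -> R) (w : T)
    (i : nat) (t : R) : R :=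
  let x := ((X i w).1 + v * t * cos (Theta i w))%R in
  let y := ((X i w).2 + v * t * sin (Theta i w))%R in
  Num.sqrt (x ^+ 2 + y ^+ 2)%R.

(* Palm expectation of the quantity [f], observed at time s as [f s], at the
   epochs of the point process [N] on the time axis. *)
Definition palm_intensity (N : T -> set R) : \bar R :=
  \int[P]_w \esum_(s in N w `&` `[0%R, 1%R]) 1.

Definition palm_expectation (N : T -> set R) (f : R -> T -> \bar R) : \bar R :=
  (palm_intensity N)^-1 *
  \int[P]_w \esum_(s in N w `&` `[0%R, 1%R]) f s w.

End network.

Section epochs.
Context (R : realType).

(* In the order of the constructors: V, S, I, calligraphic I, and the typical
   time, which is an arbitrary fixed time. *)
Inductive epoch : Type :=
  | handover
  | max_signal
  | max_interference
  | interference_handover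
  | typical_time of R.

(* An observation [(i, s)] consists of the index [i] of the serving base station
   (fading rho) and the list [s] of the interfering base stations that carry the
   fading variables rho', rho'' in this order; the {D_k} are the distances of
   all remaining base stations. *)
Definition observation : Type := (nat * seq nat)%type.

Definition closest_approach (D : nat -> R -> R) (i : nat) (t : R) : Prop :=
  forall u, (D i t <= D i u)%R.

Definition nearest (D : nat -> R -> R) (i : nat) (t : R) : Prop :=
  forall k, (D i t <= D k t)%R.

Definition only_closer (D : nat -> R -> R) (j : nat) (h t : R) : Prop :=
  (D j t < h)%R /\ forall k, (D k t < h)%R -> k = j.

Definition observed (e : epoch) (D : nat -> R -> R) (t : R) (o : observation) :
    Prop :=
  match e, o with
  | handover, (i, [:: j]) => i <> j /\ D i t = D j t /\ nearest D i t
  | max_signal, (i, [::]) => closest_approach D i t /\ nearest D i t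
  | max_interference, (j, [:: i]) =>
      closest_approach D i t /\ only_closer D j (D i t) t
  | interference_handover, (l, [:: i; j]) =>
      i <> j /\ D i t = D j t /\ only_closer D l (D i t) t
  | typical_time _, (i, [::]) => nearest D i t
  | _, _ => False
  end.

Definition epoch_times (e : epoch) (D : nat -> R -> R) : set R :=
  [set t | exists o, observed e D t o].

(* Several observations at one time differ only by exchanging base stations at
   equal distances from the user; the first one in the enumeration of the
   countable type [observation] is retained, so that the selection depends
   measurably on the configuration. *)
Definition observation_at (e : epoch) (D : nat -> R -> R) (t : R) : observation :=
  xget (0%N, [::]) [set o | observed e D t o /\
    forall o', observed e D t o' -> (choice.pickle o <= choice.pickle o')%N].

End epochs.

Section metrics.
Context (R : realType).

Inductive interference : Type := additive | tropical.

(* [named] lists the interfering powers with fading rho', rho''; [other k] is the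
   interfering power of base station k, for k outside of [excluded]. *)
Definition total_interference (a : interference) (named : seq R)
    (other : nat -> R) (excluded : seq nat) : \bar R :=
  match a with
  | additive => (\sum_(x <- named) x)%R%:E +
      \sum_(0 <= k <oo | k \notin excluded) (other k)%:E
  | tropical => ereal_sup ([set x%:E | x in [set` named]] `|`
      [set (other k)%:E | k in [set k | k \notin excluded]])
  end.

(* SINR or STINR at time t. The inverse of +oo is 0 in [\bar R], hence the value
   0 when the interference is infinite. *)
Definition signal_quality (a : interference) (sigma alpha : R) (F : nat -> R)
    (D : nat -> R -> R) (t : R) (o : observation) : \bar R :=
  let attenuation i := (D i t `^ (- alpha))%R in
  let: (i, s) := o in
  (F 0%N * attenuation i)%R%:E /
  ((sigma ^+ 2)%R%:E +
   total_interference a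
     [seq (F n.+1 * attenuation (nth 0%N s n))%R | n <- iota 0 (size s)]
     (fun k => F (k + 3)%N * attenuation k)%R
     (i :: s)).

End metrics.

Section rates.
Context d (T : measurableType d) (R : realType) (P : probability T R).

Definition average_rate (v sigma alpha B : R) (X : nat -> T -> R * R)
    (Theta F : nat -> T -> R) (a : interference) (e : epoch R) : \bar R :=
  let D := dist v X Theta in
  let data_rate t w :=
    B%:E * lne (1 + signal_quality a sigma alpha (fun n => F n w) (D w) t
                      (observation_at e (D w) t)) in
  match e with
  | typical_time t => \int[P]_w data_rate t w
  | _ => palm_expectation P (fun w => epoch_times e (D w)) data_rate
  end.

Definition no_fading : nat -> T -> R := fun _ _ => 1%R.

End rates.

(* Main.v *)
Require Import Defs.
From HB Require Import structures.
From mathcomp Require Import all_boot all_order all_algebra finmap.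
From mathcomp Require Import all_classical all_reals all_analysis.
From mathcomp Require Import measurable_realfun.
From mathcomp Require Import ring lra.
Set Implicit Arguments.
Unset Strict Implicit.
Unset Printing Implicit Defensive.
Import Order.TTheory GRing.Theory Num.Theory.
Import numFieldNormedType.Exports.
Local Open Scope classical_set_scope.
Local Open Scope ring_scope.

Local Open Scope ereal_scope.

(** Space and time can be rescaled. Scaling the plane by c, the square root of the
    intensity, turns the Poisson process into one of intensity 1. The velocity is kept if
    time is multiplied by c as well, so that the network of intensity c^2 is the network of
    intensity 1 seen through a clock that runs at another rate. Ratios of distances are
    unchanged, and without noise the signal quality depends on ratios only: the factor
    c^(-alpha) of all received powers cancels, as does the fading parameter. The epochs of
    the unit time interval become those of the interval [0, c]. By stationarity the expected
    sum of any quantity over these is c times its expected sum over the unit interval, and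
    the factor c cancels in the Palm expectation.

    The networks to be compared live on different probability spaces, and their base
    stations are enumerated in an unknown order, so that no equality in law of the sequences
    of locations is available: the comparison is confined to quantities that do not depend
    on the enumeration. The scaled network at the time t, with marks given by directions and
    fading, is a marked point process. Its void probabilities follow from the generating
    functional of the Poisson process ([poisson_generating_functional], proved from the
    joint law of the counts) and from the independence of the marks. They do not depend on t
    nor on the intensity ([probability_void_network]), because displacements that depend on
    the mark alone preserve the area.

    Void probabilities determine the expectation of every quantity that is invariant under
    relabelling ([transfer]). Base stations are sorted by a real key; events about the
    sorted configuration belong to the sigma-algebra generated by the void events, and the
    void events form a pi-system. This argument gives stationarity and scale invariance at
    once, and replaces any discussion of random measures.

    It remains to see that the sum of the rates over the epochs in a window is a measurable
    function of the configuration that is invariant under relabelling. Almost surely there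
    are no ties beyond those that define the epochs ([network_tie_free]): given all other
    randomness, a tie is an equation for the direction of one station, with finitely many
    solutions. Without such ties every observation has a unique explicit time, which gives
    measurability ([measurable_epoch_sum]), and the possible observations at one epoch have
    the same rate, which gives invariance ([epoch_sum_perm]). Stationarity and additivity
    yield Cauchy's functional equation for the expected sums ([mean_linear]), and
    [average_rate_scale_free] collects the conclusions. *)

(** * Sequence spaces and independence *)

Section sequence_space.
Context d (E : measurableType d).

(** A sequence is measured through its coordinates only, so the whole family of
    locations, or of marks, is one random element of one measurable space. *)
Definition coordinate_events : set (set (nat -> E)) :=
  \bigcup_n preimage_set_system setT (fun z : nat -> E => z n) measurable.

Definition seqsp := g_sigma_algebraType coordinate_events.
HB.instance Definition _ := Measurable.on seqsp.

Lemma measurable_coord n : measurable_fun setT (fun z : seqsp => z n).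
Proof.
move=> _ A mA; rewrite setTI; apply: sub_sigma_algebra.
by exists n => //; exists A => //; rewrite setTI.
Qed.

Lemma measurable_seqspP d' (T : measurableType d') (f : T -> seqsp) :
  (forall n, measurable_fun setT (fun w => f w n)) -> measurable_fun setT f.
Proof.
move=> mf; apply: (@measurability _ _ T seqsp setT f coordinate_events) => //.
move=> _ [_ [n _ [A mA <-]] <-]; rewrite !setTI.
by rewrite -[X in measurable X]setTI; apply: mf.
Qed.

Definition boxes (D : set (set E)) : set (set (nat -> E)) :=
  [set A | exists (n : nat) (B : nat -> set E), (forall i, D (B i)) /\
    A = [set z | forall i, (i < n)%N -> B i (z i)]].

Lemma boxes_setI D : setI_closed D -> D setT -> setI_closed (boxes D).
Proof.
move=> DI DT _ _ [n [B [DB ->]]] [m [C [DC ->]]].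
exists (maxn n m), (fun i => (if (i < n)%N then B i else setT) `&`
  (if (i < m)%N then C i else setT)); split.
  by move=> i; apply: DI; case: ifP.
apply/seteqP; split=> z /=.
  by move=> [zB zC] i _; split; case: ifPn => // im; [exact: zB|exact: zC].
move=> zBC; split=> i im.
  by have := zBC i; rewrite leq_max im => -[].
by have := zBC i; rewrite leq_max im orbT => -[].
Qed.

(** With [boxes_setI], boxes form a pi-system that generates the sigma-algebra, so that a
    finite measure on sequences is determined by its values on boxes. *)
Lemma measurable_boxes D : D setT -> measurable = <<s D >> ->
  (measurable : set (set seqsp)) = <<s boxes D >>.
Proof.
move=> DT mD.
pose BT := g_sigma_algebraType (boxes D).
rewrite eqEsubset; split; last first.
  apply: smallest_sub; first exact: sigma_algebra_measurable.
  move=> _ [n [B [DB ->]]].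
  rewrite [X in measurable X](_ : _ = \bigcap_(i in [set i | (i < n)%N])
    ((fun z : seqsp => z i) @^-1` B i)) //.
  apply: fin_bigcap_measurable => // i _.
  rewrite -[X in measurable X]setTI; apply: measurable_coord => //.
  by rewrite mD; apply: sub_sigma_algebra.
apply: smallest_sub; first exact: smallest_sigma_algebra.
move=> _ [n _ [A mA <-]]; rewrite setTI.
have -> : <<s boxes D >> ((fun z : nat -> E => z n) @^-1` A) =
  (measurable : set (set BT)) ((fun z : BT => z n) @^-1` A) by [].
rewrite -[X in measurable X]setTI.
apply: (@measurability _ _ BT E setT (fun z : BT => z n) D) => //.
move=> _ [B DB <-]; rewrite setTI; apply: sub_sigma_algebra.
exists n.+1, (fun i => if i == n then B else setT); split.
  by move=> i; case: ifP.
apply/seteqP; split=> z /=; first by move=> Bz i _; case: eqP => // ->.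
by move=> /(_ n (ltnSn n)); rewrite eqxx.
Qed.

End sequence_space.

Section uniqueness.
Context d (T : measurableType d) (R : realType).

(** The form of the pi-lambda theorem used throughout: two measures of equal finite
    mass (the total space is in G) that agree on a generating pi-system. *)
Lemma finite_measure_unique (G : set (set T)) (m1 m2 : {measure set T -> \bar R}) :
  measurable = <<s G >> -> setI_closed G -> G setT -> m1 setT < +oo ->
  (forall A, G A -> m1 A = m2 A) -> forall A, measurable A -> m1 A = m2 A.
Proof.
move=> mG GI GT fin H A mA.
apply: (@measure_unique _ _ _ G (fun=> setT)) => //.
by apply/seteqP; split=> // x _; exists 0%N.
Qed.
End uniqueness.

Section mkmfun.
Context d d' (T : measurableType d) (T' : measurableType d').
Definition mkmfun (f : T -> T') (mf : measurable_fun setT f) : {mfun T >-> T'} :=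
  mfun_Sub (mem_set mf).
End mkmfun.

Section independence.
Context d (T : measurableType d) (R : realType) (P : probability T R).

Definition independent_rv d1 d2 (E1 : measurableType d1) (E2 : measurableType d2)
    (Y : T -> E1) (W : T -> E2) :=
  forall A B, measurable A -> measurable B ->
    P (Y @^-1` A `&` W @^-1` B) = P (Y @^-1` A) * P (W @^-1` B).

Lemma mpreimage d1 (E1 : measurableType d1) (Y : T -> E1) A :
  measurable_fun setT Y -> measurable A -> measurable (Y @^-1` A).
Proof. by move=> mY mA; rewrite -[X in measurable X]setTI; exact: mY. Qed.

(** Both sides are finite measures in B: the law of W restricted to the event Q, and
    a multiple of the law of W. *)
Lemma pushforward_restr_pisystem d2 (E2 : measurableType d2) (W : T -> E2)
    (Q : set T) (c : \bar R) (D : set (set E2)) :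
  measurable_fun setT W -> measurable Q -> 0 <= c -> c \is a fin_num ->
  measurable = <<s D >> -> setI_closed D -> D setT ->
  (forall B, D B -> P (Q `&` W @^-1` B) = c * P (W @^-1` B)) ->
  forall B, measurable B -> P (Q `&` W @^-1` B) = c * P (W @^-1` B).
Proof.
move=> mW mQ c0 cf mD DI DT H B mB.
pose k : {nonneg R} := NngNum (fine_ge0 c0).
have kE : k%:num%:E = c by rewrite /= fineK.
have K := @finite_measure_unique _ E2 R D
  (pushforward (mrestr P mQ) W) (mscale k (pushforward P W)) mD DI DT.
rewrite setIC -kE; apply: (K mW mW) => //.
  by change (P (setT `&` Q) < +oo); rewrite setTI ltey_eq fin_num_measure.
move=> A DA; rewrite [LHS](_ : _ = P (W @^-1` A `&` Q))//.
by rewrite setIC H// [RHS](_ : _ = k%:num%:E * P (W @^-1` A))// kE.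
Qed.

Lemma independent_from_pisystem d1 d2 (E1 : measurableType d1) (E2 : measurableType d2)
    (Y : T -> E1) (W : T -> E2) (D : set (set E2)) :
  measurable_fun setT Y -> measurable_fun setT W ->
  measurable = <<s D >> -> setI_closed D -> D setT ->
  (forall A B, measurable A -> D B ->
    P (Y @^-1` A `&` W @^-1` B) = P (Y @^-1` A) * P (W @^-1` B)) ->
  independent_rv Y W.
Proof.
move=> mY mW mD DI DT H A B mA.
apply: (pushforward_restr_pisystem _ _ _ _ mD) => //.
- exact: mpreimage.
- exact: fin_num_measure (mpreimage _ _).
- by move=> C DC; exact: H.
Qed.

(** Tonelli for the joint law of Y and W, which is the product of their laws because
    both agree on rectangles: Y may be frozen while W is integrated out. *)
Lemma freezing d1 d2 (E1 : measurableType d1) (E2 : measurableType d2)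
    (Y : T -> E1) (W : T -> E2) (C : set (E1 * E2)) :
  measurable_fun setT Y -> measurable_fun setT W -> independent_rv Y W ->
  measurable C ->
  P [set w | C (Y w, W w)] = \int[P]_w P [set w' | C (Y w, W w')].
Proof.
move=> mY mW ind mC.
pose Yd := distribution P (mkmfun mY).
pose Wd := distribution P (mkmfun mW).
have mYW : measurable_fun setT (fun w => (Y w, W w)).
  exact: measurable_fun_pair.
have := @product_measure_unique _ _ _ _ _ Yd Wd
  (distribution P (mkmfun mYW)) ind C mC.
rewrite /Yd /Wd /distribution /= => K.
rewrite [LHS](_ : _ = pushforward P (fun w => (Y w, W w)) C)// -[LHS]K.
rewrite /product_measure1 ge0_integral_pushforward//.
- apply: eq_integral => w _ /=; rewrite /pushforward /= /xsection.
  by congr (P _); apply/seteqP; split => x/=; rewrite inE.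
- exact: (measurable_fun_xsection (distribution P (mkmfun mW))).
Qed.

(** What makes tie events negligible: it suffices that they are null for each frozen
    value of the part of the randomness that is independent of W. *)
Lemma freezing0 d1 d2 (E1 : measurableType d1) (E2 : measurableType d2)
    (Y : T -> E1) (W : T -> E2) (C : set (E1 * E2)) :
  measurable_fun setT Y -> measurable_fun setT W -> independent_rv Y W ->
  measurable C -> (forall y, P [set w' | C (y, W w')] = 0) ->
  P [set w | C (Y w, W w)] = 0.
Proof.
move=> mY mW ind mC C0; rewrite freezing//.
by rewrite integral0_eq.
Qed.

End independence.

Section mutual.
Context d (T : measurableType d) (R : realType) (P : probability T R).
Context d1 (E : measurableType d1).

(** The sets of the pi-system are replaced by arbitrary measurable sets one coordinate
    at a time; each replacement is an instance of [pushforward_restr_pisystem]. *)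
Lemma mutual_independence_from_pisystem (V : nat -> T -> E) (D : set (set E)) :
  (forall n, measurable_fun setT (V n)) ->
  measurable = <<s D >> -> setI_closed D -> D setT ->
  (forall n (B : nat -> set E), (forall i, D (B i)) ->
    P [set w | forall i, (i < n)%N -> B i (V i w)] =
      \prod_(i < n) P (V i @^-1` B i)) ->
  forall n (B : nat -> set E), (forall i, measurable (B i)) ->
    P [set w | forall i, (i < n)%N -> B i (V i w)] =
      \prod_(i < n) P (V i @^-1` B i).
Proof.
move=> mV mD DI DT H n.
have DM A : D A -> measurable A by move=> DA; rewrite mD; exact: sub_sigma_algebra.
have mE (B : nat -> set E) (Q : pred nat) : (forall i, measurable (B i)) ->
    measurable [set w | forall i, (i < n)%N -> Q i -> B i (V i w)].
  move=> mB.
  rewrite [X in measurable X](_ : _ =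
    \bigcap_(i in [set i | (i < n)%N /\ Q i]) (V i @^-1` B i)).
    apply: fin_bigcap_measurable => [|i _]; last exact: mpreimage.
    by apply: (@sub_finite_set _ _ `I_n) => // i [].
  by apply/seteqP; split=> w /= h i; [move=> []; exact: h|move=> *; exact: h].
suff: forall k (B : nat -> set E), (forall i, measurable (B i)) ->
    (forall i, (k <= i)%N -> D (B i)) ->
    P [set w | forall i, (i < n)%N -> B i (V i w)] =
      \prod_(i < n) P (V i @^-1` B i).
  move=> /(_ n) K B mB.
  pose B' i := if (i < n)%N then B i else setT.
  have := K B' _ _; rewrite /B'.
  have -> : [set w | forall i, (i < n)%N ->
        (if (i < n)%N then B i else [set: E]) (V i w)] =
      [set w | forall i, (i < n)%N -> B i (V i w)].
    by apply/seteqP; split=> w /= h i ni; have := h i ni; rewrite ni.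
  move=> ->.
  - by apply: eq_bigr => i _; rewrite ltn_ord.
  - by move=> i; case: ifP.
  - by move=> i; rewrite ltnNge => ->.
elim=> [B mB DB|k IH B mB DB]; first by apply: H => i; exact: DB.
have [nk|kn] := leqP n k.
  have := IH (fun i => if (i < n)%N then B i else setT).
  have -> : [set w | forall i, (i < n)%N ->
        (if (i < n)%N then B i else [set: E]) (V i w)] =
      [set w | forall i, (i < n)%N -> B i (V i w)].
    by apply/seteqP; split=> w /= h i ni; have := h i ni; rewrite ni.
  move=> ->.
  - by apply: eq_bigr => i _; rewrite ltn_ord.
  - by move=> i; case: ifP.
  - by move=> i ki; rewrite ltnNge (leq_trans nk ki).
pose rest := [set w | forall i, (i < n)%N -> i != k -> B i (V i w)].
have mrest : measurable rest by exact: (mE B (fun i => i != k)).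
pose q := \prod_(i < n | i != Ordinal kn) P (V i @^-1` B i).
have q0 : 0 <= q by apply: prode_ge0.
have qf : q \is a fin_num.
  rewrite /q; elim/big_ind : _ => // [x y|i _]; first exact: fin_numM.
  exact: fin_num_measure (mpreimage _ _).
have split_ A : [set w | forall i, (i < n)%N ->
    (if i == k then A else B i) (V i w)] = V k @^-1` A `&` rest.
  apply/seteqP; split=> w /=.
    move=> h; split; first by have := h k kn; rewrite eqxx.
    by move=> i ni /negPf ik; have := h i ni; rewrite ik.
  by move=> [wA wr] i ni; case: eqP => [->//|/eqP ik]; exact: wr.
have prod_ A : \prod_(i < n) P (V i @^-1` (if i == k :> nat then A else B i)) =
    P (V k @^-1` A) * q.
  rewrite (bigD1 (Ordinal kn))//= eqxx; congr (_ * _).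
  apply: eq_bigr => i ik; case: ifPn => // /eqP ik'.
  by move: ik; rewrite -val_eqE /= ik' eqxx.
have Bk : B = fun i => if i == k then B k else B i.
  by apply/funext => i; case: eqP => // ->.
rewrite Bk split_ prod_.
rewrite setIC muleC; apply: (pushforward_restr_pisystem _ _ _ _ mD) => //.
move=> A DA; rewrite setIC -split_ muleC -prod_; apply: (IH (fun i => if i == k then A else B i)) => [i|i ki].
  by case: ifP => // _; exact: DM.
by case: eqP => // /eqP ik; apply: DB; rewrite ltn_neqAle eq_sym ik.
Qed.

(** Boxes with sides in D are a generating pi-system of the sequence space. *)
Lemma independent_rv_seq d2 (E2 : measurableType d2) (Y : T -> E2)
    (V : nat -> T -> E) (D : set (set E)) :
  measurable_fun setT Y -> (forall n, measurable_fun setT (V n)) ->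
  measurable = <<s D >> -> setI_closed D -> D setT ->
  (forall A n (B : nat -> set E), measurable A -> (forall i, D (B i)) ->
    P (Y @^-1` A `&` [set w | forall i, (i < n)%N -> B i (V i w)]) =
    P (Y @^-1` A) * P [set w | forall i, (i < n)%N -> B i (V i w)]) ->
  independent_rv P Y (fun w => (V^~ w) : seqsp E).
Proof.
move=> mY mV mD DI DT H.
apply: (@independent_from_pisystem _ _ _ _ _ _ _ (seqsp E) _ _ (boxes D)) => //.
- exact: measurable_seqspP.
- exact: measurable_boxes.
- exact: boxes_setI.
- exists 0%N, (fun=> setT); split => //.
  by apply/seteqP; split.
- by move=> A _ mA [n [B [DB ->]]]; exact: H.
Qed.
End mutual.

(** * The generating functional of a Poisson process *)

Section full_probability.
Context d (T : measurableType d) (R : realType) (P : probability T R).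

Lemma probabilityI_full (O A : set T) : measurable O -> measurable A ->
  P O = 1 -> P (A `&` O) = P A.
Proof.
move=> mO mA PO.
have PC : P (~` O) = 0 by rewrite probability_setC// PO subee.
rewrite -[in RHS](setIT A) -(setUv O) setIUr measureU.
- rewrite [X in _ + X](_ : _ = 0) ?adde0//.
  apply: (subset_measure0 _ _ _ PC) => //.
  + by apply: measurableI => //; exact: measurableC.
  + exact: measurableC.
- exact: measurableI.
- by apply: measurableI => //; exact: measurableC.
- by rewrite setIACA setICr setI0.
Qed.

Lemma eq_probability_full (O A B : set T) : measurable O -> measurable A ->
  measurable B -> P O = 1 -> A `&` O = B `&` O -> P A = P B.
Proof.
by move=> mO mA mB PO AB; rewrite -(probabilityI_full mO mA PO) AB probabilityI_full.
Qed.

Lemma probability_bigcap1 (F : nat -> set T) : (forall n, measurable (F n)) ->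
  (forall n, P (F n) = 1) -> P (\bigcap_n F n) = 1.
Proof.
move=> mF F1.
have mI : measurable (\bigcap_n F n) by exact: bigcapT_measurable.
have : P (~` \bigcap_n F n) = 0.
  apply/negligibleP; first exact: measurableC.
  rewrite setC_bigcap; apply: negligible_bigcup => n.
  apply/negligibleP; first exact: measurableC.
  by rewrite [LHS]probability_setC// F1 subee.
move=> PC; rewrite -[RHS](sube0 1) -PC -probability_setC ?setCK//.
exact: measurableC.
Qed.

End full_probability.

Section exp_series.
Context (R : realType).

Lemma poisson_weight_ge0 (m : R) n : (0 <= m)%R -> (0 <= poisson_weight m n)%R.
Proof. by move=> m0; rewrite mulr_ge0 ?expR_ge0// divr_ge0// exprn_ge0. Qed.

(** The exponential series at m q, multiplied by the normalisation exp (-m). *)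
Lemma poisson_generating_function (m q : R) : (0 <= m)%R -> (0 <= q)%R ->
  \sum_(0 <= n <oo) (q ^+ n * poisson_weight m n)%:E = (expR (- (m * (1 - q))))%:E.
Proof.
move=> m0 q0.
have -> : (- (m * (1 - q)) = - m + q * m)%R by ring.
rewrite expRD EFinM.
under eq_eseriesr => n _.
  rewrite /poisson_weight (_ : _ * _ = expR (- m) * ((q * m) ^+ n / n`!%:R))%R; last first.
    by rewrite exprMn; ring.
  rewrite EFinM; over.
rewrite nneseriesZl; last first.
  by move=> n _; rewrite lee_fin divr_ge0// exprn_ge0// mulr_ge0.
congr (_ * _); rewrite expRE -EFin_lim; last first.
  rewrite /pseries/=; under eq_fun do rewrite mulrC.
  exact: is_cvg_series_exp_coeff.
apply/congr_lim/funext => n/=; rewrite /pseries/= /series/= -sumEFin//.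
by under eq_bigr do rewrite mulrC.
Qed.

End exp_series.

Section bounded_convergence.
Context d (T : measurableType d) (R : realType) (P : probability T R).

(** Dominated convergence with the constant 1 as the bound. *)
Lemma bounded_cvg (f_ : nat -> T -> R) (f : T -> R) (O : set T) :
  (forall n, measurable_fun setT (f_ n)) -> measurable_fun setT f ->
  (forall n w, 0 <= f_ n w <= 1)%R -> measurable O -> P O = 1 ->
  (forall w, O w -> f_ n w @[n --> \oo] --> f w) ->
  \int[P]_w (f_ n w)%:E @[n --> \oo] --> \int[P]_w (f w)%:E.
Proof.
move=> mf_ mf f01 mO PO cvgO.
have [|||||_ _ //] := @dominated_convergence _ _ _ P _ measurableT
  (fun n w => (f_ n w)%:E) (fun w => (f w)%:E) (cst 1).
- by move=> n; exact/measurable_EFinP.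
- exact/measurable_EFinP.
- exists (~` O); split; first exact: measurableC.
    by rewrite [LHS]probability_setC// PO subee.
  apply: subsetC => w Ow _ /=.
  by apply: cvg_EFin; [exact: nearW|exact: cvgO].
- by apply: finite_measure_integrable_cst.
- apply: aeW => w n _; have /andP[f0 f1] := f01 n w.
  by rewrite gee0_abs ?lee_fin.
Qed.
End bounded_convergence.

Section product_of_counts.
Context d (T : measurableType d) (R : realType) (P : probability T R).

(** The expectation of a product is the product of the generating functions e j of the
    marginal weights W j, since the joint law of the counts is the product of the weights.
    The sums over the counts are carried out one index at a time. *)
Lemma expectation_prod_counts (N : nat -> T -> nat) (m : nat) (q : nat -> R)
    (W : nat -> nat -> R) (e : nat -> R) :
  (forall j c, measurable (N j @^-1` [set c])) ->
  (forall j, 0 <= q j)%R -> (forall j c, 0 <= W j c)%R -> (forall j, 0 <= e j)%R ->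
  (forall j, \sum_(0 <= a <oo) (q j ^+ a * W j a)%:E = (e j)%:E) ->
  (forall n : nat -> nat, P [set w | forall j, (j < m)%N -> N j w = n j] =
     \prod_(j < m) (W j (n j))%:E) ->
  \int[P]_w (\prod_(j < m) q j ^+ N j w)%R%:E = \prod_(j < m) (e j)%:E.
Proof.
move=> mN q0 W0 e0 qW HP.
pose S k (n : nat -> nat) := [set w | forall j, (k <= j < m)%N -> N j w = n j].
have mS k n : measurable (S k n).
  rewrite [X in measurable X](_ : _ =
    \bigcap_(j in [set j | (k <= j < m)%N]) (N j @^-1` [set n j])).
    apply: fin_bigcap_measurable => // .
    by apply: (@sub_finite_set _ _ `I_m) => // i /= /andP[].
  by apply/seteqP; split=> w /= h j; exact: h.
have mq j : measurable_fun setT (fun w => q j ^+ N j w)%R.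
  move=> _ A _; rewrite setTI.
  rewrite [X in measurable X](_ : _ = \bigcup_(c in [set c | A (q j ^+ c)%R]) (N j @^-1` [set c])).
    exact: bigcup_measurable.
  by apply/seteqP; split=> [w Aw|w [c Ac /= Nc]]; [exists (N j w)|rewrite Nc].
have mprod k : measurable_fun setT (fun w => \prod_(j < k) q j ^+ N j w)%R.
  elim: k => [|k IH].
    by under eq_fun do rewrite big_ord0; exact: measurable_cst.
  by under eq_fun do rewrite big_ord_recr; exact: measurable_funM.
have prod0 k w : (0 <= \prod_(j < k) q j ^+ N j w)%R.
  by apply: prodr_ge0 => j _; exact: exprn_ge0.
(* The counts 0 .. k-1 are summed out; the event S k n fixes the remaining ones. *)
suff: forall k, (k <= m)%N -> forall n,
    \int[P]_(w in S k n) (\prod_(j < k) q j ^+ N j w)%R%:E =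
    \prod_(j < m) (if (j < k)%N then (e j)%:E else (W j (n j))%:E).
  move=> /(_ m (leqnn m) (fun=> 0%N)).
  rewrite (_ : S m _ = setT) => [->|].
    by apply: eq_bigr => j _; rewrite ltn_ord.
  by apply/seteqP; split=> // w _ j /andP[/leq_ltn_trans h /h]; rewrite ltnn.
elim=> [_ n|k IH km n].
  under eq_integral do rewrite big_ord0.
  by rewrite integral_cst//= mul1e HP.
pose upd a j := if j == k then a else n j.
have SE : S k.+1 n = \bigcup_a S k (upd a).
  apply/seteqP; split=> w /=.
    move=> Sw; exists (N k w) => // j /andP[kj jm]; rewrite /upd.
    by case: eqP => [->//|/eqP jk]; apply: Sw; rewrite ltn_neqAle eq_sym jk kj.
  move=> [a _ Sw] j /andP[kj jm]; rewrite Sw ?jm ?(ltnW kj)// /upd.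
  by rewrite gtn_eqF.
rewrite SE ge0_integral_bigcup//; last 3 first.
- by apply: measurable_funTS; exact/measurable_EFinP.
- by move=> w _; rewrite lee_fin.
- apply/trivIsetP => a b _ _ ab; apply/seteqP; split=> // w [/= Sa Sb].
  have := Sa k; have := Sb k; rewrite leqnn km /upd eqxx => -> // /(_ isT) ba.
  by rewrite ba eqxx in ab.
have intS a : \int[P]_(w in S k (upd a)) (\prod_(j < k.+1) q j ^+ N j w)%R%:E =
    (q k ^+ a * W k a)%:E * \prod_(j < m | j != Ordinal km)
      (if (j < k.+1)%N then (e j)%:E else (W j (n j))%:E).
  transitivity (\int[P]_(w in S k (upd a))
      ((q k ^+ a)%:E * (\prod_(j < k) q j ^+ N j w)%R%:E)).
    apply: eq_integral => w; rewrite inE => Sw; rewrite big_ord_recr/= -EFinM mulrC.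
    by rewrite (Sw k) ?leqnn// /upd eqxx.
  rewrite ge0_integralZl//; last 3 first.
  - by apply: measurable_funTS; exact/measurable_EFinP.
  - by move=> w _; rewrite lee_fin.
  - by rewrite lee_fin exprn_ge0.
  rewrite IH ?(ltnW km)// (bigD1 (Ordinal km))//= ltnn /upd eqxx muleA -EFinM.
  congr (_ * _); apply: eq_bigr => j jk.
  have {}jk : (j != k :> nat) by move: jk; rewrite -val_eqE.
  by rewrite ltnS [in RHS]leq_eqVlt (negPf jk).
under eq_eseriesr => a _ do rewrite intS muleC.
have -> : \prod_(j < m | j != Ordinal km)
    (if (j < k.+1)%N then (e j)%:E else (W j (n j))%:E) =
  (\prod_(j < m | j != Ordinal km) if (j < k.+1)%N then e j else W j (n j))%R%:E.
  rewrite (big_morph EFin EFinM erefl); apply: eq_bigr => j _; by case: ifP.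
rewrite nneseriesZl; last by move=> a _; rewrite lee_fin mulr_ge0 ?exprn_ge0.
rewrite qW [RHS](bigD1 (Ordinal km))//= ltnSn muleC; congr (_ * _).
rewrite (big_morph EFin EFinM erefl); apply: eq_bigr => j _; by case: ifP.
Qed.

End product_of_counts.

Section counts.
Context d (T : measurableType d) (R : realType) (P : probability T R).
Variables (lam : R) (X : nat -> T -> R * R).
Hypotheses (lam0 : (0 < lam)%R) (mX : forall i, measurable_fun setT (X i))
  (HX : is_poisson_process P lam X).

Lemma measurable_point_count (A : set (R * R)) : measurable A ->
  measurable_fun setT (fun w => point_count X w A).
Proof.
move=> mA; apply: ge0_emeasurable_sum => // i _.
rewrite (_ : (fun w => _) = (fun w => (\1_(X i @^-1` A) w : R)%:E)); last first.
  by apply/funext => w; rewrite diracE indicE.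
by apply/measurable_EFinP/measurable_indic; exact: mpreimage.
Qed.

(** The point count takes values in the extended reals and is finite only almost surely. *)
Definition finite_count (A : set (R * R)) : set T :=
  \bigcup_(c in [set: nat]) [set w | point_count X w A = c%:R%:E].

Lemma measurable_count_eq A (c : \bar R) : measurable A ->
  measurable [set w | point_count X w A = c].
Proof.
move=> mA; rewrite -[X in measurable X]setTI.
exact: (measurable_point_count mA _ (emeasurable_set1 c)).
Qed.

Lemma measurable_finite_count A : measurable A -> measurable (finite_count A).
Proof. by move=> mA; apply: bigcup_measurable => c _; exact: measurable_count_eq. Qed.

Lemma area_ge0 A : measurable A -> (0 <= fine (area A) :> R)%R.
Proof. by move=> mA; exact/fine_ge0/measure_ge0. Qed.

Lemma prob_count A (c : nat) : measurable A -> area A < +oo ->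
  P [set w | point_count X w A = c%:R%:E] =
  (poisson_weight (lam * fine (area A)) c)%:E.
Proof.
move=> mA finA.
have := @HX 1%N (fun=> A) (fun=> c).
rewrite big_ord1 => <- //; last by move=> j k; rewrite !ord1 eqxx.
by congr (P _); apply/seteqP; split=> w /= h; [move=> _|exact: h ord0].
Qed.

Lemma finite_count1 A : measurable A -> area A < +oo -> P (finite_count A) = 1.
Proof.
move=> mA finA; rewrite measure_bigcup//; last 2 first.
- by move=> c _; exact: measurable_count_eq.
- apply/trivIsetP => a b _ _ ab; apply/seteqP; split=> // w [/= -> [] /eqP].
  by rewrite eqr_nat => /eqP ba; rewrite ba eqxx in ab.
have L0 : (0 <= lam * fine (area A))%R by apply: mulr_ge0; [exact: ltW|exact: area_ge0].
transitivity (\sum_(0 <= n <oo) (1 ^+ n * poisson_weight (lam * fine (area A)) n)%:E).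
  rewrite eseries_mkcond; apply: eq_eseriesr => n _.
  by rewrite mem_set// [LHS]prob_count// expr1n mul1r.
by rewrite poisson_generating_function// subrr mulr0 oppr0 expR0.
Qed.

(** The partial sums of the point count, as natural numbers. *)
Definition hits (n : nat) (A : set (R * R)) (w : T) : nat :=
  (\sum_(i < n) (X i w \in A))%N.

Lemma hitsE n A w : \sum_(0 <= i < n) \d_(X i w) A = (hits n A w)%:R%:E :> \bar R.
Proof.
rewrite big_mkord /hits natr_sum -sumEFin; apply: eq_bigr => i _.
by rewrite diracE.
Qed.

(** A convergent sequence of natural numbers is eventually constant. *)
Lemma hits_eventually A w (c : nat) : point_count X w A = c%:R%:E ->
  \forall n \near \oo, hits n A w = c.
Proof.
move=> pc.
have hle n : (hits n A w <= c)%N.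
  by rewrite -(ler_nat R) -lee_fin -hitsE -pc; exact: nneseries_lim_ge.
have [n cn] : exists n, (c <= hits n A w)%N.
  apply/not_existsP => h.
  have c0 : (0 < c)%N by have /negP := h 0%N; rewrite -ltnNge; exact: leq_ltn_trans.
  suff : point_count X w A <= c.-1%:R%:E.
    by rewrite pc lee_fin ler_nat -{1}(prednK c0) ltnn.
  apply: lime_le; first exact: is_cvg_nneseries.
  apply: nearW => n; rewrite hitsE lee_fin ler_nat -ltnS prednK//.
  by have /negP := h n; rewrite -ltnNge.
exists n => // k /= nk; apply/eqP; rewrite eqn_leq hle (leq_trans cn)//.
by rewrite /hits -(subnKC nk) big_split_ord/= leq_addr.
Qed.

Definition count A w : nat := xget 0%N [set c : nat | point_count X w A = c%:R%:E].

Lemma countE A w (c : nat) : point_count X w A = c%:R%:E -> count A w = c.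
Proof.
move=> pc; rewrite /count; case: xgetP => [k _ /=|/(_ c)]; last by move/(_ pc).
by rewrite pc => -[] /eqP; rewrite eqr_nat => /eqP.
Qed.

Lemma measurable_count A (c : nat) : measurable A -> measurable (count A @^-1` [set c]).
Proof.
move=> mA.
have [->|c0] := eqVneq c 0%N.
  rewrite (_ : _ @^-1` _ = [set w | point_count X w A = 0%:R%:E] `|` ~` finite_count A).
    apply: measurableU; first exact: measurable_count_eq.
    by apply: measurableC; exact: measurable_finite_count.
  apply/seteqP; split=> w /=.
    move=> c0; have [[k _ /= pk]|] := pselect (finite_count A w); last by right.
    by left; rewrite -c0 (countE pk).
  case=> [/countE//|nf]; rewrite /count; case: xgetP => // k _ pk.
  by exfalso; apply: nf; exists k.
rewrite (_ : _ @^-1` _ = [set w | point_count X w A = c%:R%:E]).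
  exact: measurable_count_eq.
apply/seteqP; split=> w /= => [|/countE//].
rewrite /count; case: xgetP => [k -> pk <-//|_ c0'].
by rewrite -c0' eqxx in c0.
Qed.

(** For a simple p with value c j on A j, the product of the 1 - p (X i) over the first n
    points is a product over j of powers of 1 - c j, whose exponents are counts. The counts
    are independent Poisson variables, and bounded convergence lets n grow. *)
Lemma pgfl_simple (m : nat) (A : nat -> set (R * R)) (c : nat -> R) :
  (forall j, measurable (A j)) -> (forall j, area (A j) < +oo) ->
  (forall j k, j != k -> A j `&` A k = set0) ->
  (forall j, 0 <= c j <= 1)%R ->
  \int[P]_w (\prod_(i < n) (1 - \sum_(j < m) c j * \1_(A j) (X i w)))%R%:E
    @[n --> \oo] --> \prod_(j < m) (expR (- (lam * fine (area (A j)) * c j)))%:E.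
Proof.
move=> mA finA disj c01.
(* A point of A j survives with probability q j. *)
pose q j := (1 - c j)%R.
have q0 j : (0 <= q j)%R by rewrite subr_ge0; have /andP[] := c01 j.
have q1 j : (q j <= 1)%R by rewrite lerBlDr lerDl; have /andP[] := c01 j.
have factorE x : (1 - \sum_(j < m) c j * \1_(A j) x = \prod_(j < m) q j ^+ (x \in A j))%R.
  have [[j /= Aj]|no] := pselect (exists j : 'I_m, x \in A j).
    have no k : k != j -> (x \in A k) = false.
      move=> kj; apply/negP => Ak.
      by rewrite -[False]/(set0 x) -(disj k j kj); split; rewrite -inE.
    rewrite (bigD1 j)//= [X in (1 - (_ + X))%R]big1 => [|k kj]; last first.
      by rewrite indicE no ?mulr0.
    rewrite addr0 indicE Aj mulr1 (bigD1 j)//= Aj expr1 big1 ?mulr1// => k kj.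
    by rewrite no.
  have {}no (j : 'I_m) : (x \in A j) = false by apply/negP => h; apply: no; exists j.
  rewrite !big1 ?subr0// => j _; first by rewrite no.
  by rewrite indicE no mulr0.
have prodE n w : (\prod_(i < n) (1 - \sum_(j < m) c j * \1_(A j) (X i w)) =
    \prod_(j < m) q j ^+ hits n (A j) w)%R.
  under eq_bigr do rewrite factorE.
  by rewrite exchange_big/=; apply: eq_bigr => j _; rewrite expr_sum.
rewrite (_ : \prod_(j < m) _ = \int[P]_w (\prod_(j < m) q j ^+ count (A j) w)%R%:E); last first.
  apply/esym; apply: (@expectation_prod_counts _ _ _ _ (fun j => count (A j)) m q
    (fun j => poisson_weight (lam * fine (area (A j))))
    (fun j => expR (- (lam * fine (area (A j)) * c j)))) => //.
  - by move=> j k; exact: measurable_count.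
  - move=> j k; apply: poisson_weight_ge0.
    by apply: mulr_ge0; [exact: ltW|exact: area_ge0].
  - move=> j; rewrite poisson_generating_function//.
      by rewrite /q opprB addrC subrK.
    by apply: mulr_ge0; [exact: ltW|exact: area_ge0].
  - move=> k.
    have := @HX m (fun j => A j) (fun j => k j) (fun=> mA _) (fun=> finA _).
    move=> <-; last by move=> i j ij; exact: disj.
    apply: (@eq_probability_full _ _ _ P (\bigcap_j finite_count (A j))).
    + by apply: bigcapT_measurable => j; exact: measurable_finite_count.
    + rewrite [X in measurable X](_ : _ =
        \bigcap_(j in `I_m) (count (A j) @^-1` [set k j]))//.
      by apply: fin_bigcap_measurable => // j _; exact: measurable_count.
    + rewrite [X in measurable X](_ : _ =
        \bigcap_(j in [set: 'I_m]) [set w | point_count X w (A j) = (k j)%:R%:E]).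
        by apply: fin_bigcap_measurable => // j _; exact: measurable_count_eq.
      by apply/seteqP; split=> w /= h j; [move=> _; exact: h|exact: h].
    + apply: probability_bigcap1 => [j|j]; first exact: measurable_finite_count.
      exact: finite_count1.
    + apply/seteqP; split=> w /= [h fin]; split => // j.
        have [a _ /= pa] := fin j I.
        by rewrite pa -(countE pa) h.
      by move=> jm; exact: countE (h (Ordinal jm)).
have hitsm n j : measurable_fun setT (fun w => q j ^+ hits n (A j) w)%R.
  rewrite (_ : (fun w => _) = (fun w => \prod_(i < n) q j ^+ (X i w \in A j))%R); last first.
    by apply/funext => w; rewrite expr_sum.
  elim: n => [|n IH]; first by under eq_fun do rewrite big_ord0; exact: measurable_cst.
  under eq_fun do rewrite big_ord_recr/=.
  apply: measurable_funM => //.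
  rewrite (_ : (fun w => _) = (fun w => 1 - c j * \1_(X n @^-1` A j) w)%R).
    apply: measurable_funB => //; apply: measurable_funM => //.
    by apply: measurable_indic; exact: mpreimage.
  apply/funext => w; rewrite indicE.
  have -> : (w \in X n @^-1` A j) = (X n w \in A j) by apply/idP/idP; rewrite !inE.
  by case: (X n w \in A j); rewrite /= ?mulr1 ?mulr0 ?subr0 ?expr1 ?expr0.
have mprod (f : nat -> T -> R) k : (forall j, measurable_fun setT (f j)) ->
    measurable_fun setT (fun w => \prod_(j < k) f j w)%R.
  move=> mf; elim: k => [|k IH].
    by under eq_fun do rewrite big_ord0; exact: measurable_cst.
  by under eq_fun do rewrite big_ord_recr; exact: measurable_funM.
under eq_fun do under eq_integral do rewrite prodE.
apply: (bounded_cvg (O := \bigcap_j finite_count (A j))) => //.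
- by move=> n; apply: (mprod (fun j w => q j ^+ hits n (A j) w)%R) => j; exact: hitsm.
- apply: (mprod (fun j w => q j ^+ count (A j) w)%R) => j _ B _; rewrite setTI.
  rewrite (_ : _ @^-1` B = \bigcup_(k in [set k | B (q j ^+ k)%R]) (count (A j) @^-1` [set k])).
    by apply: bigcup_measurable => k _; exact: measurable_count.
  by apply/seteqP; split=> [w Aw|w [k Ak /= Nk]]; [exists (count (A j) w)|rewrite Nk].
- move=> n w; apply/andP; split; first by apply: prodr_ge0 => j _; exact: exprn_ge0.
  apply: prodr_ile1 => j; rewrite exprn_ge0//= exprn_ile1//.
- by apply: bigcapT_measurable => j; exact: measurable_finite_count.
- apply: probability_bigcap1 => [j|j]; first exact: measurable_finite_count.
  exact: finite_count1.
- move=> w fin; apply: cvg_near_cst.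
  suff: \forall n \near \oo, forall j, (j < m)%N -> hits n (A j) w = count (A j) w.
    by apply: filterS => n h; apply: eq_bigr => j _; rewrite h.
  elim: (m) => [|k IH]; first by apply: nearW => n j.
  have [a _ /= pa] := fin k I.
  have := hits_eventually pa; rewrite -(countE pa) => Hk.
  near=> n => j; rewrite ltnS leq_eqVlt => /orP[/eqP ->|].
    by near: n.
  by move: j; near: n.
Unshelve. all: by end_near. Qed.

End counts.

Section pgfl.
Context d (T : measurableType d) (R : realType) (P : probability T R).
Variables (lam : R) (X : nat -> T -> R * R).
Hypotheses (lam0 : (0 < lam)%R) (mX : forall i, measurable_fun setT (X i))
  (HX : is_poisson_process P lam X).

Local Notation plane := (@lebesgue_measure R \x @lebesgue_measure R).

(** If point i is deleted with probability p (X i), this is the probability that the first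
    n points all survive. *)
Definition survival (p : R * R -> R) n :=
  \int[P]_w (\prod_(i < n) (1 - p (X i w)))%R%:E.

Lemma measurable_survival (p : R * R -> R) n : measurable_fun setT p ->
  measurable_fun setT (fun w => \prod_(i < n) (1 - p (X i w)))%R.
Proof.
move=> mp; elim: n => [|n IH].
  by under eq_fun do rewrite big_ord0; exact: measurable_cst.
under eq_fun do rewrite big_ord_recr; apply: measurable_funM => //.
by apply: measurable_funB => //; exact: measurableT_comp.
Qed.

Lemma survival_nonincreasing (p : R * R -> R) : measurable_fun setT p -> (forall x, 0 <= p x <= 1)%R ->
  nonincreasing_seq (survival p).
Proof.
move=> mp p01; apply/nonincreasing_seqP => n.
have q0 w : (0 <= \prod_(i < n) (1 - p (X i w)))%R.
  by apply: prodr_ge0 => i _; rewrite subr_ge0; have /andP[] := p01 (X i w).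
apply: ge0_le_integral => //.
- move=> w _; rewrite lee_fin big_ord_recr mulr_ge0//.
  by rewrite subr_ge0; have /andP[] := p01 (X n w).
- by apply/measurable_EFinP; exact: measurable_survival.
- by apply/measurable_EFinP; exact: measurable_survival.
- move=> w _; rewrite lee_fin big_ord_recr ler_piMr//.
  by rewrite lerBlDr lerDl; have /andP[] := p01 (X n w).
Qed.

Lemma le_survival (p p' : R * R -> R) n : measurable_fun setT p -> measurable_fun setT p' ->
  (forall x, 0 <= p x)%R -> (forall x, p x <= p' x <= 1)%R ->
  survival p' n <= survival p n.
Proof.
move=> mp mp' p0 pp'; apply: ge0_le_integral => //.
- move=> w _; rewrite lee_fin prodr_ge0// => i _.
  by rewrite subr_ge0; have /andP[] := pp' (X i w).
- by apply/measurable_EFinP; exact: measurable_survival.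
- by apply/measurable_EFinP; exact: measurable_survival.
- move=> w _; rewrite lee_fin; apply: ler_prod => i _.
  by have /andP[pp p1] := pp' (X i w); rewrite subr_ge0 p1 lerB.
Qed.

(** Squares exhaust the plane and have finite area; the finite area is what a Poisson
    process requires of the sets on which it is counted. *)
Definition square (k : nat) : set (R * R) :=
  `[(- k%:R)%R, (k%:R)%R]%classic `*` `[(- k%:R)%R, (k%:R)%R]%classic.

Lemma measurable_square k : measurable (square k).
Proof. exact: measurableX. Qed.

Lemma area_square k : area (square k) < +oo.
Proof.
rewrite /area/= product_measure1E//= lebesgue_measure_itv/=.
by case: ifP => _; rewrite ?mul0e// -EFinB -EFinM ltry.
Qed.

Definition level_set (p : R * R -> R) (k j : nat) : set (R * R) :=
  square k `&` [set x | Num.truncn (p x * k.+1%:R) = j].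

(** The simple function below p that rounds p down to a multiple of 1/(k+1) on the square
    of half-side k and vanishes outside. *)
Definition level_approx (p : R * R -> R) (k : nat) (x : R * R) : R :=
  (\sum_(j < k.+2) (j%:R / k.+1%:R) * \1_(level_set p k j) x)%R.

Lemma measurable_level_set (p : R * R -> R) k j : measurable_fun setT p -> (forall x, 0 <= p x)%R ->
  measurable (level_set p k j).
Proof.
move=> mp p0; apply: measurableI; first exact: measurable_square.
rewrite (_ : [set x | _] = (fun x => p x * k.+1%:R)%R @^-1` `[j%:R, j.+1%:R[%classic).
  by apply: mpreimage => //; apply: measurable_funM.
apply/seteqP; split=> x /=; rewrite in_itv/=.
  by move=> <-; apply: truncn_itv; rewrite mulr_ge0.
by move/truncn_def.
Qed.

Lemma level_approxE (p : R * R -> R) k x : (0 <= p x <= 1)%R -> level_approx p k x =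
  (if x \in square k then (Num.truncn (p x * k.+1%:R))%:R / k.+1%:R else 0)%R.
Proof.
move=> /andP[p0 p1]; rewrite /level_approx; case: ifPn => [xk|xk]; last first.
  rewrite big1// => j _; rewrite indicE memNset ?mulr0// => -[+ _].
  by move: xk; rewrite notin_setE.
have jk : (Num.truncn (p x * k.+1%:R) < k.+2)%N.
  rewrite ltnS; have := truncn_le (p x * k.+1%:R); rewrite mulr_ge0// => h.
  by rewrite -(ler_nat R) (le_trans h)// ler_piMl.
rewrite (bigD1 (Ordinal jk))//= big1 => [|j /eqP jx].
  by rewrite addr0 indicE mem_set ?mulr1//; split => //; rewrite -inE.
rewrite indicE memNset ?mulr0// => -[_ /= e]; apply: jx.
by apply: val_inj; rewrite /= e.
Qed.

Lemma level_approx_le (p : R * R -> R) k x : (0 <= p x <= 1)%R -> (0 <= level_approx p k x <= p x)%R.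
Proof.
move=> p01; rewrite level_approxE//; case: ifP => _; last by rewrite lexx; case/andP: p01.
rewrite divr_ge0//= ler_pdivrMr//.
by have := truncn_le (p x * k.+1%:R); rewrite mulr_ge0//; case/andP: p01.
Qed.

Lemma level_approx_cvg (p : R * R -> R) x : (0 <= p x <= 1)%R -> level_approx p k x @[k --> \oo] --> p x.
Proof.
move=> p01.
have lim0 : (p x - harmonic k)%R @[k --> \oo] --> p x.
  by rewrite -[X in _ --> X]subr0; apply: cvgB; [exact: cvg_cst|exact: cvg_harmonic].
apply: (squeeze_cvgr _ lim0 (cvg_cst (p x))).
near=> k.
have xk : x \in square k.
  have h : (Num.max `|x.1| `|x.2| <= k%:R)%R.
    by near: k; exact: nbhs_infty_ger.
  rewrite inE; move: h; rewrite ge_max !ler_norml.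
  by move=> /andP[h1 h2]; split; rewrite /= in_itv.
have /andP[_ ->] := level_approx_le k p01; rewrite andbT.
rewrite level_approxE// xk /harmonic/= ler_pdivlMr// mulrBl mulVf// lerBlDr.
by rewrite natr1; apply/ltW/truncnS_gt.
Unshelve. all: by end_near. Qed.

Lemma measurable_level_approx (p : R * R -> R) k : measurable_fun setT p -> (forall x, 0 <= p x)%R ->
  measurable_fun setT (level_approx p k).
Proof.
move=> mp p0; apply: measurable_sum => j; apply: measurable_funM => //.
by apply: measurable_indic; exact: measurable_level_set.
Qed.

(** The values j/(k+1) are taken on the disjoint sets [level_set p k j], so
    [pgfl_simple] applies, and the product of exponentials is the exponential of the
    integral of the simple function. *)
Lemma survival_level_approx (p : R * R -> R) k : measurable_fun setT p -> (forall x, 0 <= p x <= 1)%R ->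
  survival (level_approx p k) n @[n --> \oo] -->
  expeR (- (lam%:E * \int[plane]_x (level_approx p k x)%:E)).
Proof.
move=> mp p01.
have p0 x : (0 <= p x)%R by case/andP: (p01 x).
pose c j : R := (if (j < k.+2)%N then j%:R / k.+1%:R else 0)%R.
have mL j := measurable_level_set k j mp p0.
have fL j : area (level_set p k j) < +oo.
  apply: le_lt_trans (area_square k); apply: le_measure => //; rewrite ?inE//.
  - exact: mL.
  - exact: measurable_square.
  - by move=> x [].
have aE j : (fine (area (level_set p k j)))%:E = plane (level_set p k j).
  by rewrite fineK// ge0_fin_numE// measure_ge0.
have c01 j : (0 <= c j <= 1)%R.
  rewrite /c; case: ifP => jk; rewrite ?lexx ?ler01//.
  by rewrite divr_ge0//= ler_pdivrMr// mul1r ler_nat -ltnS.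
have cvg := @pgfl_simple _ _ _ P _ _ lam0 mX HX k.+2 (level_set p k) c mL fL _ c01.
have lE x : (\sum_(j < k.+2) c j * \1_(level_set p k j) x)%R = level_approx p k x.
  by apply: eq_bigr => j _; rewrite /c ltn_ord.
have -> : expeR (- (lam%:E * \int[plane]_x (level_approx p k x)%:E)) =
    \prod_(j < k.+2) (expR (- (lam * fine (area (level_set p k j)) * c j)))%:E.
  under eq_integral do rewrite -lE -sumEFin.
  rewrite ge0_integral_sum//=; last 2 first.
  - move=> j; apply/measurable_EFinP; apply: measurable_funM => //.
    by apply: measurable_indic; exact: mL.
  - by move=> j x _; rewrite lee_fin mulr_ge0//; case/andP: (c01 j).
  rewrite (eq_bigr (fun j : 'I_k.+2 => (c j * fine (area (level_set p k j)))%:E)).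
    rewrite sumEFin -EFinM -EFinN/= -(big_morph EFin EFinM erefl) -expR_sum.
    congr ((expR _)%:E); rewrite mulr_sumr -sumrN; apply: eq_bigr => j _.
    by congr (- _)%R; ring.
  move=> j _; under eq_integral do rewrite EFinM.
  rewrite ge0_integralZl//; last 2 first.
  - by apply/measurable_EFinP; apply: measurable_indic; exact: mL.
  - by rewrite lee_fin; case/andP: (c01 j).
  rewrite integral_indic//=; last exact: mL.
  by rewrite EFinM aE ?setIT.
have -> : survival (level_approx p k) = fun n => \int[P]_w
    (\prod_(i < n) (1 - \sum_(j < k.+2) c j * \1_(level_set p k j) (X i w)))%R%:E.
  apply/funext => n; apply: eq_integral => w _; congr (_%:E).
  by apply: eq_bigr => i _; rewrite lE.
apply: cvg => i j ij; apply/seteqP; split=> // x [[_ /= xi] [_ /= xj]].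
by rewrite -xi xj eqxx in ij.
Qed.

Lemma survival_cvg_level_approx (p : R * R -> R) n : measurable_fun setT p ->
  (forall x, 0 <= p x <= 1)%R ->
  survival (level_approx p k) n @[k --> \oo] --> survival p n.
Proof.
move=> mp p01.
have p0 x : (0 <= p x)%R by case/andP: (p01 x).
have l01 k x : (0 <= 1 - level_approx p k x <= 1)%R.
  have /andP[l0 lp] := level_approx_le k (p01 x); rewrite subr_ge0 lerBlDr lerDl l0 andbT.
  by rewrite (le_trans lp)//; case/andP: (p01 x).
apply: (bounded_cvg (O := setT)) => //.
- by move=> k; apply: measurable_survival; exact: measurable_level_approx.
- exact: measurable_survival.
- move=> k w; rewrite prodr_ge0/=; last by move=> i _; case/andP: (l01 k (X i w)).
  by apply: prodr_ile1 => i _; exact: l01.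
- exact: probability_setT.
- move=> w _; elim: n => [|n IH].
    by under eq_fun do rewrite big_ord0; rewrite big_ord0; exact: cvg_cst.
  under eq_fun do rewrite big_ord_recr/=; rewrite big_ord_recr/=.
  apply: cvgM => //; apply: cvgB; first exact: cvg_cst.
  exact: level_approx_cvg.
Qed.

(** The limit exists by monotonicity in n. It is at most the exponential attached to each
    approximation, since survival decreases in p, and Fatou's lemma passes to p. It is at
    least the exponential because the survival of n points converges along the
    approximations, where it dominates the survival of all points. *)
Theorem poisson_generating_functional (p : R * R -> R) : measurable_fun setT p ->
  (forall x, 0 <= p x <= 1)%R ->
  survival p n @[n --> \oo] --> expeR (- (lam%:E * \int[plane]_x (p x)%:E)).
Proof.
move=> mp p01.
have p0 x : (0 <= p x)%R by case/andP: (p01 x).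
have lp k x := level_approx_le k (p01 x).
have ml k := measurable_level_approx k mp p0.
have Ek k := survival_level_approx (k := k) mp p01.
have l01 k x : (0 <= level_approx p k x <= 1)%R.
  have /andP[l0 h] := lp k x; rewrite l0 (le_trans h)//.
  by case/andP: (p01 x).
have S0 (q : R * R -> R) n : (forall x, 0 <= q x <= 1)%R -> 0 <= survival q n.
  move=> q01; apply: integral_ge0 => w _; rewrite lee_fin prodr_ge0// => i _.
  by rewrite subr_ge0; case/andP: (q01 (X i w)).
set E := expeR _.
have cv := ereal_nonincreasing_is_cvgn (survival_nonincreasing mp p01).
suff : limn (survival p) = E by move=> <-.
apply/eqP; rewrite eq_le; apply/andP; split; last first.
  apply: lime_ge => //; apply: nearW => n.
  have cn := survival_cvg_level_approx (n := n) mp p01.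
  rewrite -(cvg_lim _ cn)//; apply: lime_ge; first by apply/cvg_ex; eexists; exact: cn.
  apply: nearW => k.
  apply: (@le_trans _ _ (expeR (- (lam%:E * \int[plane]_x (level_approx p k x)%:E)))).
    rewrite lee_expeR leeN2 lee_pmul2l//; apply: ge0_le_integral => //.
    - by move=> x _; rewrite lee_fin; case/andP: (lp k x).
    - by apply/measurable_EFinP; exact: ml.
    - by apply/measurable_EFinP; exact: mp.
    - by move=> x _; rewrite lee_fin; case/andP: (lp k x).
  rewrite -(cvg_lim _ (Ek k))//; apply: lime_le.
    by apply/cvg_ex; eexists; exact: Ek.
  near=> m.
  apply: survival_nonincreasing => //.
  by near: m; exists n.
set l := limn _.
have l0 : 0 <= l by apply: lime_ge => //; apply: nearW => n; exact: S0.
have lE k : l <= expeR (- (lam%:E * \int[plane]_x (level_approx p k x)%:E)).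
  rewrite -(cvg_lim _ (Ek k))//; apply: lee_lim => //.
    by apply/cvg_ex; eexists; exact: Ek.
  apply: nearW => n; apply: le_survival => // x; first by case/andP: (lp k x).
  by have /andP[_ ->] := lp k x; case/andP: (p01 x).
have intle k : \int[plane]_x (level_approx p k x)%:E <= - lne l * (lam^-1)%:E.
  rewrite lee_pdivlMr// muleC -leeN2 oppeK -lee_expeR lneK ?in_itv/= ?l0 ?leey//.
suff : \int[plane]_x (p x)%:E <= - lne l * (lam^-1)%:E.
  rewrite lee_pdivlMr// muleC => h; rewrite -(@lneK _ l) ?in_itv/= ?l0 ?leey//.
  by rewrite lee_expeR -leeN2 oppeK.
have -> : (fun x => (p x)%:E) = (fun x => limn_einf (fun k => (level_approx p k x)%:E)).
  apply/funext => x; rewrite is_cvg_limn_einfE.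
    by apply/esym/cvg_lim => //; apply: cvg_EFin; [exact: nearW|exact: level_approx_cvg].
  by apply/cvg_ex; exists (p x)%:E; apply: cvg_EFin; [exact: nearW|exact: level_approx_cvg].
apply: le_trans; first apply: fatou => //.
- by move=> k; apply/measurable_EFinP; exact: ml.
- by move=> k x _; rewrite lee_fin; case/andP: (lp k x).
rewrite limn_einf_lim; apply: lime_le.
  exact: is_cvg_einfs.
apply: nearW => k; apply: le_trans (intle k).
by apply: ereal_inf_lbound; exists k => /=.
Unshelve. all: by end_near. Qed.
End pgfl.

(** * Locally finite configurations are determined by their void probabilities *)

Section increasing_enumeration.
Context (R : realType) (kk : nat -> R).
Hypothesis kk_inj : forall i j, i != j -> kk i != kk j.
Hypothesis kk_fin : forall r : R, exists N, forall i, (N <= i)%N -> (r <= kk i)%R.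

(** Only finitely many values lie below the value at any given element of B. *)
Lemma exists_argmin (B : set nat) : B !=set0 ->
  exists2 i, B i & forall j, B j -> (kk i <= kk j)%R.
Proof.
move=> [i0 Bi0].
suff aux N : exists i, [/\ B i, (kk i <= kk i0)%R &
    forall j, (j < N)%N -> B j -> (kk i <= kk j)%R].
  have [N hN] := kk_fin (kk i0); have [i [Bi ii0 hi]] := aux N.
  exists i => // j Bj; have [/hi|/hN] := ltnP j N; first exact.
  exact: le_trans.
elim: N => [|N [i [Bi ii0 hi]]]; first by exists i0.
have [/andP[/asboolP BN Ni]|h] := boolP (`[< B N >] && (kk N <= kk i)%R).
  exists N; split => // [|j]; first exact: le_trans ii0.
  rewrite ltnS leq_eqVlt => /orP[/eqP ->//|/hi jN /jN]; exact: le_trans.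
exists i; split => // j; rewrite ltnS leq_eqVlt => /orP[/eqP ->|/hi//] BN.
by move: h; rewrite negb_and -ltNge => /orP[/asboolP//|/ltW].
Qed.

(** Starting from the smallest value and passing each time to the least value above; local
    finiteness makes every index appear. *)
Lemma increasing_enumeration : exists2 s : nat -> nat, bijective s &
  forall k, (kk (s k) < kk (s k.+1))%R.
Proof.
have nxt (r : R) : {i | (r < kk i)%R /\ forall j, (r < kk j)%R -> (kk i <= kk j)%R}.
  apply/cid; have [|i] := @exists_argmin [set i | (r < kk i)%R].
    have [N hN] := kk_fin (r + 1)%R; exists N => /=.
    by rewrite (@lt_le_trans _ _ (r + 1)%R) ?ltrDl// hN.
  by move=> /= ri hi; exists i.
have [i0 _ hi0] := @exists_argmin setT (ex_intro _ 0%N I).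
pose s := fix s k := if k is k'.+1 then sval (nxt (kk (s k'))) else i0.
have incr k : (kk (s k) < kk (s k.+1))%R by rewrite /=; case: (nxt _) => i [].
have mono i j : (i < j)%N -> (kk (s i) < kk (s j))%R.
  elim: j => // j IH; rewrite ltnS leq_eqVlt => /orP[/eqP ->//|/IH h].
  exact: lt_trans h (incr j).
exists s => //; rewrite -setTT_bijective; split => //.
  move=> i j _ _ sij; case: (ltngtP i j) => // /mono; by rewrite sij ltxx.
move=> i _ /=; apply: contrapT => no.
have below k : (kk (s k) < kk i)%R.
  elim: k => [|k IH]; rewrite lt_neqAle.
    rewrite hi0// andbT; apply: kk_inj; apply/eqP => h; apply: no.
    by exists 0%N.
  rewrite kk_inj/=; last by apply/eqP => h; apply: no; exists k.+1.
  by case: (nxt _) => a [_ ha] /=; exact: ha.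
have [N hN] := kk_fin (kk i).
have sinj : injective s.
  move=> a b sab; case: (ltngtP a b) => // /mono; by rewrite sab ltxx.
have sN k : (s k < N)%N by rewrite ltnNge; apply/negP => /hN; rewrite leNgt below.
have := @leq_card 'I_N.+1 'I_N (fun k => Ordinal (sN k)).
rewrite !card_ord ltnn => h; apply: notF; apply: h => a b [] /sinj; exact: val_inj.
Qed.

End increasing_enumeration.

Section state.
Context (R : realType).

(** A configuration together with its randomness: the locations, and a sequence of marks.
    Mark k + 3 is the pair of the direction and the fading of base station k; marks 0, 1, 2
    carry, in their second component, the three fading variables that are attached to the
    roles of the named base stations, not to a particular base station. *)
Definition state : Type := (seqsp (R * R)%type * seqsp (R * R)%type)%type.
HB.instance Definition _ := Measurable.on state.

Definition pt (z : state) (i : nat) : (R * R) * (R * R) := (z.1 i, z.2 (i + 3)%N).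

(** Relabelling the base stations moves their locations, directions and fading variables
    together and leaves the three role fading variables in place. *)
Definition perm_state (s : nat -> nat) (z : state) : state :=
  (fun i => z.1 (s i), fun n => if (n < 3)%N then z.2 n else z.2 (s (n - 3) + 3)%N).

Definition perm_invariant {T} (f : state -> T) :=
  forall s z, bijective s -> f (perm_state s z) = f z.

Lemma measurable_state_x i : measurable_fun setT (fun z : state => z.1 i).
Proof.
exact: (@measurableT_comp _ _ _ _ _ _ (fun x : seqsp (R * R)%type => x i) setT fst
  (@measurable_coord _ _ i) measurable_fst).
Qed.

Lemma measurable_state_v i : measurable_fun setT (fun z : state => z.2 i).
Proof.
exact: (@measurableT_comp _ _ _ _ _ _ (fun x : seqsp (R * R)%type => x i) setT snd
  (@measurable_coord _ _ i) measurable_snd).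
Qed.

Lemma measurable_pt i : measurable_fun setT (fun z : state => pt z i).
Proof.
by apply: measurable_fun_pair; [exact: measurable_state_x|exact: measurable_state_v].
Qed.

(** Void events, with a side condition on the three role fading variables: their
    probabilities are exponentials of intensities, and by [transfer] they determine
    everything that does not depend on the labelling. *)
Definition void (A : set ((R * R) * (R * R))) (C : nat -> set (R * R)) : set state :=
  [set z | (forall i, ~ A (pt z i)) /\ (forall n, (n < 3)%N -> C n (z.2 n))].

Definition voids : set (set state) :=
  [set V | exists A C, [/\ measurable A, (forall n, measurable (C n)) & V = void A C]].

Lemma voids_setI : setI_closed voids.
Proof.
move=> _ _ [A [C [mA mC ->]]] [A' [C' [mA' mC' ->]]].
exists (A `|` A'), (fun n => C n `&` C' n); split.
- exact: measurableU.
- by move=> n; exact: measurableI.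
- apply/seteqP; split=> z /=.
    move=> [[zA zC] [zA' zC']]; split; last by move=> n n3; split; auto.
    by move=> i []; [exact: zA|exact: zA'].
  move=> [zA zC]; split; split=> [i Ai|n /zC[]//]; apply: (zA i); [by left|by right].
Qed.

Lemma voidsT : voids setT.
Proof.
exists set0, (fun=> setT); split => //.
by apply/seteqP; split => // z _; split => // i [].
Qed.

Lemma measurable_void A C : measurable A -> (forall n, measurable (C n)) ->
  measurable (void A C).
Proof.
move=> mA mC; rewrite (_ : void A C = \bigcap_i ((fun z => pt z i) @^-1` ~` A) `&`
    \bigcap_(n in `I_3) ((fun z : state => z.2 n) @^-1` C n)).
  apply: measurableI.
    apply: bigcapT_measurable => i; apply: mpreimage; first exact: measurable_pt.
    exact: measurableC.
  by apply: fin_bigcap_measurable => // n _; apply: mpreimage => //; exact: measurable_state_v.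
by apply/seteqP; split=> z [h1 h2]; split=> // i; [move=> _; exact: h1|exact: h1].
Qed.

(** A real number that separates the points of the network and has only finitely many
    values below any bound: the integer part locates the point among square shells, and the
    fractional part encodes its direction. An angle in [-pi, pi] gives (theta + 4)/8 in
    [0, 1) because pi < 4; the directions of distinct stations differ almost surely. *)
Definition key (p : (R * R) * (R * R)) : R :=
  ((Num.truncn (Num.max `|p.1.1| `|p.1.2|))%:R + (p.2.1 + 4) / 8)%R.

Lemma measurable_truncn : measurable_fun setT (fun x : R => (Num.truncn x)%:R : R).
Proof.
apply: nondecreasing_measurable => // x y *; rewrite ler_nat.
by apply: le_truncn; assumption.
Qed.

Lemma measurable_key : measurable_fun setT key.
Proof.
apply: measurable_funD; last first.
  apply: measurable_funM => //; apply: measurable_funD => //.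
  exact: measurableT_comp.
apply: (@measurableT_comp _ _ _ _ _ _ (fun x : R => (Num.truncn x)%:R : R)).
  exact: measurable_truncn.
by apply: measurable_maxr; apply: measurableT_comp => //; apply: measurableT_comp.
Qed.

Definition locally_finite_simple : set state :=
  [set z | (forall i j, i != j -> key (pt z i) != key (pt z j)) /\
    forall r : nat, exists N, forall i, (N <= i)%N -> (r%:R <= key (pt z i))%R].

Lemma measurable_locally_finite_simple : measurable locally_finite_simple.
Proof.
have mk i : measurable_fun setT (fun z => key (pt z i)).
  by apply: (@measurableT_comp _ _ _ _ _ _ key) => //; [exact: measurable_key|exact: measurable_pt].
rewrite (_ : locally_finite_simple =
  \bigcap_i \bigcap_(j in [set j | i != j]) [set z | key (pt z i) != key (pt z j)] `&`
  \bigcap_r \bigcup_N \bigcap_(i in [set i | (N <= i)%N])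
    [set z | (r%:R <= key (pt z i))%R]).
  apply: measurableI.
    apply: bigcapT_measurable => i; apply: bigcap_measurableType => j _.
    rewrite -[X in measurable X]setTI.
    by apply: measurable_neg => //; exact: measurable_fun_eqr.
  apply: bigcapT_measurable => r; apply: bigcupT_measurable => N.
  apply: bigcap_measurableType => i _.
  by rewrite -[X in measurable X]setTI; exact: measurable_fun_ler.
apply/seteqP; split=> z /=.
  move=> [h1 h2]; split; first by move=> i _ j; exact: h1.
  by move=> r _; have [N hN] := h2 r; exists N.
move=> [h1 h2]; split; first by move=> i j; exact: h1.
by move=> r; have [N _ hN] := h2 r I; exists N.
Qed.

Lemma sorting z : locally_finite_simple z -> exists2 s : nat -> nat, bijective s &
  forall k, (key (pt z (s k)) < key (pt z (s k.+1)))%R.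
Proof.
move=> [h1 h2]; apply: (@increasing_enumeration R (fun i => key (pt z i))) => // r.
have [N hN] := h2 (Num.truncn `|r|).+1; exists N => i /hN; apply: le_trans.
by rewrite (le_trans (ler_norm r))// ltW// truncnS_gt.
Qed.

(** Points are listed by increasing key. The identity is a default value, taken on
    configurations that cannot be sorted. *)
Definition sort_perm z : nat -> nat :=
  if pselect (locally_finite_simple z) is left h then sval (cid2 (sorting h)) else id.

Lemma sort_permP z : bijective (sort_perm z).
Proof.
rewrite /sort_perm; case: pselect => [h|_]; last by exists id.
by case: cid2.
Qed.

Lemma sort_perm_lt z k : locally_finite_simple z ->
  (key (pt z (sort_perm z k)) < key (pt z (sort_perm z k.+1)))%R.
Proof. by rewrite /sort_perm; case: pselect => // h _; case: cid2. Qed.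

Lemma sort_perm_mono z k l : locally_finite_simple z -> (k < l)%N ->
  (key (pt z (sort_perm z k)) < key (pt z (sort_perm z l)))%R.
Proof.
move=> h; elim: l => // l IH; rewrite ltnS leq_eqVlt => /orP[/eqP ->|/IH kl].
  exact: sort_perm_lt.
exact: lt_trans kl (sort_perm_lt l h).
Qed.

(** The sigma-algebra generated by the void events; being a pi-system, these determine a
    probability on it. *)
Definition void_space := g_sigma_algebraType voids.

Definition no_point (A : set ((R * R) * (R * R))) : set state := void A (fun=> setT).

Lemma measurable_no_point A : measurable A ->
  (measurable : set (set void_space)) (no_point A).
Proof. by move=> mA; apply: sub_sigma_algebra; exists A, (fun=> setT); split. Qed.

Lemma no_pointP A z : no_point A z <-> forall i, ~ A (pt z i).
Proof. by split=> [[]|] //; split. Qed.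

Definition key_in (q r : R) : set ((R * R) * (R * R)) :=
  [set p | (q <= key p < r)%R].

Lemma measurable_key_in q r : measurable (key_in q r).
Proof.
rewrite (_ : key_in q r = key @^-1` `[q, r[%classic); last first.
  by apply/seteqP; split=> p /=; rewrite in_itv.
by apply: mpreimage => //; exact: measurable_key.
Qed.

(** At least k points have key below q, written by void events and countable operations
    alone: there is a rational q' < q with at least k - 1 points below q' and one point
    in [q', q). *)
Fixpoint at_least (k : nat) (q : rat) : set state :=
  if k is k'.+1 then
    \bigcup_(q' in [set q' | (q' < q)%R])
      (at_least k' q' `&` ~` no_point (key_in (ratr q') (ratr q)))
  else setT.

Lemma bigcup_rat_measurable d (T : measurableType d) (D : set rat) (F : rat -> set T) :
  (forall q, D q -> measurable (F q)) -> measurable (\bigcup_(q in D) F q).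
Proof.
move=> mF; rewrite bigcup_mkcond; apply: bigcupT_measurable_rat => q.
by case: ifPn => // qD; apply: mF; rewrite inE in qD.
Qed.

Lemma measurable_at_least k q : (measurable : set (set void_space)) (at_least k q).
Proof.
elim: k q => [|k IH] q /=; first exact: measurableT.
apply: bigcup_rat_measurable => q' _; apply: measurableI; first exact: IH.
by apply: measurableC; apply: measurable_no_point; exact: measurable_key_in.
Qed.

Lemma rat_below_kth z k : locally_finite_simple z -> exists q : rat,
  (ratr q < key (pt z (sort_perm z k)))%R /\
  forall j, (j < k)%N -> (key (pt z (sort_perm z j)) < ratr q)%R.
Proof.
move=> gz.
pose lo := if k is k'.+1 then key (pt z (sort_perm z k')) else
  (key (pt z (sort_perm z 0)) - 1)%R.
have lok : (lo < key (pt z (sort_perm z k)))%R.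
  by rewrite /lo; case: (k) => [|k']; [rewrite ltrBlDr ltrDl|exact: sort_perm_lt].
have [q /andP[loq qk]] := rat_in_itvoo lok; exists q; split=> // j.
move=> jk; apply: le_lt_trans loq.
move: jk; rewrite /lo; case: (k) => // k'; rewrite ltnS leq_eqVlt => /orP[/eqP ->//|jk].
by apply/ltW/sort_perm_mono.
Qed.

Lemma at_leastP k q z : locally_finite_simple z ->
  at_least k q z <-> forall j, (j < k)%N -> (key (pt z (sort_perm z j)) < ratr q)%R.
Proof.
move=> gz; elim: k q => [|k IH] q /=; first by split.
have [g gK Kg] := sort_permP z.
split=> [[q' /= q'q [/IH h /no_pointP hex]] j|h].
  have [i] : exists i, key_in (ratr q') (ratr q) (pt z i).
    by apply: contrapT => no; apply: hex => i hi; apply: no; exists i.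
  rewrite -(Kg i) => /andP[qi iq].
  have kg : (k <= g i)%N.
    rewrite leqNgt; apply/negP => /h; by rewrite ltNge qi.
  rewrite ltnS => jk; apply: le_lt_trans iq.
  have := leq_trans jk kg; rewrite leq_eqVlt => /orP[/eqP ->//|jg].
  by apply/ltW/sort_perm_mono.
have [q' [q'k lowq']] := rat_below_kth k gz.
exists q' => /=.
  by rewrite -(ltr_rat R) (lt_trans _ (h k _)).
split; first exact/IH.
move=> /no_pointP /(_ (sort_perm z k)); apply; rewrite /key_in/= ltW//=.
exact: h.
Qed.

(** A rational window [q, r) that starts above the first k points of the sorted list and
    contains a point of A but no point outside A. For a small enough window around the key
    of the point number k (from 0), these conditions hold exactly when that point is in A. *)
Definition kth_in (k : nat) (A : set ((R * R) * (R * R))) : set state :=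
  \bigcup_q \bigcup_r (at_least k q `&` ~` at_least k.+1 q `&`
    (no_point (~` A `&` key_in (ratr q) (ratr r)) `&`
     ~` no_point (A `&` key_in (ratr q) (ratr r)))).

Lemma measurable_kth_in k A : measurable A ->
  (measurable : set (set void_space)) (kth_in k A).
Proof.
move=> mA; apply: bigcup_rat_measurable => q _; apply: bigcup_rat_measurable => r _.
have mk := measurable_key_in (ratr q) (ratr r).
apply: measurableI.
  by apply: measurableI; [|apply: measurableC]; exact: measurable_at_least.
apply: measurableI; last apply: measurableC.
  by apply: measurable_no_point; apply: measurableI => //; exact: measurableC.
by apply: measurable_no_point; exact: measurableI.
Qed.

Lemma kth_inP k A z : locally_finite_simple z ->
  kth_in k A z <-> A (pt z (sort_perm z k)).
Proof.
move=> gz; have [g gK Kg] := sort_permP z; split.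
  move=> [q _ [r _ [[/at_leastP h /at_leastP h1] [/no_pointP nA /no_pointP hex]]]].
  have {}h := h gz; have {}h1 : (ratr q <= key (pt z (sort_perm z k)))%R.
    rewrite leNgt; apply/negP => hk; apply: h1 => // j; rewrite ltnS leq_eqVlt.
    by move=> /orP[/eqP ->//|]; exact: h.
  have [i [Ai]] : exists i, (A `&` key_in (ratr q) (ratr r)) (pt z i).
    by apply: contrapT => no; apply: hex => i hi; apply: no; exists i.
  rewrite -(Kg i) => /andP[qi ir].
  apply: contrapT => nAk; apply: (nA (sort_perm z k)); split => //.
  rewrite /key_in/= h1/=; apply: le_lt_trans ir.
  have kg : (k <= g i)%N.
    by rewrite leqNgt; apply/negP => /h; rewrite ltNge qi.
  move: kg; rewrite leq_eqVlt => /orP[/eqP ->//|kg].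
  by apply/ltW/sort_perm_mono.
move=> Ak.
have [q [qk lowq]] := rat_below_kth k gz.
have [r /andP[kr rk]] := rat_in_itvoo (sort_perm_lt k gz).
exists q => //; exists r => //; split; split.
- exact/at_leastP.
- by move=> /at_leastP h; have := h gz k (ltnSn k); rewrite ltNge ltW.
- apply/no_pointP => i [nAi]; rewrite -(Kg i) => /andP[qi ir]; apply: nAi.
  suff gik : g i = k by rewrite -(Kg i) gik.
  case: (ltngtP (g i) k) => // h.
    by have := lowq _ h; rewrite ltNge qi.
  exfalso; have : (key (pt z (sort_perm z k.+1)) <= key (pt z (sort_perm z (g i))))%R.
      move: h; rewrite leq_eqVlt => /orP[/eqP ->//|h].
    by apply/ltW/sort_perm_mono.
  by rewrite leNgt (lt_trans ir).
- move=> /no_pointP /(_ (sort_perm z k)); apply; split => //.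
  by rewrite /key_in/= (ltW qk).
Qed.

Definition sort_state z := perm_state (sort_perm z) z.

(** The sets that coincide with an element of the void sigma-algebra on the configurations
    that can be sorted: the natural class in which the sorted configuration is measurable. *)
Definition void_trace : set (set state) :=
  [set W | exists2 V, (measurable : set (set void_space)) V &
    forall z, locally_finite_simple z -> (W z <-> V z)].

Lemma sigma_algebra_void_trace : sigma_algebra setT void_trace.
Proof.
split.
- by exists set0.
- move=> W [V mV WV]; exists (~` V); first exact: measurableC.
  by move=> z gz; rewrite setTD /= WV.
- move=> W hW.
  have /choice[V hV] : forall n, exists V, (measurable : set (set void_space)) V /\
      forall z, locally_finite_simple z -> (W n z <-> V z).
    by move=> n; have [V mV WV] := hW n; exists V.
  exists (\bigcup_n V n); first by apply: bigcupT_measurable => n; case: (hV n).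
  move=> z gz; split=> -[n _ h]; exists n => //.
    by case: (hV n) => _ /(_ z gz) [+ _]; apply.
  by case: (hV n) => _ /(_ z gz) [_ +]; apply.
Qed.

(** Coordinates of the sorted configuration are described by [kth_in], and coordinates
    generate the sigma-algebra of states. *)
Lemma sort_state_trace (G : set state) : measurable G ->
  exists2 V, (measurable : set (set void_space)) V &
    forall z, locally_finite_simple z -> (G (sort_state z) <-> V z).
Proof.
pose ST := g_sigma_algebraType void_trace.
have mST : (measurable : set (set ST)) = void_trace.
  exact: sigma_algebra_id sigma_algebra_void_trace.
suff ms : measurable_fun setT (sort_state : ST -> state).
  move=> mG; have := ms measurableT _ mG; rewrite setTI => h.
  have {h} : void_trace (sort_state @^-1` G) by rewrite -mST.
  by [].
apply: measurable_fun_pair; apply: measurable_seqspP => n _ B mB;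
  rewrite setTI mST /sort_state /perm_state /=.
  exists (kth_in n (fst @^-1` B)).
    by apply: measurable_kth_in; exact: mpreimage.
  by move=> z gz; rewrite kth_inP.
have [n3|n3] := ltnP n 3.
  exists (void set0 (fun m => if m == n then B else setT)).
    apply: sub_sigma_algebra; eexists _, _; split; [| |reflexivity] => //.
    by move=> m /=; case: ifP.
  move=> z _; split=> [zB|[_ /(_ n n3)]]; last by rewrite eqxx.
  by split=> [i []//|m _]; case: eqP => // ->.
exists (kth_in (n - 3) (snd @^-1` B)).
  by apply: measurable_kth_in; exact: mpreimage.
by move=> z gz; rewrite kth_inP.
Qed.

End state.

Section transfer.
Context (R : realType).

Definition same_voids d1 d2 (T1 : measurableType d1) (T2 : measurableType d2)
    (P1 : probability T1 R) (P2 : probability T2 R)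
    (Z1 : T1 -> state R) (Z2 : T2 -> state R) :=
  forall A C, measurable A -> (forall n, measurable (C n)) ->
    P1 (Z1 @^-1` void A C) = P2 (Z2 @^-1` void A C).

Context d1 d2 (T1 : measurableType d1) (T2 : measurableType d2)
    (P1 : probability T1 R) (P2 : probability T2 R)
    (Z1 : T1 -> state R) (Z2 : T2 -> state R).
Hypotheses (mZ1 : measurable_fun setT Z1) (mZ2 : measurable_fun setT Z2).
Hypotheses (good1 : P1 (Z1 @^-1` @locally_finite_simple R) = 1)
  (good2 : P2 (Z2 @^-1` @locally_finite_simple R) = 1).
Hypothesis ZZ : same_voids P1 P2 Z1 Z2.

Lemma void_space_sub V : (measurable : set (set (void_space R))) V ->
  (measurable : set (set (state R))) V.
Proof.
apply: smallest_sub; first exact: sigma_algebra_measurable.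
by move=> _ [A [C [mA mC ->]]]; exact: measurable_void.
Qed.

Lemma eq_on_void_space V : (measurable : set (set (void_space R))) V ->
  P1 (Z1 @^-1` V) = P2 (Z2 @^-1` V).
Proof.
have m1 : measurable_fun setT (Z1 : T1 -> void_space R).
  by move=> _ A mA; exact: (mZ1 measurableT (void_space_sub mA)).
have m2 : measurable_fun setT (Z2 : T2 -> void_space R).
  by move=> _ A mA; exact: (mZ2 measurableT (void_space_sub mA)).
have := @finite_measure_unique _ (void_space R) R (@voids R)
  (distribution P1 (mkmfun m1)) (distribution P2 (mkmfun m2)) erefl
  (@voids_setI R) (@voidsT R); apply.
- by change (P1 setT < +oo); rewrite probability_setT ltry.
- by move=> _ [A [C [mA mC ->]]]; exact: ZZ.
Qed.

(** A set that is invariant under relabelling is unchanged by sorting, so it agrees with a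
    set of the void sigma-algebra by [sort_state_trace]; on that sigma-algebra the two laws
    are equal, since they agree on the pi-system of void events. *)
Theorem transfer_set (G : set (state R)) : measurable G -> perm_invariant G ->
  P1 (Z1 @^-1` G) = P2 (Z2 @^-1` G).
Proof.
move=> mG Ginv; have [V mV GV] := sort_state_trace mG.
have {}GV z : locally_finite_simple z -> G z <-> V z.
  by move=> gz; rewrite -GV// /sort_state Ginv//; exact: sort_permP.
have mV' := void_space_sub mV.
have mL := @measurable_locally_finite_simple R.
transitivity (P1 (Z1 @^-1` V)).
  apply: (eq_probability_full _ _ _ good1); try exact: mpreimage.
  by apply/seteqP; split=> w [/= h1 h2]; split=> //; apply/GV.
rewrite eq_on_void_space//.
apply: (eq_probability_full _ _ _ good2); try exact: mpreimage.
by apply/seteqP; split=> w [/= h1 h2]; split=> //; apply/GV.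
Qed.

Theorem transfer (f : state R -> \bar R) : measurable_fun setT f -> (forall z, 0 <= f z) ->
  perm_invariant f -> \int[P1]_w f (Z1 w) = \int[P2]_w f (Z2 w).
Proof.
move=> mf f0 finv.
have m1 : measurable_fun setT (f \o Z1) by exact: measurableT_comp.
have m2 : measurable_fun setT (f \o Z2) by exact: measurableT_comp.
transitivity (\int[distribution P1 (mkmfun m1)]_y abse y).
  rewrite ge0_integral_distribution//.
  by apply: eq_integral => w _ /=; rewrite gee0_abs.
transitivity (\int[distribution P2 (mkmfun m2)]_y abse y).
  apply: eq_measure_integral => B mB _.
  apply: (transfer_set (G := f @^-1` B)); first exact: mpreimage.
  by move=> s z bs; rewrite /preimage/= finv.
rewrite ge0_integral_distribution//.
by apply: eq_integral => w _ /=; rewrite gee0_abs.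
Qed.

End transfer.

(** * Void probabilities of the displaced, rescaled, marked network *)

Lemma measurable_cos (R : realType) : measurable_fun setT (cos : R -> R).
Proof. by apply: continuous_measurable_fun; exact: continuous_cos. Qed.

Lemma measurable_sin (R : realType) : measurable_fun setT (sin : R -> R).
Proof. by apply: continuous_measurable_fun; exact: continuous_sin. Qed.

Section affine_lebesgue.
Context (R : realType).
Local Notation leb := (@lebesgue_measure R).
Local Notation RT := (measurableTypeR R).

Lemma measurable_affine (c b : R) : measurable_fun setT (fun x : RT => (c * x + b)%R : RT).
Proof.
by apply: measurable_funD => //; apply: measurable_funM => //.
Qed.

(** The left-hand side is a measure in A that gives every interval its length. *)
Lemma lebesgue_affine (c b : R) (A : set RT) : (0 < c)%R -> measurable A ->
  c%:E * leb [set x | A (c * x + b)%R] = leb A.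
Proof.
move=> c0 mA.
pose k : {nonneg R} := NngNum (ltW c0).
have := @lebesgue_measure_unique R (mscale k (pushforward leb (fun x : RT => (c * x + b)%R : RT))).
move=> /(_ (measurable_affine c b)) H.
apply/esym; apply: H => //.
move=> _ [[u v] /= uv <-].
rewrite /mscale/= /pushforward/=.
have -> : (fun x : RT => (c * x + b)%R : RT) @^-1` [set` `]u, v]] =
    [set` `]((u - b) / c)%R, ((v - b) / c)%R]].
  apply/seteqP; split=> x /=; rewrite !in_itv/= ltr_pdivrMr// ler_pdivlMr//;
  by rewrite ltrBlDr lerBrDr mulrC.
rewrite !lebesgue_measure_itv/= !lte_fin ltr_pM2r ?invr_gt0// ltrD2r.
case: ifP => _; last by rewrite mule0.
by rewrite -!EFinB -EFinM; congr (_%:E); field; rewrite gt_eqF.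
Qed.

Local Notation plane := (leb \x leb).

Lemma plane_affine (c : R) (b : R * R) (A : set (RT * RT)) : (0 < c)%R -> measurable A ->
  (c ^+ 2)%:E * plane [set x | A (c * x.1 + b.1, c * x.2 + b.2)%R] = plane A.
Proof.
move=> c0 mA.
pose phi (x : RT * RT) : RT * RT := (c * x.1 + b.1, c * x.2 + b.2)%R.
have mphi : measurable_fun setT phi.
  by apply: measurable_fun_pair; apply: (measurableT_comp (measurable_affine _ _)).
pose k : {nonneg R} := NngNum (exprn_ge0 2 (ltW c0)).
have := @product_measure_unique _ _ RT RT R leb leb (mscale k (pushforward plane phi)).
move=> /(_ mphi) H; apply/esym; apply: H => // A1 A2 mA1 mA2.
rewrite [LHS](_ : _ = (c ^+ 2)%:E * plane (phi @^-1` (A1 `*` A2)))//.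
have mp (D : set RT) e : measurable D -> measurable [set x : RT | D (c * x + e)%R].
  by move=> mD; apply: (@mpreimage _ _ _ _ (fun x : RT => (c * x + e)%R : RT)) => //; exact: measurable_affine.
have -> : phi @^-1` (A1 `*` A2) = [set x | A1 (c * x + b.1)%R] `*` [set x | A2 (c * x + b.2)%R].
  by [].
rewrite product_measure1E; [|exact: mp..].
rewrite [RHS](_ : _ = (c%:E * leb [set x | A1 (c * x + b.1)%R]) *
    (c%:E * leb [set x | A2 (c * x + b.2)%R])); last first.
  by rewrite (@lebesgue_affine c b.1 A1)// (@lebesgue_affine c b.2 A2).
by rewrite expr2 EFinM; exact: muleACA.
Qed.

End affine_lebesgue.

Section finite_products.
Context d (T : measurableType d) (R : realType) (P : probability T R).

Definition product_rule (E : nat -> set T) := forall n,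
  P [set w | forall i, (i < n)%N -> E i w] = \prod_(i < n) P (E i).

(** The roles 0, 1, 2 have no direction, so that their marks contribute constant events at
    the head of the sequence. *)
Lemma product_rule_prepend E : (E 0%N = set0 \/ E 0%N = setT) ->
  product_rule (fun i => E i.+1) -> product_rule E.
Proof.
move=> E0 H [|n].
  rewrite big_ord0 [X in P X](_ : _ = setT) ?probability_setT//.
  by apply/seteqP; split.
rewrite big_ord_recl -H.
have -> : [set w | forall i, (i < n.+1)%N -> E i w] =
    E 0%N `&` [set w | forall i, (i < n)%N -> E i.+1 w].
  apply/seteqP; split=> w /=.
    by move=> h; split; [exact: h|move=> i ni; exact: h].
  by move=> [h0 h] [//|i] ni; exact: h.
by case: E0 => ->; rewrite ?set0I ?measure0 ?mul0e// setTI probability_setT mul1e.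
Qed.

Lemma mutually_independent_product_rule (G : nat -> set (set T)) (E : nat -> set T) :
  mutually_independent P G -> (forall i, G i (E i)) -> product_rule E.
Proof.
move=> ind GE n.
have := ind [fset j | j in iota 0 n]%fset E (fun j _ => GE j).
rewrite [X in P X](_ : _ = [set w | forall i, (i < n)%N -> E i w]); last first.
  apply/seteqP; split=> w /= h i.
    by move=> ni; apply: h; rewrite /= !inE /= mem_iota.
  by rewrite /= !inE mem_iota /= => ni; exact: h.
move=> ->; rewrite -(big_mkord xpredT (fun i => P (E i))) /index_iota subn0.
apply: perm_big; apply: uniq_perm; rewrite ?fset_uniq ?iota_uniq// => i.
by rewrite !inE.
Qed.

End finite_products.

Section families.
Context d (T : measurableType d).

Lemma family_measurable d' (T' : measurableType d') (Y : nat -> T -> T') i A :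
  measurable A -> sigma_of_family Y (Y i @^-1` A).
Proof.
move=> mA; apply: sub_sigma_algebra; exists i => //; exists A => //.
by rewrite setTI.
Qed.

Lemma family_sequence_measurable d' (T' : measurableType d') (Y : nat -> T -> T')
    (A : set (seqsp T')) :
  measurable A -> sigma_of_family Y ((fun w => Y^~ w) @^-1` A).
Proof.
move=> mA.
pose TY := g_sigma_algebraType (\bigcup_i events_of (Y i)).
have mY : measurable_fun setT ((fun w => Y^~ w) : TY -> seqsp T').
  apply: measurable_seqspP => n _ B mB; rewrite setTI; exact: family_measurable.
by have := mY measurableT A mA; rewrite setTI.
Qed.

Lemma sigma_of_family_bigcap d' (T' : measurableType d') (Y : nat -> T -> T')
    (E : nat -> set T) n : (forall i, sigma_of_family Y (E i)) ->
  sigma_of_family Y [set w | forall i, (i < n)%N -> E i w].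
Proof.
move=> mE.
pose TY := g_sigma_algebraType (\bigcup_i events_of (Y i)).
have -> : [set w | forall i, (i < n)%N -> E i w] = \bigcap_(i in `I_n) E i.
  by apply/seteqP; split=> w h i; exact: h.
by apply: (@fin_bigcap_measurable _ TY) => // i _; exact: mE.
Qed.

Lemma sigma_of_familyI d' (T' : measurableType d') (Y : nat -> T -> T') A B :
  sigma_of_family Y A -> sigma_of_family Y B -> sigma_of_family Y (A `&` B).
Proof.
pose TY := g_sigma_algebraType (\bigcup_i events_of (Y i)).
exact: (@measurableI _ TY).
Qed.

Lemma sub_sigma_of_family d1 d2 (T1 : measurableType d1) (T2 : measurableType d2)
    (Y1 : nat -> T -> T1) (Y2 : nat -> T -> T2) (f : T2 -> T1) :
  measurable_fun setT f -> (forall i, Y1 i = f \o Y2 i) ->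
  sigma_of_family Y1 `<=` sigma_of_family Y2.
Proof.
move=> mf Yf; apply: smallest_sub; first exact: smallest_sigma_algebra.
move=> _ [i _ [A mA <-]]; rewrite setTI Yf comp_preimage.
by apply: family_measurable; exact: mpreimage.
Qed.

End families.

Section product_measures_agree.
Context d1 d2 (T1 : measurableType d1) (T2 : measurableType d2) (R : realType).
Variables (mu1 : {sigma_finite_measure set T1 -> \bar R})
  (mu2 : {sigma_finite_measure set T2 -> \bar R}).

Lemma product_measure12 B : measurable B -> (mu1 \x mu2) B = (mu1 \x^ mu2) B.
Proof.
apply: product_measure_unique => A1 A2 mA1 mA2.
by rewrite [LHS]product_measure2E.
Qed.

(** Fibrewise change of variables: the map x |-> phi u x scales mu1 by the same factor for
    every mark u. *)
Lemma product_measure_displacement (phi : T2 -> T1 -> T1) (k : R) (A D : set (T1 * T2)) :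
  (0 <= k)%R -> measurable A -> measurable D ->
  (forall p, D p <-> A (phi p.2 p.1, p.2)) ->
  (forall u B, measurable B -> k%:E * mu1 [set x | B (phi u x)] = mu1 B) ->
  k%:E * (mu1 \x mu2) D = (mu1 \x mu2) A.
Proof.
move=> k0 mA mD DA kphi.
rewrite product_measure12// product_measure12//.
rewrite /product_measure2 -ge0_integralZl//; last exact: measurable_fun_ysection.
apply: eq_integral => u _ /=.
rewrite -(kphi u _ (measurable_ysection u mA)); congr (_ * mu1 _).
by apply/seteqP; split=> x /=; rewrite /ysection/= !inE; have [] := DA (x, u).
Qed.
End product_measures_agree.

Section plane_displacement.
Context d1 d2 (T1 : measurableType d1) (T2 : measurableType d2) (R : realType).
Variables (mu1 : {sigma_finite_measure set T1 -> \bar R})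
  (mu2 : {sigma_finite_measure set T2 -> \bar R}).

(** A copy of the product measure that carries its own sigma-finite structure, so that it
    can be used as the first factor of another product. *)
Definition square_measure : set (T1 * T1) -> \bar R := mu1 \x mu1.

HB.instance Definition _ := Measure.on square_measure.

Lemma square_measure_sigma_finite : sigma_finite setT square_measure.
Proof.
have /sigma_finiteP[F [TF ndF Foo]] := sigma_finiteT mu1.
exists (fun n => F n `*` F n) => [|k].
  rewrite -setXTT TF; apply/seteqP; split=> [[x y] [[n _ Fx] [k _ Fy]]|[x y] [n _ []]].
    exists (maxn n k) => //; split.
      by have /subsetPset := ndF _ _ (leq_maxl n k); exact.
    by have /subsetPset := ndF _ _ (leq_maxr n k); exact.
  by split; exists n.
have [mF Fk] := Foo k; split; first exact: measurableX.
by rewrite /square_measure product_measure1E// lte_mul_pinfty// ge0_fin_numE.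
Qed.

HB.instance Definition _ := Measure_isSigmaFinite.Build _ _ _ square_measure
  square_measure_sigma_finite.

Lemma product_measure_displacement2 (phi : T2 -> T1 * T1 -> T1 * T1) (k : R)
    (A D : set ((T1 * T1) * T2)) :
  (0 <= k)%R -> measurable A -> measurable D ->
  (forall p, D p <-> A (phi p.2 p.1, p.2)) ->
  (forall u B, measurable B -> k%:E * (mu1 \x mu1) [set x | B (phi u x)] = (mu1 \x mu1) B) ->
  k%:E * ((mu1 \x mu1) \x mu2) D = ((mu1 \x mu1) \x mu2) A.
Proof. exact: (product_measure_displacement (mu1 := square_measure)). Qed.
End plane_displacement.

(** A common form for the two models with and without fading. The factor c is the square
    root of the intensity: scaling the plane by c turns the process into one of intensity 1.
    The factor m normalises the fading in the same way: the law of m F is the same in the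
    models that are compared. *)
Record marked_model d (T : measurableType d) (R : realType) (P : probability T R)
    (lam c m : R) (X : nat -> {RV P >-> (R * R)%type}) (Theta F : nat -> {RV P >-> R})
    (law : set R -> \bar R) : Prop := MarkedModel {
  model_c : (0 < c)%R ;
  model_c2 : (c ^+ 2 = lam)%R ;
  model_poisson : is_poisson_process P lam (fun i => X i : T -> R * R) ;
  model_Theta : iid_with_law Theta (uniform_prob (ltNpipi R)) ;
  model_XTheta : independent2 P (sigma_of_family (fun i => X i : T -> R * R))
                                (sigma_of_family (fun i => Theta i : T -> R)) ;
  model_F : iid_with_law F law ;
  model_FXTheta : independent2 P (sigma_of_family (fun i w => (X i w, Theta i w)))
                   (sigma_of_family (fun i => F i : T -> R)) }.

Section model.
Context d (T : measurableType d) (R : realType) (P : probability T R).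
Variables (lam c m : R) (X : nat -> {RV P >-> (R * R)%type})
  (Theta F : nat -> {RV P >-> R}) (lawF : set R -> \bar R).
Hypothesis M : marked_model lam c m X Theta F lawF.
Let HX := model_poisson M.
Let HTheta := model_Theta M.
Let HXTheta := model_XTheta M.
Let HF := model_F M.
Let HFXTheta := model_FXTheta M.
Let c0 : (0 < c)%R := model_c M.
Let c2 : (c ^+ 2 = lam)%R := model_c2 M.
Let lam0 : (0 < lam)%R.
Proof. by rewrite -c2 exprn_gt0. Qed.

(** Angles are shifted by 3 to stay aligned with the marks; the first three marks have the
    dummy angle 0. *)
Definition shifted_angle (n : nat) (w : T) : R :=
  if n is k.+3 then Theta k w else 0%R.

Definition mark (n : nat) (w : T) : R * R := (shifted_angle n w, m * F n w)%R.

Lemma measurable_shifted_angle n : measurable_fun setT (shifted_angle n).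
Proof. by case: n => [|[|[|n]]] //=; exact: measurable_cst. Qed.

Lemma measurable_mark n : measurable_fun setT (mark n).
Proof.
apply: measurable_fun_pair; first exact: measurable_shifted_angle.
exact: measurable_funM.
Qed.

(** The locations are those at time 0, at their original scale. *)
Definition base_state (w : T) : state R := (fun i => X i w, fun n => mark n w).

Definition rectangles : set (set (R * R)) :=
  [set A `*` B | A in measurable & B in measurable].

Lemma rectanglesI : setI_closed rectangles.
Proof.
move=> _ _ [A mA [B mB <-]] [A' mA' [B' mB' <-]]; exists (A `&` A'); first exact: measurableI.
by exists (B `&` B'); [exact: measurableI|rewrite setXI].
Qed.

Lemma rectanglesT : rectangles setT.
Proof. by exists setT => //; exists setT => //; rewrite setXTT. Qed.

Lemma measurable_rectangles : measurable = <<s rectangles >>.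
Proof. exact: measurable_prod_measurableType. Qed.

Lemma rectangle_split (B : nat -> set (R * R)) : (forall i, rectangles (B i)) ->
  exists BT BF : nat -> set R, [/\ forall i, measurable (BT i),
    forall i, measurable (BF i) & forall i w,
    B i (mark i w) <-> BT i (shifted_angle i w) /\ BF i (m * F i w)%R].
Proof.
move=> rB.
have /choice[BB hBB] : forall i, exists D : set R * set R,
    [/\ measurable D.1, measurable D.2 & B i = D.1 `*` D.2].
  by move=> i; have [A mA [B' mB' <-]] := rB i; exists (A, B').
exists (fun i => (BB i).1), (fun i => (BB i).2); split=> [i|i|i w].
- by case: (hBB i).
- by case: (hBB i).
- by case: (hBB i) => _ _ ->.
Qed.

Lemma angles_product_rule (BT : nat -> set R) : (forall i, measurable (BT i)) ->
  product_rule P (fun i => shifted_angle i @^-1` BT i).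
Proof.
move=> mBT.
have cst_ (r : R) (A : set R) : (fun _ : T => r) @^-1` A = set0 \/ (fun _ : T => r) @^-1` A = setT.
  have [Ar|nAr] := pselect (A r); [right|left]; by apply/seteqP; split.
do 3 (apply: product_rule_prepend; first exact: cst_).
apply: (mutually_independent_product_rule HTheta.2) => i /=.
by exists (BT i.+3) => //; rewrite setTI.
Qed.

Lemma fading_event (BF : set R) i : measurable BF ->
  sigma_of_family (fun i => F i : T -> R) [set w | BF (m * F i w)%R].
Proof.
move=> mBF; apply: (@family_measurable _ _ _ _ _ i [set x | BF (m * x)%R]).
by apply: (@mpreimage _ _ _ _ (fun x : R => m * x)%R) => //; exact: measurable_funM.
Qed.

Lemma fading_product_rule (BF : nat -> set R) : (forall i, measurable (BF i)) ->
  product_rule P (fun i => [set w | BF i (m * F i w)%R]).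
Proof.
move=> mBF; apply: (mutually_independent_product_rule HF.2) => i /=.
exists [set x | BF i (m * x)%R]; last by rewrite setTI.
by apply: (@mpreimage _ _ _ _ (fun x : R => m * x)%R) => //; exact: measurable_funM.
Qed.

Lemma angle_event (BT : set R) i : measurable BT ->
  sigma_of_family (fun i => Theta i : T -> R) (shifted_angle i @^-1` BT).
Proof.
move=> mBT; pose TY := g_sigma_algebraType (\bigcup_i events_of (Theta i : T -> R)).
have h0 : sigma_of_family (fun i => Theta i : T -> R) ((fun _ : T => 0%R) @^-1` BT).
  exact: (@mpreimage _ TY _ _ (fun _ : TY => 0%R : R)).
by case: i => [|[|[|i]]] //=; exact: family_measurable.
Qed.

(** A rectangle of marks splits into an event of the angles and an event of the fading
    variables. The fading variables are independent of locations and angles together, then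
    the angles of the locations. *)
Lemma location_marks_event (A : set (seqsp (R * R)%type)) n (B : nat -> set (R * R)) :
  measurable A -> (forall i, rectangles (B i)) ->
  P ((fun w => (fun i => X i w) : seqsp (R * R)%type) @^-1` A `&`
     [set w | forall i, (i < n)%N -> B i (mark i w)]) =
  P ((fun w => (fun i => X i w) : seqsp (R * R)%type) @^-1` A) *
  \prod_(i < n) P (mark i @^-1` B i).
Proof.
move=> mA /rectangle_split[BT [BF [mBT mBF BTF]]].
set XA := _ @^-1` A.
pose ET := [set w | forall i, (i < n)%N -> BT i (shifted_angle i w)].
pose EF := [set w | forall i, (i < n)%N -> BF i (m * F i w)%R].
have sXA : sigma_of_family (fun i => X i : T -> R * R) XA by exact: family_sequence_measurable.
have sET : sigma_of_family (fun i => Theta i : T -> R) ET.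
  by apply: sigma_of_family_bigcap => i; exact: angle_event.
have sEF : sigma_of_family (fun i => F i : T -> R) EF.
  by apply: sigma_of_family_bigcap => i; exact: fading_event.
have subX : sigma_of_family (fun i => X i : T -> R * R) `<=`
    sigma_of_family (fun i w => (X i w, Theta i w)).
  exact: (@sub_sigma_of_family _ _ _ _ _ _ _ _ fst).
have subT : sigma_of_family (fun i => Theta i : T -> R) `<=`
    sigma_of_family (fun i w => (X i w, Theta i w)).
  exact: (@sub_sigma_of_family _ _ _ _ _ _ _ _ snd).
rewrite (_ : [set w | _] = ET `&` EF); last first.
  apply/seteqP; split=> w /=.
    by move=> h; split=> i /h /BTF[].
  by move=> [h1 h2] i ni; apply/BTF; split; [exact: h1|exact: h2].
rewrite setIA HFXTheta//; last by apply: sigma_of_familyI; [exact: subX|exact: subT].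
rewrite HXTheta// -muleA; congr (_ * _).
rewrite angles_product_rule// fading_product_rule// -big_split/=.
apply: eq_bigr => i _; rewrite -HFXTheta//.
- by congr (P _); apply/seteqP; split=> w /= /BTF.
- by apply: subT; exact: angle_event.
- exact: fading_event.
Qed.

Lemma marks_product_rule (B : nat -> set (R * R)) : (forall i, measurable (B i)) ->
  product_rule P (fun i => mark i @^-1` B i).
Proof.
move=> mB n.
apply: (mutual_independence_from_pisystem measurable_mark measurable_rectangles
  rectanglesI rectanglesT) => // {mB}n' {}B rB.
have := @location_marks_event setT n' B measurableT rB.
by rewrite preimage_setT setTI probability_setT mul1e.
Qed.

(** Extends [location_marks_event] from boxes with rectangular sides. *)
Lemma locations_independent_of_marks :
  independent_rv P (fun w => (fun i => X i w) : seqsp (R * R)%type)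
    (fun w => (fun i => mark i w) : seqsp (R * R)%type).
Proof.
apply: (@independent_rv_seq _ _ _ _ _ _ _ _ _ mark rectangles) => //.
- exact: measurable_seqspP.
- exact: measurable_mark.
- exact: measurable_rectangles.
- exact: rectanglesI.
- exact: rectanglesT.
- move=> A n B mA rB; rewrite location_marks_event//; congr (_ * _).
  rewrite marks_product_rule// => i.
  by rewrite measurable_rectangles; exact: sub_sigma_algebra.
Qed.

(** All base stations have identically distributed marks; mark 3 is that of station 0. *)
Definition mark_law := distribution P (mkmfun (measurable_mark 3)).

Lemma mark_rectangle i A B : measurable A -> measurable B ->
  P (mark (i + 3) @^-1` (A `*` B)) = uniform_prob (ltNpipi R) A * lawF [set x | B (m * x)%R].
Proof.
move=> mA mB.
have mB' : measurable [set x | B (m * x)%R].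
  by apply: (@mpreimage _ _ _ _ (fun x : R => m * x)%R) => //; exact: measurable_funM.
have subT : sigma_of_family (fun i => Theta i : T -> R) `<=`
    sigma_of_family (fun i w => (X i w, Theta i w)).
  exact: (@sub_sigma_of_family _ _ _ _ _ _ _ _ snd).
rewrite (_ : _ @^-1` _ = shifted_angle (i + 3) @^-1` A `&` [set w | B (m * F (i + 3)%N w)%R])//.
rewrite HFXTheta; [|by apply: subT; exact: angle_event|exact: fading_event].
rewrite -(HF.1 (i + 3)%N _ mB') -(HTheta.1 i _ mA).
by rewrite addn3.
Qed.

Lemma same_mark_law i B : measurable B -> P (mark (i + 3) @^-1` B) = mark_law B.
Proof.
have := @finite_measure_unique _ (R * R)%type R rectangles
  (distribution P (mkmfun (measurable_mark (i + 3)))) mark_law measurable_rectangles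
  rectanglesI rectanglesT; apply.
- by change (P setT < +oo); rewrite probability_setT ltry.
- move=> _ [A mA [B' mB' <-]].
  rewrite [LHS](_ : _ = P (mark (i + 3) @^-1` (A `*` B')))//.
  rewrite [RHS](_ : _ = P (mark (0 + 3) @^-1` (A `*` B')))//.
  by rewrite !mark_rectangle.
Qed.

Lemma measurable_base_state : measurable_fun setT base_state.
Proof.
apply: measurable_fun_pair; apply: measurable_seqspP => // n.
exact: measurable_mark.
Qed.

Local Notation plane := (@lebesgue_measure R \x @lebesgue_measure R).

(** The probability that a station located at x has a mark that puts it in A. *)
Definition hit_probability (A : set ((R * R) * (R * R))) (x : R * R) : R :=
  fine (mark_law (xsection A x)).

Lemma hit_probabilityE A x : measurable A ->
  (hit_probability A x)%:E = mark_law (xsection A x).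
Proof.
move=> mA; rewrite /hit_probability fineK// fin_num_measure//.
exact: measurable_xsection.
Qed.

Lemma measurable_hit_probability A : measurable A -> measurable_fun setT (hit_probability A).
Proof.
move=> mA; apply: (@measurableT_comp _ _ _ _ _ _ fine) => //.
exact: measurable_fun_xsection.
Qed.

Lemma hit_probability01 A x : measurable A -> (0 <= hit_probability A x <= 1)%R.
Proof.
move=> mA; rewrite -!lee_fin hit_probabilityE// measure_ge0/=.
by apply: probability_le1; exact: measurable_xsection.
Qed.

Definition void_upto (N : nat) A (C : nat -> set (R * R)) : set (state R) :=
  [set z | (forall i, (i < N)%N -> ~ A (pt z i)) /\ (forall n, (n < 3)%N -> C n (z.2 n))].

Lemma measurable_void_upto N A C : measurable A -> (forall n, measurable (C n)) ->
  measurable (void_upto N A C).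
Proof.
move=> mA mC; rewrite (_ : void_upto N A C =
    \bigcap_(i in `I_N) ((fun z => pt z i) @^-1` ~` A) `&`
    \bigcap_(n in `I_3) ((fun z : state R => z.2 n) @^-1` C n)).
  apply: measurableI.
    apply: fin_bigcap_measurable => // i _; apply: mpreimage; first exact: measurable_pt.
    exact: measurableC.
  by apply: fin_bigcap_measurable => // n _; apply: mpreimage => //; exact: measurable_state_v.
by apply/seteqP; split=> z.
Qed.

(** Freezing the locations, the marks of the stations are independent, and station i avoids
    A with probability 1 - p (X i), where p is the hit probability. *)
Lemma probability_void_upto N A C : measurable A -> (forall n, measurable (C n)) ->
  P (base_state @^-1` void_upto N A C) =
  \prod_(n < 3) P (mark n @^-1` C n) * survival P (fun i => X i) (hit_probability A) N.
Proof.
move=> mA mC.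
have mE := measurable_void_upto N mA mC.
rewrite [LHS](@freezing _ _ _ P _ _ _ _ (fun w => (fun i => X i w) : seqsp (R * R)%type)
    (fun w => (fun i => mark i w) : seqsp (R * R)%type) (void_upto N A C))//; last 3 first.
- exact: measurable_seqspP.
- by apply: measurable_seqspP; exact: measurable_mark.
- exact: locations_independent_of_marks.
pose K := (\prod_(n < 3) fine (P (mark n @^-1` C n)))%R.
have cE : \prod_(n < 3) P (mark n @^-1` C n) = K%:E.
  rewrite /K (big_morph EFin EFinM erefl); apply: eq_bigr => n _.
  by rewrite fineK// fin_num_measure//; apply: mpreimage => //; exact: measurable_mark.
rewrite cE /survival -ge0_integralZl//; last 3 first.
- apply/measurable_EFinP; apply: (measurable_survival (X := fun i => X i)) => //.
  exact: measurable_hit_probability.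
- move=> w _; rewrite lee_fin prodr_ge0// => i _; rewrite subr_ge0.
  by case/andP: (hit_probability01 (X i w) mA).
- by rewrite lee_fin prodr_ge0// => n _; exact: fine_ge0.
apply: eq_integral => w _.
pose B n := if (n < 3)%N then C n else ~` xsection A (X (n - 3) w).
have mB n : measurable (B n).
  by rewrite /B; case: ifP => // _; apply: measurableC; exact: measurable_xsection.
rewrite [LHS](_ : _ = P [set w' | forall i, (i < 3 + N)%N -> B i (mark i w')]); last first.
  congr (P _); apply/seteqP; split=> w' /=.
    move=> [h1 h2] i iN; rewrite /B; case: ltnP => i3; first exact: h2.
    rewrite /xsection/= inE => hA; apply: (h1 (i - 3)%N).
      by rewrite ltn_subLR.
    by rewrite /pt/= subnK.
  move=> h; split=> [i iN|n n3].
    have := h (i + 3)%N; rewrite addnC ltn_add2l => /(_ iN).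
    by rewrite /B ltnNge leq_addr/= addKn /xsection/= inE /pt/= addnC.
  by have := h n; rewrite /B n3; apply; rewrite (leq_trans n3)// leq_addr.
rewrite marks_product_rule// big_split_ord/= -cE; congr (_ * _).
  by apply: eq_bigr => n _; rewrite /B ltn_ord.
rewrite (big_morph EFin EFinM erefl); apply: eq_bigr => i _.
rewrite /B ltnNge leq_addr/= addKn EFinB hit_probabilityE// addnC.
have mS := measurable_xsection (X i w) mA.
rewrite -(same_mark_law i mS).
exact: (probability_setC P (mpreimage (measurable_mark (i + 3)) mS)).
Qed.

(** The generating functional of the locations at the hit probability. The exponent is the
    intensity of the marked Poisson process on A. *)
Theorem probability_void A C : measurable A -> (forall n, measurable (C n)) ->
  P (base_state @^-1` void A C) =
  \prod_(n < 3) P (mark n @^-1` C n) *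
  expeR (- (lam%:E * (plane \x mark_law) A)).
Proof.
move=> mA mC.
have cv : P (base_state @^-1` void_upto N A C) @[N --> \oo] --> P (base_state @^-1` void A C).
  have -> : base_state @^-1` void A C = \bigcap_N (base_state @^-1` void_upto N A C).
    apply/seteqP; split=> w /=; first by move=> [h1 h2] N _; split=> //.
    move=> h; split; last by case: (h 0%N I).
    by move=> i; case: (h i.+1 I) => + _; apply.
  apply: (@nonincreasing_cvg_mu _ _ _ P (fun N => base_state @^-1` void_upto N A C)).
  - by rewrite (le_lt_trans (probability_le1 _ _)) ?ltry//; apply: mpreimage;
      [exact: measurable_base_state|exact: measurable_void_upto].
  - by move=> N; apply: mpreimage; [exact: measurable_base_state|exact: measurable_void_upto].
  - by apply: bigcapT_measurable => N; apply: mpreimage;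
      [exact: measurable_base_state|exact: measurable_void_upto].
  - apply/nonincreasing_seqP => N; apply/subsetPset => w /= [h1 h2]; split=> // i iN.
    by apply: h1; exact: leqW.
rewrite -(cvg_lim _ cv)//; apply/cvg_lim => //.
under eq_fun do rewrite probability_void_upto//.
apply: cvgeZl.
  apply: (big_ind (fun x => x \is a fin_num)) => // [x y|n _]; first exact: fin_numM.
  by rewrite fin_num_measure//; apply: mpreimage => //; exact: measurable_mark.
have := @poisson_generating_functional _ _ _ P lam (fun i => X i) lam0 _ HX
  (hit_probability A) (measurable_hit_probability mA)
  (fun x => hit_probability01 x mA).
rewrite (_ : \int[plane]_x (hit_probability A x)%:E = (plane \x mark_law) A).
  by apply.
by apply: eq_integral => x _; rewrite hit_probabilityE.
Qed.

Variable v : R.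

(** The position at time t, in the plane scaled by c. The speed v is not scaled: t is
    measured in a clock that runs c times faster than that of the original network. *)
Definition displace (t : R) (x u : R * R) : R * R :=
  (c * x.1 + v * t * cos u.1, c * x.2 + v * t * sin u.1)%R.

Lemma measurable_displace t :
  measurable_fun setT (fun p : (R * R) * (R * R) => displace t p.1 p.2).
Proof.
have mc := @measurable_cos R; have ms := @measurable_sin R.
apply: measurable_fun_pair; apply: measurable_funD; apply: measurable_funM => //.
- exact: measurableT_comp.
- by apply: measurableT_comp => //; exact: measurableT_comp.
- exact: measurableT_comp.
- by apply: measurableT_comp => //; exact: measurableT_comp.
Qed.

Definition network_state (t : R) (w : T) : state R :=
  (fun i => displace t (X i w) (mark (i + 3) w), fun n => mark n w).

Lemma measurable_network_state t : measurable_fun setT (network_state t).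
Proof.
apply: measurable_fun_pair; apply: measurable_seqspP => n; last exact: measurable_mark.
apply: (@measurableT_comp _ _ _ _ _ _ (fun p : (R * R) * (R * R) => displace t p.1 p.2)
   setT (fun w => (X n w, mark (n + 3) w))).
  exact: measurable_displace.
by apply: measurable_fun_pair => //; exact: measurable_mark.
Qed.

Definition displaced_set (t : R) (A : set ((R * R) * (R * R))) : set ((R * R) * (R * R)) :=
  (fun p => (displace t p.1 p.2, p.2)) @^-1` A.

Lemma measurable_displaced_set t A : measurable A -> measurable (displaced_set t A).
Proof.
move=> mA; apply: mpreimage => //; apply: measurable_fun_pair => //.
exact: measurable_displace.
Qed.

(** Displacement by a vector that depends on the mark alone preserves the area, and scaling
    by c divides it by lam = c^2: the intensity measure becomes that of the network of
    intensity 1, at every time. *)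
Lemma intensity_displaced_set t A : measurable A ->
  lam%:E * (plane \x mark_law) (displaced_set t A) = (plane \x mark_law) A.
Proof.
move=> mA; have mD := measurable_displaced_set t mA.
pose RT := measurableTypeR R.
have K := @product_measure_displacement2 _ _ RT (R * R)%type R
  [the {sigma_finite_measure set RT -> \bar R} of @lebesgue_measure R] mark_law
  (fun u x => displace t x u) lam.
have K2 := K A (displaced_set t A) (ltW lam0).
have K3 := K2 mA mD.
apply: K3 => //.
- move=> u B mB.
  have := @plane_affine R c (v * t * cos u.1, v * t * sin u.1)%R B c0 mB.
  by rewrite c2.
Qed.

(** The right-hand side depends neither on t nor on lam: this is the source of stationarity
    and of scale invariance. *)
Theorem probability_void_network t A C : measurable A -> (forall n, measurable (C n)) ->
  P (network_state t @^-1` void A C) =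
  \prod_(n < 3) P (mark n @^-1` C n) * expeR (- (plane \x mark_law) A).
Proof.
move=> mA mC.
rewrite (_ : _ @^-1` _ = base_state @^-1` void (displaced_set t A) C)//.
rewrite probability_void//; last exact: measurable_displaced_set.
by rewrite intensity_displaced_set.
Qed.

End model.

(** * Almost sure properties of the network *)

Section uniform_angle.
Context (R : realType).
Local Notation unif := (uniform_prob (ltNpipi R)).

Lemma uniform_support : unif `[(- pi)%R, pi] = 1.
Proof. exact: (integral_uniform_pdf1 (ltNpipi R)). Qed.

Lemma uniform_finite0 (A : set R) : measurable A ->
  finite_set (A `&` `[(- pi)%R, pi]) -> unif A = 0.
Proof.
move=> mA finA.
have <- := probabilityI_full (P := [the probability _ R of unif])
  (measurable_itv `[(- pi)%R, pi]) mA uniform_support.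
apply: (@dominates_uniform_prob _ _ _ (ltNpipi R) (A `&` `[(- pi)%R, pi]%classic)) => //.
  apply/measure0_null_setP; first exact: measurableI.
  exact: countable_lebesgue_measure0 (finite_set_countable finA).
exact: measurableI.
Qed.

Lemma uniform_point0 (r : R) : unif [set r] = 0.
Proof.
apply: uniform_finite0 => //.
by apply: (@sub_finite_set _ _ [set r]) => // x [].
Qed.

Lemma acos_cos_norm (t : R) : (- pi <= t <= pi)%R -> acos (cos t) = `|t|%R.
Proof.
move=> /andP[t1 t2]; have [t0|t0] := leP 0%R t.
  by rewrite ger0_norm// cosK// in_itv/= t0.
by rewrite ltr0_norm// -cosN cosK// in_itv/= oppr_ge0 ltW//= lerNl.
Qed.

Lemma measurable_trig_eq (x y b : R) :
  measurable [set t : R | (x * cos t + y * sin t = b)%R].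
Proof.
have mc := @measurable_cos R; have ms := @measurable_sin R.
rewrite (_ : [set t | _] = (fun t => x * cos t + y * sin t)%R @^-1` [set b])//.
by apply: mpreimage => //; apply: measurable_funD; exact: measurable_funM.
Qed.

(** By sin^2 = 1 - cos^2 the cosine of a solution is a root of a quadratic polynomial, so
    only finitely many angles are solutions. *)
Lemma uniform_trig_eq0 (x y b : R) : (x, y) != 0%R ->
  unif [set t : R | (x * cos t + y * sin t = b)%R] = 0.
Proof.
move=> xy0; apply: uniform_finite0; first exact: measurable_trig_eq.
set S := _ `&` _.
have a0 : (x ^+ 2 + y ^+ 2 != 0)%R.
  rewrite paddr_eq0 ?sqr_ge0// !sqrf_eq0.
  by move: xy0; rewrite -pair_eqE.
have root t : S t -> ((x ^+ 2 + y ^+ 2) * cos t ^+ 2 - 2 * b * x * cos t + b ^+ 2 - y ^+ 2 = 0)%R.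
  move=> [/= <- _]; have := cos2Dsin2 t; set C := cos t; set D := sin t => CD.
  transitivity (y ^+ 2 * (C ^+ 2 + D ^+ 2 - 1))%R; first by ring.
  by rewrite CD subrr mulr0.
have [[t0 St0]|noS] := pselect (exists t, S t); last first.
  by apply: (@sub_finite_set _ _ set0) => // t St; apply: noS; exists t.
(* The sum of the roots of the quadratic gives the second root from the first. *)
pose u1 := cos t0; pose u2 := (2 * b * x / (x ^+ 2 + y ^+ 2) - u1)%R.
apply: (@sub_finite_set _ _ ([set acos u1; - acos u1] `|` [set acos u2; - acos u2])%R); last first.
  by rewrite finite_setU.
move=> t St; have [_ /=] := St; rewrite in_itv/= => tpi.
have tE := acos_cos_norm tpi.
have cu : cos t = u1 \/ cos t = u2.
  have := root _ St; have := root _ St0; rewrite -/u1 => h0 h1.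
  have /eqP : ((cos t - u1) * ((x ^+ 2 + y ^+ 2) * (cos t + u1) - 2 * b * x) = 0)%R.
    by rewrite -[RHS](subrr 0%R) -{1}h1 -h0; ring.
  rewrite mulf_eq0 => /orP[|]; first by rewrite subr_eq0 => /eqP ->; left.
  rewrite subr_eq0 => /eqP h; right; rewrite /u2 -h.
  by field.
have tt : t = `|t|%R \/ t = (- `|t|)%R.
  by have [t0'|t0'] := leP 0%R t; [left; rewrite ger0_norm|right; rewrite ltr0_norm// opprK].
by case: cu => <-; [left|right]; rewrite /= tE.
Qed.

End uniform_angle.

Lemma measurable_eq_set d (T : measurableType d) (R : realType) (f g : T -> R) :
  measurable_fun setT f -> measurable_fun setT g -> measurable [set x | f x = g x].
Proof.
move=> mf mg; rewrite (_ : [set x | _] = (fun x => f x - g x)%R @^-1` [set 0%R]).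
  by apply: mpreimage => //; exact: measurable_funB.
by apply/seteqP; split=> x /= => [->|/eqP]; [rewrite subrr|rewrite subr_eq0 => /eqP].
Qed.

Section almost_sure.
Context d (T : measurableType d) (R : realType) (P : probability T R).

Lemma probability1_ae (E : set T) : measurable E ->
  P E = 1 <-> \forall w \ae P, E w.
Proof.
move=> mE; split=> [PE|[N [mN N0 sub]]].
  exists (~` E); split => //; first exact: measurableC.
  by rewrite [LHS]probability_setC// PE subee.
have : P (~` E) = 0 by apply: (subset_measure0 _ _ sub N0) => //; exact: measurableC.
move=> PC; rewrite -[RHS](sube0 1) -PC -probability_setC ?setCK//.
exact: measurableC.
Qed.

Lemma null_ae (E : set T) : measurable E -> P E = 0 -> \forall w \ae P, ~ E w.
Proof. by move=> mE PE; exists E; split => // w /= /contrapT. Qed.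

Lemma ae_forall2 (Q : nat -> nat -> T -> Prop) :
  (forall i j, \forall w \ae P, Q i j w) -> \forall w \ae P, forall i j, Q i j w.
Proof. by move=> h; apply: ae_foralln => i; exact: ae_foralln. Qed.

End almost_sure.

Section comparison.
Context (R : realType) (v1 v2 : R).
Context d1 (T1 : measurableType d1) (P1 : probability T1 R)
  (lam1 c1 m1 : R) (X1 : nat -> {RV P1 >-> (R * R)%type})
  (Theta1 F1 : nat -> {RV P1 >-> R}) (law1 : set R -> \bar R).
Context d2 (T2 : measurableType d2) (P2 : probability T2 R)
  (lam2 c2 m2 : R) (X2 : nat -> {RV P2 >-> (R * R)%type})
  (Theta2 F2 : nat -> {RV P2 >-> R}) (law2 : set R -> \bar R).
Hypotheses (M1 : marked_model lam1 c1 m1 X1 Theta1 F1 law1)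
  (M2 : marked_model lam2 c2 m2 X2 Theta2 F2 law2).
Hypothesis same_law : forall B, measurable B ->
  law1 [set x | B (m1 * x)%R] = law2 [set x | B (m2 * x)%R].

Lemma same_mark_laws B : measurable B ->
  mark_law m1 Theta1 F1 B = mark_law m2 Theta2 F2 B.
Proof.
have := @finite_measure_unique _ (R * R)%type R (@rectangles R)
  (mark_law m1 Theta1 F1) (mark_law m2 Theta2 F2) (@measurable_rectangles R)
  (@rectanglesI R) (@rectanglesT R); apply.
- by change (P1 setT < +oo); rewrite probability_setT ltry.
- move=> _ [A mA [B' mB' <-]].
  rewrite [LHS](_ : _ = P1 (mark m1 Theta1 F1 (0 + 3) @^-1` (A `*` B')))//.
  rewrite [RHS](_ : _ = P2 (mark m2 Theta2 F2 (0 + 3) @^-1` (A `*` B')))//.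
  by rewrite (mark_rectangle M1)// (mark_rectangle M2)// same_law.
Qed.

Lemma same_first_marks n B : (n < 3)%N -> measurable B ->
  P1 (mark m1 Theta1 F1 n @^-1` B) = P2 (mark m2 Theta2 F2 n @^-1` B).
Proof.
move=> n3 mB.
pose B0 := [set y : R | B (0%R, y)].
have mB0 : measurable B0.
  by apply: (@mpreimage _ _ _ _ (pair (0%R : R))) => //; exact: pair1_measurable.
have mBm (m : R) : measurable [set x | B0 (m * x)%R].
  by apply: (@mpreimage _ _ _ _ (fun x : R => m * x)%R) => //; exact: measurable_funM.
have := same_law mB0.
rewrite -((model_F M1).1 n _ (mBm m1)) -((model_F M2).1 n _ (mBm m2)).
by move: n3; case: n => [|[|[|]]].
Qed.

(** The void probabilities involve only the laws of the marks. *)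
Lemma same_voids_models t1 t2 : same_voids P1 P2
  (network_state c1 m1 X1 Theta1 F1 v1 t1) (network_state c2 m2 X2 Theta2 F2 v2 t2).
Proof.
move=> A C mA mC.
rewrite (probability_void_network M1)// (probability_void_network M2)//; congr (_ * _).
  by apply: eq_bigr => n _; exact: same_first_marks.
congr (expeR (- _)); apply: eq_integral => x _ /=.
by apply: same_mark_laws; exact: measurable_xsection.
Qed.

End comparison.

Section good_configurations.
Context d (T : measurableType d) (R : realType) (P : probability T R).
Variables (lam c m : R) (X : nat -> {RV P >-> (R * R)%type})
  (Theta F : nat -> {RV P >-> R}) (lawF : set R -> \bar R).
Hypothesis M : marked_model lam c m X Theta F lawF.
Let c0 : (0 < c)%R := model_c M.
Local Notation mk := (mark m Theta F).
Local Notation mmk := (measurable_mark m Theta F).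

(** The marks with mark n erased; they are independent of mark n. *)
Definition blank (n i : nat) (w : T) : R * R := if i == n then (0, 0)%R else mk i w.

Lemma measurable_blank n i : measurable_fun setT (blank n i).
Proof.
rewrite /blank; case: (i == n); last exact: mmk.
exact: measurable_cst.
Qed.

Lemma blank_independent n :
  independent_rv P (fun w => (blank n)^~ w : seqsp (R * R)%type) (mk n).
Proof.
suff h : independent_rv P (mk n) (fun w => (blank n)^~ w : seqsp (R * R)%type).
  by move=> A B mA mB; rewrite setIC muleC h.
apply: (@independent_rv_seq _ _ _ _ _ _ _ _ _ (blank n) measurable) => //.
- exact: mmk.
- exact: measurable_blank.
- by rewrite sigma_algebra_id//; exact: sigma_algebra_measurable.
- by move=> ? ? ? ?; exact: measurableI.
move=> A N B mA mB.
pose cst0 := [set w : T | (n < N)%N -> B n (0, 0)%R].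
have cst01 : cst0 = set0 \/ cst0 = setT.
  have [h|h] := pselect ((n < N)%N -> B n (0, 0)%R); [right|left];
  by apply/seteqP; split.
pose B' A' i := if i == n then A' else if (i < N)%N then B i else setT.
have mB' A' : measurable A' -> forall i, measurable (B' A' i).
  by move=> mA' i; rewrite /B'; case: ifP => // _; case: ifP.
have E A' : mk n @^-1` A' `&` [set w | forall i, (i < N)%N -> blank n i w \in B i] =
   cst0 `&` [set w | forall i, (i < maxn N n.+1)%N -> B' A' i (mk i w)].
  apply/seteqP; split=> w /=.
    move=> [Aw h]; split.
      by move=> nN; have := h n nN; rewrite /blank eqxx inE.
    move=> i _; rewrite /B'; case: eqP => [->//|/eqP ni]; case: ifP => // iN.
    by have := h i iN; rewrite /blank (negPf ni) inE.
  move=> [h1 h2]; split.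
    by have := h2 n; rewrite leq_max ltnSn orbT /B' eqxx; apply.
  move=> i iN; rewrite inE /blank; case: eqP => [e|/eqP ni].
    by rewrite e; apply: h1; rewrite -e.
  by have := h2 i; rewrite leq_max iN /B' (negPf ni) iN; apply.
have {}E A' : mk n @^-1` A' `&` [set w | forall i, (i < N)%N -> B i (blank n i w)] =
   cst0 `&` [set w | forall i, (i < maxn N n.+1)%N -> B' A' i (mk i w)].
  by rewrite -E; congr (_ `&` _); apply/seteqP; split=> w /= h i iN;
    have := h i iN; rewrite inE.
have nM : (n < maxn N n.+1)%N by rewrite leq_max ltnSn orbT.
have prod_ A' : measurable A' ->
    P [set w | forall i, (i < maxn N n.+1)%N -> B' A' i (mk i w)] =
    P (mk n @^-1` A') * \prod_(i < maxn N n.+1 | i != Ordinal nM) P (mk i @^-1` B' setT i).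
  move=> mA'; rewrite (marks_product_rule M (mB' A' mA')) (bigD1 (Ordinal nM))//=.
  congr (_ * _); first by rewrite /B' eqxx.
  apply: eq_bigr => i; rewrite -val_eqE/= => ni.
  by rewrite /B' (negPf ni).
have PT : P [set w | forall i, (i < N)%N -> B i (blank n i w)] =
    P (cst0 `&` [set w | forall i, (i < maxn N n.+1)%N -> B' setT i (mk i w)]).
  by rewrite -E preimage_setT setTI.
rewrite E PT; case: cst01 => ->; first by rewrite !set0I measure0 mule0.
by rewrite !setTI !prod_// preimage_setT probability_setT mul1e.
Qed.

Definition blanked (n : nat) (w : T) : state R := (fun i => X i w, fun i => blank n i w).

Lemma measurable_blanked n : measurable_fun setT (blanked n).
Proof.
apply: measurable_fun_pair; apply: measurable_seqspP => // i.
exact: measurable_blank.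
Qed.

(** [freezing0] twice: freeze the locations, then all marks but mark n. *)
Lemma null_by_mark n (G : set (state R * (R * R))) : measurable G ->
  (forall z, P (mk n @^-1` [set u | G (z, u)]) = 0) ->
  P [set w | G (blanked n w, mk n w)] = 0.
Proof.
move=> mG G0.
pose bl (z : state R) : state R := (z.1, fun i => if i == n then (0, 0)%R else z.2 i).
have mbl : measurable_fun setT bl.
  apply: measurable_fun_pair => //; apply: measurable_seqspP => i.
  by case: (i == n); [exact: measurable_cst|exact: measurable_state_v].
pose C : set (state R) := [set z | G (bl z, z.2 n)].
have mC : measurable C.
  apply: (@mpreimage _ _ _ _ (fun z => (bl z, z.2 n))) => //.
  by apply: measurable_fun_pair => //; exact: measurable_state_v.
rewrite [LHS](_ : _ = P [set w | C ((fun i => X i w), (fun i => mk i w))]); last first.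
  congr (P _); apply/seteqP; split=> w; rewrite /C /bl /blanked /blank //=.
apply: (@freezing0 _ _ _ P _ _ (seqsp (R * R)%type) (seqsp (R * R)%type)
  (fun w i => X i w) (fun w i => mk i w) C) => //.
- exact: measurable_seqspP.
- by apply: measurable_seqspP; exact: mmk.
- exact: (locations_independent_of_marks M).
move=> x.
pose C' : set (seqsp (R * R)%type * (R * R)) := [set p | G ((x, p.1), p.2)].
rewrite [LHS](_ : _ = P [set w | C' ((fun i => blank n i w), mk n w)])//.
apply: (@freezing0 _ _ _ P _ _ (seqsp (R * R)%type) (R * R)%type
  (fun w i => blank n i w) (mk n) C') => //.
- by apply: measurable_seqspP; exact: measurable_blank.
- exact: mmk.
- exact: blank_independent.
- apply: (@mpreimage _ _ _ _ (fun p : seqsp (R * R)%type * (R * R) => ((x, p.1) : state R, p.2))) => //.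
  by apply: measurable_fun_pair => //; apply: measurable_fun_pair.
- by move=> y; exact: (G0 (x, y)).
Qed.

Lemma mark_angle0 k (S : set R) : measurable S -> uniform_prob (ltNpipi R) S = 0 ->
  P (mk (k + 3) @^-1` [set u | S u.1]) = 0.
Proof.
move=> mS S0.
rewrite (_ : _ @^-1` _ = mk (k + 3) @^-1` (S `*` setT)).
  by rewrite (mark_rectangle M)// S0 mul0e.
by apply/seteqP; split=> w //= [].
Qed.

(** Given everything but the direction of station k, the displayed equation for that
    direction has finitely many solutions. All exclusions of ties below are of this form. *)
Lemma direction_equation_null k (f : state R -> R) : measurable_fun setT f ->
  \forall w \ae P, X k w != (0, 0)%R ->
    ((X k w).1 * cos (mk (k + 3) w).1 + (X k w).2 * sin (mk (k + 3) w).1)%R !=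
    f (blanked (k + 3) w).
Proof.
move=> mf.
have mc := @measurable_cos R; have ms := @measurable_sin R.
pose G : set (state R * (R * R)) := [set p | p.1.1 k != (0, 0)%R /\
  (((p.1.1 k).1 * cos p.2.1 + (p.1.1 k).2 * sin p.2.1)%R = f p.1)].
have m1 : measurable_fun setT (fun p : state R * (R * R) => p.1.1 k).
  by apply: (@measurableT_comp _ _ _ _ _ _ (fun z : state R => z.1 k)) => //; exact: measurable_state_x.
have mG : measurable G.
  apply: measurableI.
    rewrite [X in measurable X](_ : _ = (fun p : state R * (R * R) => p.1.1 k) @^-1` ~` ([set 0%R] `*` [set 0%R])).
      apply: mpreimage => //; apply: measurableC; exact: measurableX.
    apply/seteqP; split=> p /=.
      by move=> /eqP h [h1 h2]; apply: h; case: (p.1.1 k) h1 h2 => /= ? ? -> ->.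
    by move=> h; apply/eqP => e; apply: h; rewrite e.
  have mr : measurable_fun setT (fun p : state R * (R * R) => f p.1) by exact: measurableT_comp.
  apply: (measurable_eq_set _ mr).
  apply: measurable_funD; apply: measurable_funM.
  - by apply: (measurableT_comp measurable_fst m1).
  - by apply: measurableT_comp => //; apply: measurableT_comp.
  - by apply: (measurableT_comp measurable_snd m1).
  - by apply: measurableT_comp => //; apply: measurableT_comp.
have G0 : P [set w | G (blanked (k + 3) w, mk (k + 3) w)] = 0.
  apply: null_by_mark => // z.
  have [z0|z0] := eqVneq (z.1 k) (0, 0)%R.
    rewrite (_ : _ @^-1` _ = set0) ?measure0//.
    by apply/seteqP; split=> w //=; rewrite /G/= z0 eqxx => -[].
  rewrite (_ : _ @^-1` _ = mk (k + 3) @^-1`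
    [set u | [set t | (z.1 k).1 * cos t + (z.1 k).2 * sin t = f z]%R u.1]).
    apply: mark_angle0; first exact: measurable_trig_eq.
    by apply: uniform_trig_eq0; rewrite -surjective_pairing.
  by apply/seteqP; split=> w; rewrite /G/=; [case|split].
apply: filterS (null_ae _ G0) => [w nG X0|].
  by apply/eqP => e; apply: nG; split.
apply: (@mpreimage _ _ _ _ (fun w => (blanked (k + 3) w, mk (k + 3) w))) => //.
by apply: measurable_fun_pair; [exact: measurable_blanked|exact: mmk].
Qed.

(** The case of an equation that fixes the direction of one station in terms of another. *)
Lemma angles_distinct : \forall w \ae P, forall i j, i != j -> Theta i w != Theta j w.
Proof.
apply: ae_forall2 => i j.
have [->|ij] := eqVneq i j; first by apply: aeW => w; rewrite eqxx.
pose G : set (state R * (R * R)) := [set p | (p.2.1 = (p.1.2 (i + 3)%N).1)%R].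
have mG : measurable G.
  apply: measurable_eq_set.
    by apply: measurableT_comp.
  apply: (@measurableT_comp _ _ _ _ _ _ (fun z : state R => (z.2 (i + 3)%N).1)) => //.
  exact: (measurableT_comp measurable_fst (measurable_state_v _)).
have G0 : P [set w | G (blanked (j + 3) w, mk (j + 3) w)] = 0.
  apply: null_by_mark => // z.
  rewrite (_ : _ @^-1` _ = mk (j + 3) @^-1` [set u | [set (z.2 (i + 3)%N).1] u.1])//.
  by apply: mark_angle0 => //; exact: uniform_point0.
apply: filterS (null_ae _ G0) => [w nG _|].
  apply/eqP => e; apply: nG; rewrite /G/= /blank eqn_add2r (negPf ij) /mark/= !addn3/=.
  by rewrite e.
apply: (@mpreimage _ _ _ _ (fun w => (blanked (j + 3) w, mk (j + 3) w))) => //.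
by apply: measurable_fun_pair; [exact: measurable_blanked|exact: mmk].
Qed.

Lemma angles_bounded : \forall w \ae P, forall i, (- pi <= Theta i w <= pi)%R.
Proof.
apply: ae_foralln => i.
have mI := measurable_itv `[(- pi)%R, pi : R].
have h := (model_Theta M).1 i _ mI; rewrite uniform_support in h.
have mE : measurable (Theta i @^-1` `[(- pi)%R, pi]) by exact: mpreimage.
have := (probability1_ae P mE).1 h.
by apply: filterS => w /=; rewrite in_itv.
Qed.

Lemma locations_locally_finite :
  \forall w \ae P, forall k, finite_count (fun i => X i) (@square R k) w.
Proof.
apply: ae_foralln => k.
have mS := @measurable_square R k.
apply/probability1_ae; first exact: measurable_finite_count.
apply: (finite_count1 _ _ (model_poisson M)) => //.
- by rewrite -(model_c2 M) exprn_gt0.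
- exact: area_square.
Qed.

Lemma locations_nonzero : \forall w \ae P, forall i, X i w != (0, 0)%R.
Proof.
pose O : set (R * R) := [set 0%R] `*` [set 0%R].
have mO : measurable O by exact: measurableX.
have aO : area O = 0.
  by rewrite /area product_measure1E//= lebesgue_measure_set1 mul0e.
have l0 : (0 < lam)%R by rewrite -(model_c2 M) exprn_gt0.
have h : P [set w | point_count (fun i => X i) w O = 0%:R%:E] = 1.
  rewrite (prob_count (model_poisson M))// ?aO//= /poisson_weight.
  by rewrite fact0 expr0 invr1 !mul1r mulr0 oppr0 expR0.
have mE : measurable [set w | point_count (fun i => X i) w O = 0%:R%:E].
  exact: measurable_count_eq.
have := (probability1_ae P mE).1 h; apply: filterS => w /= pc i; apply/eqP => Xi.
have : (1 <= point_count (fun i => X i) w O).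
  rewrite /point_count; apply: le_trans (nneseries_lim_ge i.+1 _) => //.
  rewrite big_mkord big_ord_recr/= diracE mem_set ?leeDr ?sume_ge0//.
  by rewrite /O Xi.
by rewrite pc lee_fin ler10.
Qed.

Lemma eventually_outside (A : set (R * R)) w : finite_count (fun i => X i) A w ->
  exists N, forall i, (N <= i)%N -> ~ A (X i w).
Proof.
move=> [k _ /= /hits_eventually [N _ hN]]; exists N => i Ni Ai.
have h1 := hN i Ni; have h2 := hN i.+1 (leqW Ni).
move: h2; rewrite /hits big_ord_recr/= mem_set//= addn1 => h2.
move: h1; rewrite /= -[in RHS]h2 => /eqP.
by rewrite ltn_eqF.
Qed.

Variable v : R.

(** A station with key below r lies within r of the user in the sup norm, hence within
    (r + |v t|)/c at time 0 and before scaling, and there are finitely many of those. *)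
Lemma locally_finite_simple_network t w :
  (forall i j, i != j -> Theta i w != Theta j w) ->
  (forall i, (- pi <= Theta i w <= pi)%R) ->
  (forall k, finite_count (fun i => X i) (@square R k) w) ->
  locally_finite_simple (network_state c m X Theta F v t w).
Proof.
move=> dist bnd fin.
(* The fractional part of the key; pi < 4. *)
have e01 i : (0 <= (Theta i w + 4) / 8 < 1)%R.
  have /andP[h1 h2] := bnd i; have /andP[_ h3] := @pihalf_02 R.
  by apply/andP; split; lra.
have keyE i : key (pt (network_state c m X Theta F v t w) i) =
    ((Num.truncn (Num.max `|(displace c v t (X i w) (mk (i + 3) w)).1|
      `|(displace c v t (X i w) (mk (i + 3) w)).2|))%:R + (Theta i w + 4) / 8)%R.
  by rewrite /key/= /mark !addn3.
split=> [i j ij|r].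
  rewrite !keyE; apply/eqP.
  set a := Num.truncn _; set b := Num.truncn _ => e.
  have /andP[i0 i1] := e01 i; have /andP[j0 j1] := e01 j.
  have ab : a = b.
    case: (ltngtP a b) => // h; exfalso; move: h; rewrite -(ler_nat R) -natr1 => h; lra.
  have /eqP := dist i j ij; apply; rewrite ab in e; lra.
pose K := (Num.truncn ((r%:R + `|v * t|) / c)%R).+1.
have [N hN] := eventually_outside (fin K); exists N => i Ni.
rewrite leNgt; apply/negP => kr; apply: (hN i Ni).
have /andP[i0 i1] := e01 i.
have trr : (Num.truncn (Num.max `|(displace c v t (X i w) (mk (i + 3) w)).1|
      `|(displace c v t (X i w) (mk (i + 3) w)).2|)%R < r)%N.
  by rewrite -(ltr_nat R); rewrite keyE in kr; lra.
have mr : (Num.max `|(displace c v t (X i w) (mk (i + 3) w)).1|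
      `|(displace c v t (X i w) (mk (i + 3) w)).2| < r%:R)%R.
  by rewrite (lt_le_trans (truncnS_gt _))// ler_nat.
have Kb (x s : R) : (`|s| <= 1)%R -> (`|c * x + v * t * s| < r%:R)%R ->
    x \in `[(- K%:R)%R, (K%:R)%R].
  move=> s1 h; have cx : (`|c * x| <= r%:R + `|v * t|)%R.
    have -> : (c * x = (c * x + v * t * s) - v * t * s)%R by ring.
    by rewrite (le_trans (ler_normB _ _))// lerD// ?(ltW h)// normrM ler_piMr.
  rewrite in_itv/= -ler_norml.
  have xK : (`|x| <= (r%:R + `|v * t|) / c)%R.
    by rewrite ler_pdivlMr// mulrC -[X in (X * _)%R](gtr0_norm c0) -normrM.
  by rewrite (le_trans xK)// ltW// truncnS_gt.
move: mr; rewrite gt_max => /andP[h1 h2]; split.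
- by apply: Kb h1; rewrite ler_norml cos_geN1 cos_le1.
- by apply: Kb h2; rewrite ler_norml sin_geN1 sin_le1.
Qed.

Theorem network_locally_finite_simple t :
  P (network_state c m X Theta F v t @^-1` @locally_finite_simple R) = 1.
Proof.
have mE : measurable (network_state c m X Theta F v t @^-1` @locally_finite_simple R).
  by apply: mpreimage; [exact: measurable_network_state|exact: measurable_locally_finite_simple].
apply/(probability1_ae P mE); near=> w; apply: locally_finite_simple_network.
- by near: w; exact: angles_distinct.
- by near: w; exact: angles_bounded.
- by near: w; exact: locations_locally_finite.
Unshelve. all: by end_near. Qed.

End good_configurations.

Section tie_free.
Context (R : realType).
Implicit Types z : state R.

Definition sqdist z i : R := ((z.1 i).1 ^+ 2 + (z.1 i).2 ^+ 2)%R.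

(** The scalar product of location and direction: half the time derivative, at time 0 and
    for unit speed, of the squared distance. *)
Definition drift z i : R :=
  ((z.1 i).1 * cos (z.2 (i + 3)%N).1 + (z.1 i).2 * sin (z.2 (i + 3)%N).1)%R.

Lemma measurable_sqdist i : measurable_fun setT (fun z => sqdist z i).
Proof.
by apply: measurable_funD; apply: measurable_funX;
  apply: measurableT_comp => //; exact: measurable_state_x.
Qed.

Lemma measurable_drift i : measurable_fun setT (fun z => drift z i).
Proof.
have mc := @measurable_cos R; have ms := @measurable_sin R.
apply: measurable_funD; apply: measurable_funM.
- by apply: measurableT_comp => //; exact: measurable_state_x.
- by apply: measurableT_comp => //; apply: measurableT_comp => //; exact: measurable_state_v.
- by apply: measurableT_comp => //; exact: measurable_state_x.
- by apply: measurableT_comp => //; apply: measurableT_comp => //; exact: measurable_state_v.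
Qed.

Definition distinct_distances : set (state R) :=
  [set z | forall i j, i != j -> sqdist z i != sqdist z j].

Definition distinct_drifts : set (state R) :=
  [set z | forall i j, i != j -> drift z i != drift z j].

(** The squared distances at time t, less the common term (v t)^2, are affine functions of
    t with intercept [sqdist] and slope 2 v [drift]; this determinant vanishes when three
    of these lines pass through one point. *)
Definition collinearity z i j k : R :=
  ((sqdist z i - sqdist z j) * (drift z i - drift z k) -
   (sqdist z i - sqdist z k) * (drift z i - drift z j))%R.

Definition no_triple_tie : set (state R) :=
  [set z | forall i j k, i != j -> i != k -> j != k -> collinearity z i j k != 0%R].

Definition nonneg_fading : set (state R) := [set z | forall n, (0 <= (z.2 n).2)%R].

(** On these configurations an observation happens at a single time, and two observations
    at the same time differ only by exchanging two stations at equal distance. *)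
Definition tie_free : set (state R) :=
  distinct_distances `&` distinct_drifts `&` no_triple_tie `&` nonneg_fading.

Lemma measurable_neq_set d (T : measurableType d) (f g : T -> R) :
  measurable_fun setT f -> measurable_fun setT g -> measurable [set x | f x != g x].
Proof.
move=> mf mg; rewrite (_ : [set x | _] = ~` [set x | f x = g x]).
  by apply: measurableC; exact: measurable_eq_set.
by apply/seteqP; split=> x /eqP.
Qed.

Lemma measurable_distinct (f : state R -> nat -> R) :
  (forall i, measurable_fun setT (fun z => f z i)) ->
  measurable [set z | forall i j, i != j -> f z i != f z j].
Proof.
move=> mf; rewrite [X in measurable X](_ : _ =
    \bigcap_i \bigcap_(j in [set j | i != j]) [set z | f z i != f z j]).
  apply: bigcapT_measurable => i; apply: bigcap_measurableType => j _.
  exact: measurable_neq_set.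
by apply/seteqP; split=> z /= h i; [move=> _ j; exact: h|exact: h].
Qed.

Lemma measurable_tie_free : measurable tie_free.
Proof.
apply: measurableI; [apply: measurableI; [apply: measurableI|]|].
- by apply: measurable_distinct => i; exact: measurable_sqdist.
- by apply: measurable_distinct => i; exact: measurable_drift.
- rewrite [X in measurable X](_ : _ = \bigcap_i \bigcap_(j in [set j | i != j])
      \bigcap_(k in [set k | i != k /\ j != k]) [set z | collinearity z i j k != 0%R]).
    apply: bigcapT_measurable => i; apply: bigcap_measurableType => j _.
    apply: bigcap_measurableType => k _; apply: measurable_neq_set => //.
    apply: measurable_funB; apply: measurable_funM; apply: measurable_funB;
      solve [exact: measurable_sqdist|exact: measurable_drift].
  apply/seteqP; split=> z /= h i; first by move=> _ j /= ij k [ik jk]; exact: h.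
  by move=> j k ij ik jk; apply: (h i I j ij k).
- rewrite [X in measurable X](_ : _ = \bigcap_n ((fun z => (z.2 n).2) @^-1` `[0%R, +oo[)).
    apply: bigcapT_measurable => n; apply: mpreimage => //.
    by apply: measurableT_comp => //; exact: measurable_state_v.
  apply/seteqP; split=> z /= h n; first by move=> _ /=; rewrite in_itv/= h.
  by have := h n I; rewrite /= in_itv/= andbT.
Qed.

Lemma sqdist_perm s z i : sqdist (perm_state s z) i = sqdist z (s i).
Proof. by []. Qed.

Lemma drift_perm s z i : drift (perm_state s z) i = drift z (s i).
Proof. by rewrite /drift /= ltnNge leq_addl/= addnK. Qed.

Lemma tie_free_sub s z : injective s -> tie_free z -> tie_free (perm_state s z).
Proof.
move=> inj [[[h1 h2] h3] h4]; split; [split; [split|]|].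
- by move=> i j ij; rewrite !sqdist_perm h1// inj_eq.
- by move=> i j ij; rewrite !drift_perm h2// inj_eq.
- move=> i j k ij ik jk; rewrite /collinearity !sqdist_perm !drift_perm.
  by apply: h3; rewrite inj_eq.
- by move=> n /=; case: ifP => _; exact: h4.
Qed.

Lemma perm_stateK s g z : cancel s g -> cancel g s -> perm_state g (perm_state s z) = z.
Proof.
move=> sg gs; case: z => x y; rewrite /perm_state/=; congr pair; apply/funext => n.
  by rewrite gs.
have [//|n3] := ltnP n 3.
by rewrite ltnNge leq_addl/= addnK gs subnK.
Qed.

Lemma perm_invariant_sub (G : set (state R)) :
  (forall s z, bijective s -> G z -> G (perm_state s z)) -> perm_invariant G.
Proof.
move=> sub s z [g sg gs]; apply/propext; split; last by apply: sub; exists g.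
by move/(sub g) => /(_ (Bijective gs sg)); rewrite perm_stateK.
Qed.

Lemma tie_free_perm : perm_invariant tie_free.
Proof. by apply: perm_invariant_sub => s z /bij_inj; exact: tie_free_sub. Qed.

Lemma distinct_distances_perm : perm_invariant distinct_distances.
Proof.
apply: perm_invariant_sub => s z /bij_inj inj h i j ij.
by rewrite !sqdist_perm h// inj_eq.
Qed.

End tie_free.

(** As x^-1 = x (x^2)^-1, the inverse reduces to a power function on nonnegative reals. *)
Lemma measurable_invr (R : realType) : measurable_fun setT (fun x : R => x^-1%R).
Proof.
rewrite (_ : (fun x : R => x^-1%R) = (fun x => x * (x ^+ 2) `^ (-1))%R).
  apply: measurable_funM => //; apply: (measurableT_comp (measurable_powR _)).
  exact: measurable_funX.
apply/funext => x; rewrite powR_inv1 ?sqr_ge0//.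
have [->|x0] := eqVneq x 0%R; first by rewrite mul0r invr0.
by field.
Qed.

Section tie_free_network.
Context d (T : measurableType d) (R : realType) (P : probability T R).
Variables (lam c m : R) (X : nat -> {RV P >-> (R * R)%type})
  (Theta F : nat -> {RV P >-> R}) (lawF : set R -> \bar R).
Hypothesis M : marked_model lam c m X Theta F lawF.
Let c0 : (0 < c)%R := model_c M.
Hypothesis fading_ge0 : \forall w \ae P, forall n, (0 <= m * F n w)%R.
Variable v : R.
Hypothesis v0 : (v != 0)%R.
Local Notation base := (base_state m X Theta F).
Local Notation net := (network_state c m X Theta F v).

Lemma sqdist_network t w i : sqdist (net t w) i =
  (c ^+ 2 * sqdist (base w) i + 2 * c * (v * t) * drift (base w) i + (v * t) ^+ 2)%R.
Proof.
rewrite /sqdist /drift /=; have := cos2Dsin2 (mark m Theta F (i + 3) w).1.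
set C := cos _; set D := sin _ => CD.
by rewrite -[((v * t) ^+ 2)%R in RHS]mulr1 -[X in (_ = _ + (v * t) ^+ 2 * X)%R]CD; ring.
Qed.

Lemma drift_network t w i : drift (net t w) i = (c * drift (base w) i + v * t)%R.
Proof.
rewrite /drift /=; have := cos2Dsin2 (mark m Theta F (i + 3) w).1.
set C := cos _; set D := sin _ => CD.
by rewrite -[(v * t)%R in RHS]mulr1 -CD; ring.
Qed.

(** Whatever does not involve the direction of station k differs from its drift. *)
Lemma drift_avoids k (f : state R -> R) : measurable_fun setT f ->
  (forall w, f (blanked m X Theta F (k + 3) w) = f (base w)) ->
  \forall w \ae P, drift (base w) k != f (base w).
Proof.
move=> mf bf; apply: filterS2 (locations_nonzero M) (direction_equation_null M k mf).
by move=> w Xk; rewrite -bf; apply; exact: Xk.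
Qed.

Lemma drift_blanked k i w : i != k ->
  drift (blanked m X Theta F (k + 3) w) i = drift (base w) i.
Proof. by move=> ik; rewrite /drift /= /blank eqn_add2r (negPf ik). Qed.

Lemma base_drifts_distinct : \forall w \ae P, distinct_drifts (base w).
Proof.
apply: ae_forall2 => i j.
have [->|ij] := eqVneq i j; first by apply: aeW.
apply: filterS (@drift_avoids i (fun z => drift z j) (@measurable_drift R j) _) => [w h _ //|w].
by rewrite drift_blanked// eq_sym.
Qed.

(** At time 0 the distances do not involve the directions, so that the direction argument
    is made at the time 1/v instead, when they do. *)
Lemma net_distances_distinct : \forall w \ae P, distinct_distances (net v^-1 w).
Proof.
apply: ae_forall2 => i j.
have [->|ij] := eqVneq i j; first by apply: aeW.
pose f (z : state R) := ((c ^+ 2 * sqdist z j + 2 * c * drift z j - c ^+ 2 * sqdist z i) / (2 * c))%R.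
have mf : measurable_fun setT f.
  apply: measurable_funM => //; apply: measurable_funB.
    by apply: measurable_funD; apply: measurable_funM => //;
      [exact: measurable_sqdist|exact: measurable_drift].
  by apply: measurable_funM => //; exact: measurable_sqdist.
apply: filterS (@drift_avoids i f mf _) => [w h _|w]; last first.
  by rewrite /f drift_blanked// eq_sym.
apply: contra h => /eqP; rewrite !sqdist_network mulfV// mulr1 => /addIr e.
apply/eqP; rewrite /f; apply: (canRL (mulfK _)); first by rewrite mulf_neq0// gt_eqF.
by move: e => /eqP; rewrite -subr_eq0 => /eqP e; apply/eqP; rewrite -subr_eq0; apply/eqP; rewrite -[RHS]e; ring.
Qed.

(** Given distinct distances, the determinant is a nonconstant affine function of the drift
    of the third station. *)
Lemma base_no_triple_tie : \forall w \ae P, distinct_distances (base w) ->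
  no_triple_tie (base w).
Proof.
suff h i j k : \forall w \ae P, distinct_distances (base w) ->
    i != j -> i != k -> j != k -> collinearity (base w) i j k != 0%R.
  have := ae_forall2 (fun i j => ae_foralln (h i j)).
  by apply: filterS => w h' dd i j k; exact: h'.
have [->|ij] := eqVneq i j; first by apply: aeW.
have [->|ik] := eqVneq i k; first by apply: aeW.
have [->|jk] := eqVneq j k; first by apply: aeW.
pose f (z : state R) := (drift z i - (sqdist z i - sqdist z k) * (drift z i - drift z j) *
   (sqdist z i - sqdist z j)^-1)%R.
have mf : measurable_fun setT f.
  apply: measurable_funB; first exact: measurable_drift.
  apply: measurable_funM; first (apply: measurable_funM; apply: measurable_funB;
    solve [exact: measurable_sqdist|exact: measurable_drift]).
  apply: (measurableT_comp (@measurable_invr R)).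
  by apply: measurable_funB; exact: measurable_sqdist.
apply: filterS (@drift_avoids k f mf _) => [w h dd _ _ _|w]; last first.
  by rewrite /f !drift_blanked.
apply: contra h; rewrite /collinearity /f.
have := dd i j ij; rewrite -subr_eq0; move: (sqdist _ i - _)%R => N N0 /eqP e.
apply/eqP; apply: (mulfI N0); rewrite mulrBr mulrCA mulfV// mulr1.
by apply/eqP; rewrite -subr_eq0; apply/eqP; rewrite -[RHS]oppr0 -e; ring.
Qed.

(** Stationarity moves the conclusion of [net_distances_distinct] to any time. *)
Lemma network_distinct_distances t : P (net t @^-1` @distinct_distances R) = 1.
Proof.
have mD : measurable (@distinct_distances R).
  by apply: measurable_distinct => i; exact: measurable_sqdist.
have mn s := @measurable_network_state _ _ _ _ c m X Theta F v s.
have lfs s := network_locally_finite_simple M v s.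
rewrite (@transfer_set R _ _ _ _ P P (net t) (net v^-1))//.
- by apply/(probability1_ae P) => //; [exact: mpreimage|exact: net_distances_distinct].
- exact: (same_voids_models v v M M).
- exact: distinct_distances_perm.
Qed.

(** The properties are checked at time 0 and transferred to the time t. *)
Theorem network_tie_free t : P (net t @^-1` @tie_free R) = 1.
Proof.
have mn s := @measurable_network_state _ _ _ _ c m X Theta F v s.
have mTF := @measurable_tie_free R.
have lfs s := network_locally_finite_simple M v s.
rewrite (@transfer_set R _ _ _ _ P P (net t) (net 0%R))//.
- have mD : measurable (@distinct_distances R).
    by apply: measurable_distinct => i; exact: measurable_sqdist.
  apply/(probability1_ae P); first exact: mpreimage.
  have dd := (probability1_ae P (mpreimage (mn 0%R) mD)).1 (network_distinct_distances 0).
  near=> w.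
  have ddw : distinct_distances (net 0%R w) by near: w.
  have ddb : distinct_distances (base w).
    move=> i j ij; have := ddw i j ij; rewrite !sqdist_network !mulr0 !mul0r.
    by apply: contra => /eqP ->.
  have c00 : (c != 0)%R by rewrite gt_eqF.
  split; [split; [split=> //|]|].
  + have : distinct_drifts (base w) by near: w; exact: base_drifts_distinct.
    move=> h i j ij; have := h i j ij; rewrite !drift_network; apply: contra.
    by move=> /eqP/addIr/(mulfI c00) ->.
  + have : no_triple_tie (base w).
      by move: (ddb); near: w; exact: base_no_triple_tie.
    move=> h i j k ij ik jk; have := h i j k ij ik jk; apply: contra => /eqP e.
    apply/eqP/(mulfI (expf_neq0 3 c00)); rewrite mulr0 -e /collinearity.
    by rewrite !sqdist_network !drift_network; ring.
  + by near: w; apply: filterS fading_ge0 => w h n; exact: h.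
- exact: (same_voids_models v v M M).
- exact: tie_free_perm.
Unshelve. all: by end_near. Qed.

End tie_free_network.

(** * Signal quality, distances and epochs of one configuration *)

Section extended_reals.
Context (R : realType).

(** The case y = 0, whose inverse is +oo, and the case of infinite y are included. *)
Lemma divepM (k x : R) (y : \bar R) : (0 < k)%R ->
  (k * x)%R%:E / (k%:E * y) = x%:E / y.
Proof.
move=> k0; have kn : k != 0%R by rewrite gt_eqF.
case: y => [y| |].
- rewrite -EFinM !inver mulf_eq0 (negPf kn)/=.
  case: ifPn => [_|y0]; first by rewrite mulrC EFinM -muleA gt0_muley ?lte_fin.
  by rewrite -!EFinM; congr EFin; field; rewrite kn y0.
- by rewrite gt0_muley ?lte_fin// invey !mule0.
- by rewrite gt0_muleNy ?lte_fin// inveNy EFinM [k%:E * _]muleC -muleA gt0_muleNy ?lte_fin.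
Qed.

Lemma ratio_scale (k : R) (x y : \bar R) : (0 < k)%R ->
  (k%:E * x)^-1 * (k%:E * y) = x^-1 * y.
Proof.
move=> k0; have kn : k != 0%R by rewrite gt_eqF.
have -> : (k%:E * x)^-1 = k^-1%:E * x^-1.
  case: x => [x| |].
  - rewrite -EFinM !inver mulf_eq0 (negPf kn)/=.
    case: ifPn => _; first by rewrite gt0_muley// lte_fin invr_gt0.
    by rewrite invfM EFinM.
  - by rewrite gt0_muley ?lte_fin// invey mule0.
  - by rewrite gt0_muleNy ?lte_fin// inveNy gt0_muleNy// lte_fin invr_gt0.
by rewrite muleACA -EFinM mulVf// mul1e.
Qed.

Lemma measurable_inve : measurable_fun setT (fun x : \bar R => x^-1).
Proof.
have -> : (fun x : \bar R => x^-1) = (fun x => if x == +oo then 0 else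
    if x == -oo then -oo else if x == 0 then +oo else ((fine x)^-1)%:E).
  apply/funext => x; case: (inveP x) => //=; rewrite ?eqxx// => r r0.
  by rewrite eqe (negPf r0).
have mE (y : \bar R) : measurable_fun setT (fun x : \bar R => x == y).
  apply: (measurable_fun_bool true); rewrite setTI.
  rewrite (_ : _ @^-1` _ = [set y]); first exact: emeasurable_set1.
  by apply/seteqP; split=> x /= => [/eqP//|->]; rewrite eqxx.
apply: measurable_fun_ifT => //; apply: measurable_fun_ifT => //.
apply: measurable_fun_ifT => //; apply/measurable_EFinP.
by apply: (measurableT_comp (@measurable_invr R)).
Qed.

Lemma measurable_lne : measurable_fun setT (@lne R).
Proof.
have -> : @lne R = (fun x => if x == +oo then +oo else
    if x <= 0 then -oo else (ln (fine x))%:E).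
  by apply/funext => -[x| |] //=; rewrite leNye.
apply: measurable_fun_ifT => //.
  apply: (measurable_fun_bool true); rewrite setTI.
  rewrite (_ : _ @^-1` _ = [set +oo]); first exact: emeasurable_set1.
  by apply/seteqP; split=> x /= => [/eqP//|->]; rewrite eqxx.
apply: measurable_fun_ifT => //.
  apply: (measurable_fun_bool true); rewrite setTI.
  exact: (emeasurable_itv (`]-oo, 0]%O)).
by apply/measurable_EFinP; apply: (measurableT_comp (@measurable_ln R)).
Qed.

End extended_reals.

Section null_modification.
Import HBNNSimple.
Context d (T : measurableType d) (R : realType) (P : probability T R).

(** The integrands need not be measurable: the integral of a nonnegative function is a
    supremum over simple functions below it, and cutting such a function off outside E does
    not change its integral. Measurability is not available for sums over epochs on the null
    set of configurations with ties. *)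
Lemma integral_le_off_null (f g : T -> \bar R) (E : set T) :
  (forall w, 0 <= f w) -> (forall w, 0 <= g w) -> measurable E -> P E = 1 ->
  (forall w, E w -> f w = g w) -> \int[P]_w f w <= \int[P]_w g w.
Proof.
move=> f0 g0 mE PE fg; rewrite !ge0_integralTE//.
apply: ge_ereal_sup => _ [h hf <-].
have hE : forall w, (indic E w * h w)%R%:E <= g w.
  move=> w; rewrite indicE; have [wE|wE] := boolP (w \in E).
    by rewrite mul1r -fg; [exact: hf|rewrite inE in wE].
  by rewrite mul0r.
pose hE' := mul_nnsfun (indic_nnsfun R mE) h.
have -> : sintegral P h = sintegral P hE'.
  rewrite -!integralT_nnsfun; apply: ae_eq_integral => //.
  - by apply/measurable_EFinP.
  - by apply/measurable_EFinP.
  have := (probability1_ae P mE).1 PE; apply: filterS => w Ew _.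
  by have -> : hE' w = (\1_E w * h w)%R by []; rewrite indicE mem_set// mul1r.
apply: ereal_sup_ubound; exists hE' => //.
Qed.

Lemma integral_eq_off_null (f g : T -> \bar R) (E : set T) :
  measurable E -> P E = 1 -> (forall w, E w -> f w = g w) ->
  \int[P]_w f w = \int[P]_w g w.
Proof.
move=> mE PE fg; rewrite [LHS]integralE [RHS]integralE.
by congr (_ - _); apply/eqP; rewrite eq_le; apply/andP; split;
  apply: (@integral_le_off_null _ _ E) => // w Ew;
  rewrite ?funeposE ?funenegE fg.
Qed.

End null_modification.

Section linear_growth.
Context (R : realType).

(** Cauchy's equation with monotonicity. The argument compares c with multiples of
    1/(n+1); an infinite value at 1 forces infinite values everywhere. *)
Lemma additive_linear (h : R -> \bar R) : (forall c, (0 < c)%R -> 0 <= h c) ->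
  (forall a b, (0 < a)%R -> (0 < b)%R -> h (a + b)%R = h a + h b) ->
  forall c, (0 < c)%R -> h c = c%:E * h 1%R.
Proof.
move=> h0 hD.
have mono a b : (0 < a)%R -> (a <= b)%R -> h a <= h b.
  move=> a0; rewrite le_eqVlt => /orP[/eqP->//|ab].
  by rewrite -(subrKC a b) hD ?subr_gt0// leeDl// h0 ?subr_gt0.
have natM n a : (0 < a)%R -> h (n.+1%:R * a)%R = n.+1%:R%:E * h a.
  move=> a0; elim: n => [|n IH]; first by rewrite mul1r mul1e.
  rewrite -natr1 mulrDl mul1r hD ?mulr_gt0// IH [in RHS]EFinD.
  by rewrite ge0_muleDl ?lee_fin// mul1e.
have unit n : h 1%R = n.+1%:R%:E * h (n.+1%:R^-1)%R.
  by rewrite -natM ?invr_gt0// mulfV.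
move=> c c0; have [h1|h1] := eqVneq (h 1%R) +oo.
  rewrite h1 gt0_muley ?lte_fin//.
  have [n nc] : exists n, (n.+1%:R^-1 <= c)%R.
    exists (Num.truncn c^-1); rewrite invf_ple ?posrE//.
    exact/ltW/truncnS_gt.
  have hn : h (n.+1%:R^-1)%R = +oo.
    have := unit n; rewrite h1 => /esym; have := h0 (n.+1%:R^-1)%R.
    rewrite invr_gt0 ltr0n => /(_ isT).
    by case: (h _) => // r _; rewrite -EFinM.
  apply/eqP; rewrite -leye_eq -hn; apply: mono => //.
have fin1 : h 1%R \is a fin_num by rewrite ge0_fin_numE ?h0// lt_neqAle h1 leey.
have bounds n : ((Num.truncn (c * n.+1%:R))%:R / n.+1%:R)%:E * h 1%R <= h c <=
    ((Num.truncn (c * n.+1%:R)).+1%:R / n.+1%:R)%:E * h 1%R.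
  set k := Num.truncn _.
  have n0 : (0 < n.+1%:R^-1 :> R)%R by rewrite invr_gt0.
  have hk j : (j.+1%:R / n.+1%:R)%:E * h 1%R = h (j.+1%:R / n.+1%:R)%R.
    rewrite natM// [in LHS](unit n) muleA -EFinM divfK//.
  have cn0 : (0 <= c * n.+1%:R)%R by rewrite mulr_ge0// ltW.
  have /andP[k1 k2] := truncn_itv cn0; rewrite -/k in k1 k2.
  apply/andP; split; last first.
    by rewrite hk; apply: mono => //; rewrite ler_pdivlMr// ltW.
  case: k k1 {k2} => [|j] k1; first by rewrite mul0r mul0e h0.
  by rewrite hk; apply: mono; rewrite ?mulr_gt0// ler_pdivrMr.
move: (h1); rewrite -(fineK fin1) => _.
set y := fine _; have y0 : (0 <= y)%R by rewrite fine_ge0// h0.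
have hc : h c \is a fin_num.
  rewrite ge0_fin_numE ?h0//; have /andP[_ /le_lt_trans] := bounds 0%N; apply.
  by rewrite -(fineK fin1) -EFinM ltry.
rewrite -(fineK hc) -EFinM; congr EFin.
have close n : (`|fine (h c) - c * y| <= y / n.+1%:R)%R.
  have l := bounds n; rewrite -(fineK fin1) -(fineK hc) -!EFinM !lee_fin -/y in l.
  have /andP[l1 l2] := l.
  have cn0 : (0 <= c * n.+1%:R)%R by rewrite mulr_ge0// ltW.
  have /andP[k1 k2] := truncn_itv cn0; move: l1 l2 k1 k2; set k := Num.truncn _.
  rewrite -[k.+1%:R]natr1 => l1 l2 k1 k2.
  have n0 : (0 < n.+1%:R :> R)%R by [].
  have {}k1 : (k%:R / n.+1%:R <= c)%R by rewrite ler_pdivrMr.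
  have {}k2 : (c <= (k%:R + 1)/ n.+1%:R)%R by rewrite ler_pdivlMr// ltW.
  have e1 : ((k%:R + 1)/ n.+1%:R * y = k%:R / n.+1%:R * y + y / n.+1%:R)%R by field; rewrite lt0r_neq0.
  have := ler_wpM2r y0 k1; have := ler_wpM2r y0 k2.
  rewrite e1 in l2; rewrite e1 ler_distl.
  move: (k%:R / n.+1%:R * y)%R (y / n.+1%:R)%R (c * y)%R (fine (h c)) l1 l2 => *.
  by apply/andP; split; lra.
apply/eqP; rewrite -subr_eq0 -normr_eq0 eq_le normr_ge0 andbT.
apply/ler_addgt0Pl => e e0; rewrite addr0.
have [n ny] : exists n, (y / n.+1%:R <= e)%R.
  exists (Num.truncn (y / e)); rewrite ler_pdivrMr// mulrC -ler_pdivrMr//.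
  exact/ltW/truncnS_gt.
exact: le_trans (close n) ny.
Qed.

End linear_growth.

Section interference_powers.
Context (R : realType) (a : interference).
Implicit Types (named : seq R) (other : nat -> R) (ex : seq nat).

Lemma eq_total_interference named other ex other' ex' :
  (forall k, k \notin ex -> other k = other' k) -> ex =i ex' ->
  total_interference a named other ex = total_interference a named other' ex'.
Proof.
move=> oo ee; case: a => /=.
  congr (_ + _); under eq_eseriesl do rewrite ee.
  by apply: eq_eseriesr => k kx; rewrite oo// ee.
congr (ereal_sup (_ `|` _)); apply/seteqP; split=> _ [k /= kx <-]; exists k => //=.
- by rewrite -ee.
- by rewrite oo.
- by rewrite ee.
- by rewrite oo// ee.
Qed.

Lemma total_interference_ge0 named other ex : {in named, forall x, (0 <= x)%R} ->
  (forall k, (0 <= other k)%R) -> 0 <= total_interference a named other ex.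
Proof.
move=> named0 other0; case: a => /=.
  apply: adde_ge0; last by apply: nneseries_ge0 => k _ _; rewrite lee_fin.
  by rewrite lee_fin big_seq sumr_ge0.
have [k kx] : exists k, k \notin ex.
  exists (\max_(i <- ex) i).+1; apply/negP => h.
  by have := @leq_bigmax_seq _ ex xpredT id _ h isT; rewrite ltnn.
apply: le_trans (ereal_sup_ubound _); last by right; exists k.
by rewrite lee_fin.
Qed.

(** Positive scaling commutes with sums, series and suprema. *)
Lemma total_interference_scale (k : R) named other ex : (0 < k)%R ->
  {in named, forall x, (0 <= x)%R} -> (forall j, (0 <= other j)%R) ->
  total_interference a [seq (k * x)%R | x <- named] (fun j => k * other j)%R ex =
  k%:E * total_interference a named other ex.
Proof.
move=> k0 named0 other0; case: a => /=.
  rewrite ge0_muleDr; last 2 first.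
  - by rewrite lee_fin big_seq sumr_ge0.
  - by apply: nneseries_ge0 => j _ _; rewrite lee_fin.
  rewrite big_map -mulr_sumr EFinM -nneseriesZl//.
  by move=> j _; rewrite lee_fin.
rewrite -ereal_sup_pZl//; congr ereal_sup; rewrite image_setU; congr (_ `|` _).
  apply/seteqP; split=> [_ [x /= /mapP[y yn ->] <-]|_ [_ [x /= xn <-] <-]].
    by exists y%:E => //; exists y.
  by exists (k * x)%R => //=; exact: map_f.
apply/seteqP; split=> [_ [j /= jx <-]|_ [_ [j /= jx <-] <-]].
  by exists (other j)%:E => //; exists j.
by exists j.
Qed.

Lemma total_interference_perm s named other ex : bijective s ->
  (forall j, (0 <= other j)%R) ->
  total_interference a named (other \o s) ex =
  total_interference a named other [seq s i | i <- ex].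
Proof.
move=> bs other0; have injs := bij_inj bs; have [g sg gs] := bs.
have ex_map k : (s k \notin [seq s i | i <- ex]) = (k \notin ex) by rewrite mem_map.
case: a => /=.
  congr (_ + _); rewrite !nneseries_esum; do ?by move=> j _; rewrite lee_fin.
  apply/esym; apply: (reindex_esum _ _ s); split=> /=.
  - by move=> k /=; rewrite ex_map.
  - by move=> i j _ _ /injs.
  - by move=> k /= kx; exists (g k) => //=; rewrite -ex_map gs.
congr (ereal_sup (_ `|` _)); apply/seteqP; split=> _ [k /= kx <-].
- by exists (s k) => //=; rewrite ex_map.
- by exists (g k) => /=; [rewrite -ex_map gs|rewrite gs].
Qed.

End interference_powers.

Section signal.
Context (R : realType) (a : interference) (alpha : R).
Local Notation quality := (signal_quality a 0 alpha).

(** A common factor of all the powers, here k c^(-alpha), cancels in the ratio of signal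
    and interference because there is no noise. *)
Lemma signal_quality_scale (k c : R) (F F' : nat -> R) (D D' : nat -> R -> R) t t' o :
  (0 < k)%R -> (0 < c)%R -> (forall n, (0 <= F n)%R) -> (forall i, (0 <= D i t)%R) ->
  (forall n, F' n = k * F n)%R -> (forall i, D' i t' = c * D i t)%R ->
  quality F' D' t' o = quality F D t o.
Proof.
move=> k0 c0 F0 D0 F'E D'E; case: o => i s.
pose K := (k * c `^ (- alpha))%R.
have K0 : (0 < K)%R by rewrite mulr_gt0// powR_gt0.
have KE n j : (F' n * D' j t' `^ (- alpha) = K * (F n * D j t `^ (- alpha)))%R.
  by rewrite F'E D'E powRM ?(ltW c0)//; rewrite /K; ring.
rewrite /signal_quality expr0n/= !add0e KE -[RHS](divepM _ _ K0); congr (_ / _).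
rewrite -total_interference_scale//; last 2 first.
- by move=> _ /mapP[n _ ->]; rewrite mulr_ge0// powR_ge0.
- by move=> j; rewrite mulr_ge0// powR_ge0.
rewrite -map_comp; under eq_map do rewrite KE.
by apply: eq_total_interference.
Qed.

Lemma signal_quality_ge0 (F : nat -> R) D t o : (forall n, (0 <= F n)%R) ->
  0 <= quality F D t o.
Proof.
move=> F0; case: o => i s; rewrite /signal_quality expr0n/= add0e mule_ge0//.
  by rewrite lee_fin mulr_ge0// powR_ge0.
rewrite inve_ge0; apply: total_interference_ge0 => [_ /mapP[n _ ->]|k];
by rewrite mulr_ge0// powR_ge0.
Qed.

(** Station i of a relabelled configuration is station s i of the original one. *)
Definition rename (s : nat -> nat) (o : observation) : observation :=
  (s o.1, [seq s i | i <- o.2]).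

Lemma signal_quality_perm s (F F' : nat -> R) (D D' : nat -> R -> R) t o :
  bijective s -> (forall n, (0 <= F n)%R) ->
  (forall n, (n < 3)%N -> F' n = F n) -> (forall k, F' (k + 3)%N = F (s k + 3)%N) ->
  (forall i, D' i t = D (s i) t) -> (size o.2 <= 2)%N ->
  quality F' D' t o = quality F D t (rename s o).
Proof.
move=> bs F0 F'3 F'E D'E; case: o => i r /= r2.
rewrite F'3// D'E size_map.
rewrite -(@total_interference_perm _ a s _ _ (i :: r) bs); last first.
  by move=> j; rewrite mulr_ge0// powR_ge0.
congr (_ / (_ + _)).
have -> : [seq (F' n.+1 * D' (nth 0 r n) t `^ (- alpha))%R | n <- iota 0 (size r)] =
    [seq (F n.+1 * D (nth 0 (map s r) n) t `^ (- alpha))%R | n <- iota 0 (size r)].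
  apply/eq_in_map => n; rewrite mem_iota add0n => /andP[_ nr].
  by rewrite F'3 ?D'E ?(nth_map 0%N)// ltnS (leq_trans nr).
by apply: eq_total_interference => // k _ /=; rewrite F'E D'E.
Qed.

(** Exchanging the serving and the interfering station of a handover is harmless: the
    fading variables belong to the roles, and both stations are at the same distance. *)
Lemma signal_quality_swap F D t i j : D i t = D j t ->
  quality F D t (i, [:: j]) = quality F D t (j, [:: i]).
Proof.
move=> ij; rewrite /signal_quality/= ij; congr (_ / (_ + _)).
by apply: eq_total_interference => // k; rewrite !inE orbC.
Qed.

Lemma signal_quality_swap2 F D t l i j : D i t = D j t ->
  quality F D t (l, [:: i; j]) = quality F D t (l, [:: j; i]).
Proof.
move=> ij; rewrite /signal_quality/= ij; congr (_ / (_ + _)).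
by apply: eq_total_interference => // k; rewrite !inE [(k == i) || _]orbC.
Qed.

Context d (T : measurableType d).

(** The supremum exceeds a level exactly when one of countably many powers does. *)
Lemma measurable_total_interference (named : T -> seq R) (g : nat -> T -> R)
    (r : seq nat) (other : T -> nat -> R) ex :
  (forall z, named z = [seq g n z | n <- r]) ->
  (forall n, measurable_fun setT (g n)) ->
  (forall k, measurable_fun setT (fun z => other z k)) ->
  (forall z k, (0 <= other z k)%R) ->
  measurable_fun setT (fun z => total_interference a (named z) (other z) ex).
Proof.
move=> nE mg mo other0; case: a => /=.
  apply: emeasurable_funD.
    apply/measurable_EFinP; under eq_fun do rewrite nE big_map.
    by apply: measurable_sum.
  apply: (@ge0_emeasurable_sum _ _ _ setT (fun k z => (other z k)%:E)
    [pred k | k \notin ex]) => [k z _ _|k _].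
    by rewrite lee_fin.
  by apply/measurable_EFinP.
move=> _; apply: (measurability _ (ErealGenOInfty.measurableE R)) => //.
move=> _ [_ [y ->] <-]; rewrite setTI.
rewrite [X in measurable X](_ : _ =
  \bigcup_(n in [set` r]) [set z | y%:E < (g n z)%:E] `|`
  \bigcup_(k in [set k | k \notin ex]) [set z | y%:E < (other z k)%:E]).
  have mlt (h : T -> R) : measurable_fun setT h -> measurable [set z | y%:E < (h z)%:E].
    move=> mh; rewrite -[X in measurable X]setTI.
    by apply: emeasurable_fun_o_infty => //; apply/measurable_EFinP.
  by apply: measurableU; apply: bigcup_measurable => n _; exact: mlt.
apply/seteqP; split=> z /=; rewrite in_itv/= andbT.
  move=> /ereal_sup_gt[_ [[x /= + <-]|[k /= kx <-]] yx].
    by rewrite nE => /mapP[n nr xE]; left; exists n => //=; rewrite -xE.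
  by right; exists k.
move=> [[n /= nr]|[k /= kx]] /lt_le_trans; apply; apply: ereal_sup_ubound.
  by left; exists (g n z) => //=; rewrite nE; exact: map_f.
by right; exists k.
Qed.

Lemma measurable_signal_quality (F : T -> nat -> R) (D : T -> nat -> R -> R) (t : T -> R) o :
  (forall n, measurable_fun setT (fun z => F z n)) ->
  (forall i, measurable_fun setT (fun z => D z i (t z))) ->
  (forall z n, (0 <= F z n)%R) ->
  measurable_fun setT (fun z => quality (F z) (D z) (t z) o).
Proof.
case: o => i s mF mD F0.
have mp n j : measurable_fun setT (fun z => (F z n * D z j (t z) `^ (- alpha))%R).
  by apply: measurable_funM => //; apply: (measurableT_comp (measurable_powR _)).
apply: emeasurable_funM; first by apply/measurable_EFinP.
apply: (measurableT_comp (@measurable_inve R)).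
apply: emeasurable_funD => //.
apply: (@measurable_total_interference _
  (fun n z => F z n.+1 * D z (nth 0 s n) (t z) `^ (- alpha))%R) => //.
by move=> z k; rewrite mulr_ge0// powR_ge0.
Qed.

End signal.

Section geometry.
Context (R : realType) (v : R).
Hypothesis v0 : (0 < v)%R.
Implicit Types (z : state R) (e : epoch R) (o : observation).

Definition state_dist z : nat -> R -> R :=
  dist v (fun i (z : state R) => z.1 i) (fun i (z : state R) => (z.2 (i + 3)%N).1) z.

Definition sqdist_at z i t : R := (sqdist z i + 2 * (v * t) * drift z i + (v * t) ^+ 2)%R.

Lemma sqdist_at_sum z i t : sqdist_at z i t =
  (((z.1 i).1 + v * t * cos (z.2 (i + 3)%N).1) ^+ 2 +
   ((z.1 i).2 + v * t * sin (z.2 (i + 3)%N).1) ^+ 2)%R.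
Proof.
rewrite /sqdist_at /sqdist /drift; have := cos2Dsin2 (z.2 (i + 3)%N).1.
set C := cos _; set D := sin _ => CD.
by rewrite -[((v * t) ^+ 2)%R]mulr1 -[X in (_ + (v * t) ^+ 2 * X)%R]CD; ring.
Qed.

Lemma sqdist_at_ge0 z i t : (0 <= sqdist_at z i t)%R.
Proof. by rewrite sqdist_at_sum addr_ge0// sqr_ge0. Qed.

Lemma state_distE z i t : state_dist z i t = Num.sqrt (sqdist_at z i t).
Proof. by rewrite sqdist_at_sum. Qed.

Lemma state_dist_inj z i j t u : state_dist z i t = state_dist z j u ->
  sqdist_at z i t = sqdist_at z j u.
Proof.
rewrite !state_distE => /(congr1 (fun x => x ^+ 2)%R).
by rewrite !sqr_sqrtr ?sqdist_at_ge0.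
Qed.

(** The squared distance is a parabola in v t with its minimum at v t = - drift. *)
Lemma closest_approachE z i t : closest_approach (state_dist z) i t <->
  (v * t + drift z i = 0)%R.
Proof.
have sq u : sqdist_at z i u = ((v * u + drift z i) ^+ 2 + (sqdist z i - drift z i ^+ 2))%R.
  by rewrite /sqdist_at; ring.
split=> [/(_ (- drift z i / v)%R)|ct u].
  rewrite !state_distE ler_sqrt ?sqdist_at_ge0// !sq lerD2r mulrCA mulfV ?gt_eqF//.
  by rewrite mulr1 addNr expr0n => h; apply/eqP; rewrite -sqrf_eq0 eq_le h sqr_ge0.
by rewrite !state_distE ler_sqrt ?sqdist_at_ge0// !sq lerD2r ct expr0n sqr_ge0.
Qed.

Lemma tie_equation z i j t : state_dist z i t = state_dist z j t ->
  (sqdist z i - sqdist z j = - (2 * (v * t)) * (drift z i - drift z j))%R.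
Proof.
move/state_dist_inj => /eqP; rewrite -subr_eq0 => /eqP e.
by apply/eqP; rewrite -subr_eq0 -e /sqdist_at; apply/eqP; ring.
Qed.

(** A third station at the same distance would put three lines through one point. *)
Lemma tie_pair z i j k t : tie_free z -> i <> j ->
  state_dist z i t = state_dist z j t -> state_dist z i t = state_dist z k t ->
  k = i \/ k = j.
Proof.
move=> [[_ nt] _] /eqP ij /tie_equation e1 /tie_equation e2.
have [->|ki] := eqVneq k i; first by left.
have [->|kj] := eqVneq k j; first by right.
have := nt i j k ij; rewrite eq_sym ki eq_sym kj => /(_ isT isT) /eqP[].
by rewrite /collinearity e1 e2; ring.
Qed.

Lemma state_dist_perm s z i t : state_dist (perm_state s z) i t = state_dist z (s i) t.
Proof. by rewrite !state_distE /sqdist_at sqdist_perm drift_perm. Qed.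

(** A typical time is treated as an epoch too: the configuration is observed at the time 0,
    after being moved to the time in question. *)
Definition observes_at e (t : R) := if e is typical_time _ then t = 0%R else True.

(** The time at which an observation takes place, if it does: a tie or a closest approach
    determines it. *)
Definition epoch_time e z o : R :=
  match e, o with
  | handover, (i, [:: j]) =>
      ((sqdist z i - sqdist z j) / (- 2 * v * (drift z i - drift z j)))%R
  | max_signal, (i, [::]) => (- drift z i / v)%R
  | max_interference, (j, [:: i]) => (- drift z i / v)%R
  | interference_handover, (l, [:: i; j]) =>
      ((sqdist z i - sqdist z j) / (- 2 * v * (drift z i - drift z j)))%R
  | _, _ => 0%R
  end.

Lemma closest_approach_time z i t : closest_approach (state_dist z) i t ->
  t = (- drift z i / v)%R.
Proof.
move/closest_approachE => /eqP; rewrite addr_eq0 => /eqP <-.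
by rewrite mulrAC mulfV ?mul1r// gt_eqF.
Qed.

Lemma tie_time z i j t : tie_free z -> i <> j -> state_dist z i t = state_dist z j t ->
  t = ((sqdist z i - sqdist z j) / (- 2 * v * (drift z i - drift z j)))%R.
Proof.
move=> [[[_ dd] _] _] /eqP ij /tie_equation ->.
have := dd i j ij; rewrite -subr_eq0 => a0.
by field; rewrite a0 gt_eqF.
Qed.

Lemma observed_time e z t o : tie_free z -> observes_at e t ->
  observed e (state_dist z) t o -> t = epoch_time e z o.
Proof.
case: e o => [||||t0] [i [|j [|k [|l r]]]] tf //= et.
- by move=> [ij [e1 _]]; exact: tie_time.
- by move=> [ca _]; exact: closest_approach_time.
- by move=> [ca _]; exact: closest_approach_time.
- by move=> [jk [e1 _]]; exact: tie_time.
Qed.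

Lemma only_closer_unique z l l' h t : only_closer (state_dist z) l h t ->
  only_closer (state_dist z) l' h t -> l = l'.
Proof. by move=> [lh _] [_]; exact. Qed.

(** Used in both directions to show that two interference handovers at the same time have
    the same height: of two tied stations below the height, one would be a second closer
    station. *)
Lemma only_closer_height z l l' i j t : i <> j ->
  state_dist z i t = state_dist z j t ->
  only_closer (state_dist z) l' l t -> (l <= state_dist z i t)%R.
Proof.
move=> ij e1 [_ u]; rewrite leNgt; apply/negP => h; apply: ij.
by rewrite (u i)// (u j)// -e1.
Qed.

(** By the absence of triple ties, a tied pair is determined up to order; by distinct
    drifts, at most one station is at its closest approach. *)
Lemma observed_unique e z t o o' : tie_free z -> observes_at e t ->
  observed e (state_dist z) t o -> observed e (state_dist z) t o' ->
  o' = o \/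
  exists i j, state_dist z i t = state_dist z j t /\
    ((o = (i, [:: j]) /\ o' = (j, [:: i])) \/
     exists l, o = (l, [:: i; j]) /\ o' = (l, [:: j; i])).
Proof.
move=> tf; have [[[dn da] _] _] := tf.
have dinj i i' : drift z i = drift z i' -> i' = i.
  by move=> e1; apply/eqP/negPn/negP; rewrite eq_sym => /da; rewrite e1 eqxx.
have cinj i i' : closest_approach (state_dist z) i t ->
    closest_approach (state_dist z) i' t -> i' = i.
  by move=> /closest_approachE h /closest_approachE h'; apply: dinj; lra.
case: e => [||||t0] /=.
- case: o => i [|j []]//; case: o' => i' [|j' []]// _ [ij [e1 n1]] [ij' [e1' n1']].
  have ii' : state_dist z i t = state_dist z i' t.
    by apply/eqP; rewrite eq_le n1 n1'.
  have [] := tie_pair tf ij e1 ii' => ei;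
  have [] := tie_pair tf ij e1 (etrans ii' e1') => ej; subst.
  + by case: ij'.
  + by left.
  + by right; exists i, j; split => //; left.
  + by case: ij'.
- case: o => i []//; case: o' => i' []// _ [c1 _] [c2 _].
  by left; rewrite (cinj _ _ c1 c2).
- case: o => i [|j []]//; case: o' => i' [|j' []]// _ [c1 o1] [c2 o2].
  have ej := cinj _ _ c1 c2; subst; left.
  by rewrite (only_closer_unique o1 o2).
- case: o => l [|i [|j []]]//; case: o' => l' [|i' [|j' []]]// _ [ij [e1 o1]] [ij' [e1' o1']].
  have ii' : state_dist z i t = state_dist z i' t.
    apply/eqP; rewrite eq_le (only_closer_height ij e1 o1').
    by rewrite (only_closer_height ij' e1' o1).
  rewrite -ii' in o1'; have el := only_closer_unique o1 o1'; subst.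
  have [] := tie_pair tf ij e1 ii' => ei;
  have [] := tie_pair tf ij e1 (etrans ii' e1') => ej; subst.
  + by case: ij'.
  + by left.
  + by right; exists i, j; split => //; right; exists l'.
  + by case: ij'.
- case: o => i []//; case: o' => i' []// t0' n1 n1'.
  left; congr pair; apply/eqP/negPn/negP; rewrite eq_sym => /dn /eqP[].
  have /state_dist_inj : state_dist z i t = state_dist z i' t.
    by apply/eqP; rewrite eq_le n1 n1'.
  by rewrite /sqdist_at t0' !mulr0 !mul0r !addr0 => /addIr.
Qed.

Lemma observed_perm e s z t o : bijective s ->
  observed e (state_dist (perm_state s z)) t o <->
  observed e (state_dist z) t (rename s o).
Proof.
move=> bs; have injs := bij_inj bs; have [g sg gs] := bs.
have DE i u := state_dist_perm s z i u.
have ca i : closest_approach (state_dist (perm_state s z)) i t <->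
    closest_approach (state_dist z) (s i) t.
  by split=> h u; have := h u; rewrite !DE.
have ne i : nearest (state_dist (perm_state s z)) i t <->
    nearest (state_dist z) (s i) t.
  by split=> h k; [have := h (g k)|have := h (s k)]; rewrite !DE ?gs.
have oc l h : only_closer (state_dist (perm_state s z)) l h t <->
    only_closer (state_dist z) (s l) h t.
  split=> -[h1 h2]; split; rewrite ?DE// in h1 *; move=> k kh.
    by rewrite -(h2 (g k)) ?gs// DE gs.
  by apply: injs; apply: h2; rewrite -DE.
have inj i j : i <> j <-> s i <> s j.
  by split=> h e1; apply: h; [exact: injs|rewrite e1].
case: e o => [||||t0] [i [|j [|k [|l r]]]] //=; rewrite ?DE.
- by rewrite ne inj.
- by rewrite ca ne.
- by rewrite ca oc.
- by rewrite inj oc.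
Qed.

Lemma measurable_state_dist (t : state R -> R) i : measurable_fun setT t ->
  measurable_fun setT (fun z => state_dist z i (t z)).
Proof.
move=> mt; have mvt : measurable_fun setT (fun z => v * t z)%R by exact: measurable_funM.
rewrite (_ : (fun z => _) = fun z => Num.sqrt (sqdist_at z i (t z))); last first.
  by apply/funext => z; rewrite state_distE.
apply: (@measurableT_comp _ _ _ _ _ _ (@Num.sqrt R)).
  by apply: continuous_measurable_fun; exact: sqrt_continuous.
apply: measurable_funD; last exact: measurable_funX.
apply: measurable_funD; first exact: measurable_sqdist.
by apply: measurable_funM; [exact: measurable_funM|exact: measurable_drift].
Qed.

Lemma measurable_closest_approach (t : state R -> R) i : measurable_fun setT t ->
  measurable [set z | closest_approach (state_dist z) i (t z)].
Proof.
move=> mt; rewrite [X in measurable X](_ : _ = [set z | (v * t z + drift z i = 0)%R]).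
  apply: measurable_eq_set => //; apply: measurable_funD; last exact: measurable_drift.
  exact: measurable_funM.
by apply/seteqP; split=> z /closest_approachE.
Qed.

Lemma measurable_ltr_set (f g : state R -> R) : measurable_fun setT f ->
  measurable_fun setT g -> measurable [set z | (f z < g z)%R].
Proof.
move=> mf mg; rewrite [X in measurable X](_ : _ = (fun z => g z - f z)%R @^-1` `]0%R, +oo[).
  by apply: mpreimage => //; exact: measurable_funB.
by apply/seteqP; split=> z /=; rewrite in_itv/= andbT subr_gt0.
Qed.

Lemma measurable_nearest (t : state R -> R) i : measurable_fun setT t ->
  measurable [set z | nearest (state_dist z) i (t z)].
Proof.
move=> mt; rewrite [X in measurable X](_ : _ =
  \bigcap_k ~` [set z | (state_dist z k (t z) < state_dist z i (t z))%R]).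
  apply: bigcapT_measurable => k; apply: measurableC; apply: measurable_ltr_set;
  exact: measurable_state_dist.
apply/seteqP; split=> z /= h k; first by move=> _ /=; apply/negP; rewrite -leNgt.
by rewrite leNgt; apply/negP => /(h k I).
Qed.

Lemma measurable_only_closer (t h : state R -> R) l : measurable_fun setT t ->
  measurable_fun setT h ->
  measurable [set z | only_closer (state_dist z) l (h z) (t z)].
Proof.
move=> mt mh; apply: measurableI.
  by apply: measurable_ltr_set => //; exact: measurable_state_dist.
rewrite [X in measurable X](_ : _ =
  \bigcap_(k in [set k | k != l]) ~` [set z | (state_dist z k (t z) < h z)%R]).
  apply: bigcap_measurableType => k _; apply: measurableC; apply: measurable_ltr_set => //.
  exact: measurable_state_dist.
apply/seteqP; split=> z /= hz k.
  by move=> /= /eqP kl kh; apply: kl; exact: hz.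
by move=> kh; apply/eqP/negPn/negP => kl; exact: (hz k kl).
Qed.

Lemma measurable_Prop (Q : Prop) : measurable [set _ : state R | Q].
Proof.
have [q|q] := pselect Q.
  by rewrite (_ : [set _ | Q] = setT)//; apply/seteqP; split.
by rewrite (_ : [set _ | Q] = set0)//; apply/seteqP; split.
Qed.

Lemma measurable_observed e (t : state R -> R) o : measurable_fun setT t ->
  measurable [set z | observed e (state_dist z) (t z) o].
Proof.
move=> mt; have mD i := measurable_state_dist i mt.
have mF : measurable [set _ : state R | False] := measurable_Prop False.
case: e o => [||||t0] [i [|j [|k [|l r]]]] //=.
- apply: measurableI; first exact: measurable_Prop.
  by apply: measurableI; [exact: measurable_eq_set|exact: measurable_nearest].
- by apply: measurableI; [exact: measurable_closest_approach|exact: measurable_nearest].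
- by apply: measurableI; [exact: measurable_closest_approach|exact: measurable_only_closer].
- apply: measurableI; first exact: measurable_Prop.
  by apply: measurableI; [exact: measurable_eq_set|exact: measurable_only_closer].
- exact: measurable_nearest.
Qed.

Lemma measurable_epoch_time e o : measurable_fun setT (fun z => epoch_time e z o).
Proof.
have mn i := @measurable_sqdist R i; have ma i := @measurable_drift R i.
have m1 i : measurable_fun setT (fun z => - drift z i / v)%R.
  by apply: measurable_funM => //; exact: measurableT_comp.
have m2 i j : measurable_fun setT (fun z =>
    (sqdist z i - sqdist z j) / (- 2 * v * (drift z i - drift z j)))%R.
  apply: measurable_funM; first exact: measurable_funB.
  apply: (measurableT_comp (@measurable_invr R)).
  by apply: measurable_funM => //; exact: measurable_funB.
by case: e o => [||||t0] [i [|j [|k [|l r]]]] //=; exact: measurable_cst.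
Qed.

End geometry.

(** * Sums over the epochs of a configuration *)

Section first_observation.
Context (R : realType) (e : epoch R) (D : nat -> R -> R) (t : R).
Implicit Types o : observation.

Definition first_observed o := observed e D t o /\
  forall o', observed e D t o' -> (choice.pickle o <= choice.pickle o')%N.

Lemma first_observed_unique o o' : first_observed o -> first_observed o' -> o = o'.
Proof.
move=> [h1 h2] [h1' h2']; apply: (pcan_inj choice.pickleK).
by apply/eqP; rewrite eqn_leq h2// h2'.
Qed.

Lemma observation_atP : epoch_times e D t -> first_observed (observation_at e D t).
Proof.
move=> [ o ho]; apply: (@xgetPex _ _ (fun o => first_observed o)).
pose Q n := `[< exists o', observed e D t o' /\ choice.pickle o' = n >].
have [|n /asboolP[ o' [ho' on]] nmin] := ex_minnP (P := Q).
  by exists (choice.pickle o); apply/asboolP; exists o.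
exists o'; split => // o'' ho''; rewrite on; apply: nmin.
by apply/asboolP; exists o''.
Qed.

Lemma first_observed_at o : first_observed o -> observation_at e D t = o.
Proof.
move=> ho; have te : epoch_times e D t by exists o; case: ho.
exact: first_observed_unique (observation_atP te) ho.
Qed.

End first_observation.

Section countable_sums.
Context (R : realType) (T : countType).

(** The enumeration of a countable type turns a sum over it into a series, to which the
    measurability results for series apply. The test on n discards the codes of no element. *)
Lemma esum_countType (a : T -> \bar R) : (forall o, 0 <= a o) ->
  \esum_(o in setT) a o =
  \sum_(0 <= n <oo) (if choice.unpickle n is Some o then
    if choice.pickle o == n then a o else 0 else 0).
Proof.
move=> a0; pose b n := if choice.unpickle n is Some o then
    if choice.pickle o == n then a o else 0 else 0.
have b0 n : 0 <= b n by rewrite /b; case: choice.unpickle => // o; case: ifP.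
rewrite -/b nneseries_esumT//.
transitivity (\esum_(n in range (choice.pickle : T -> nat)) b n).
  rewrite (@reindex_esum R T nat setT (range (choice.pickle : T -> nat)) choice.pickle).
    by apply: eq_esum => o _; rewrite /b choice.pickleK eqxx.
  split=> [ o _|o o' _ _|n [ o _ <-]]; [by exists o|exact: (pcan_inj choice.pickleK)|by exists o].
rewrite esum_mkcond; apply: eq_esum => n _; case: ifPn => // nr.
rewrite /b; case: choice.unpickle => // o; case: eqP => // on.
by move: nr; rewrite -on mem_set//; exists o.
Qed.

End countable_sums.

Section epoch_sums.
Context (R : realType) (v : R).
Hypothesis v0 : (0 < v)%R.
Implicit Types (z : state R) (e : epoch R) (o : observation).
Local Notation D := (state_dist v).

(** What is summed over the epochs, namely the constant 1 or the data rate: a quantity that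
    is compatible with relabelling and with the ambiguity of observations at ties. *)
Record observable (f : R -> state R -> observation -> \bar R) : Prop := Observable {
  observable_ge0 : forall t z o, 0 <= f t z o ;
  observable_measurable : forall (t : state R -> R) o, measurable_fun setT t ->
    measurable_fun setT (fun z => f (t z) z o) ;
  observable_perm : forall s z t o, bijective s -> (size o.2 <= 2)%N ->
    f t (perm_state s z) o = f t z (rename s o) ;
  observable_swap : forall z t i j, D z i t = D z j t ->
    f t z (i, [:: j]) = f t z (j, [:: i]) ;
  observable_swap2 : forall z t l i j, D z i t = D z j t ->
    f t z (l, [:: i; j]) = f t z (l, [:: j; i]) }.

Definition epoch_sum e (I : set R) (f : R -> state R -> observation -> \bar R) z :=
  \esum_(t in epoch_times e (D z) `&` I) f t z (observation_at e (D z) t).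

Variables (e : epoch R) (I : set R) (f : R -> state R -> observation -> \bar R).
Hypothesis If : observable f.
Hypothesis Ie : forall t, I t -> observes_at e t.
Hypothesis mI : measurable I.

Lemma epoch_sum_ge0 z : 0 <= epoch_sum e I f z.
Proof. by apply: esum_ge0 => t _; exact: observable_ge0 If _ _ _. Qed.

(** The retained observation is determined by its own time; this makes the condition
    measurable in z. *)
Definition selected o : set (state R) :=
  [set z | first_observed e (D z) (epoch_time v e z o) o /\ I (epoch_time v e z o)].

Lemma measurable_selected o : measurable (selected o).
Proof.
have mt := measurable_epoch_time v e o.
apply: measurableI; last exact: mpreimage.
apply: measurableI; first exact: measurable_observed.
rewrite [X in measurable X](_ : _ =
  \bigcap_n (if choice.unpickle n is Some o' then
    if (choice.pickle o <= choice.pickle (o' : observation))%N then setT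
    else ~` [set z | observed e (D z) (epoch_time v e z o) o'] else setT)).
  apply: bigcapT_measurable => n; case: choice.unpickle => [ o'|//].
  by case: ifP => // _; apply: measurableC; exact: measurable_observed.
apply/seteqP; split=> z /= h.
  move=> n _; case: choice.unpickle => [ o'|//]; case: ifPn => // /negP oo' /= ho'.
  by apply: oo'; exact: h.
move=> o' ho'; have /= := h (choice.pickle o') Logic.I; rewrite choice.pickleK.
by case: ifPn.
Qed.

(** Distinct epochs have distinct retained observations and conversely, so the sum over an
    uncountable set of times becomes a sum over the countable set of observations. *)
Lemma epoch_sum_countable z : tie_free z ->
  epoch_sum e I f z =
  \sum_(0 <= n <oo) (if choice.unpickle n is Some o then
    if choice.pickle o == n then
      if z \in selected o then f (epoch_time v e z o) z o else 0 else 0 else 0).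
Proof.
move=> tf; rewrite -(esum_countType (a := fun o =>
  if z \in selected o then f (epoch_time v e z o) z o else 0)); last first.
  by move=> o; case: ifP => // _; exact: observable_ge0 If _ _ _.
rewrite (_ : \esum_(o in setT) _ =
    \esum_(o in [set o | selected o z]) f (epoch_time v e z o) z o); last first.
  rewrite [RHS]esum_mkcond; apply: eq_esum => o _.
  by congr (if _ then _ else _); apply/idP/idP; rewrite !inE.
rewrite /epoch_sum (reindex_esum [set o | selected o z] _ (epoch_time v e z)).
  apply: eq_esum => o [ho _]; congr (f _ _ _); exact: first_observed_at.
split=> [ o [ho It]|o o' /set_mem[ho It] /set_mem[ho' It'] tt|t [te It]].
- by split=> //; exists o; case: ho.
- by rewrite tt in ho; apply: first_observed_unique ho ho'.
have ho := observation_atP te; exists (observation_at e (D z) t); last first.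
  by apply/esym; apply: observed_time => //; [exact: Ie|case: ho].
have et : t = epoch_time v e z (observation_at e (D z) t).
  by apply: observed_time => //; [exact: Ie|case: ho].
by rewrite /selected/= -et.
Qed.

Lemma measurable_epoch_sum :
  measurable_fun setT ((epoch_sum e I f) \_ (@tie_free R)).
Proof.
pose g n z := (if choice.unpickle n is Some o then
    if choice.pickle o == n then
      if z \in selected o then f (epoch_time v e z o) z o else 0 else 0 else 0).
have g0 n z : 0 <= g n z.
  rewrite /g; case: choice.unpickle => // o; case: ifP => // _; case: ifP => // _.
  exact: observable_ge0 If _ _ _.
have mg n : measurable_fun setT (g n).
  rewrite /g; case: choice.unpickle => [ o|]; last exact: measurable_cst.
  case: (choice.pickle o == n); last exact: measurable_cst.
  apply: measurable_fun_ifT => //.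
    apply: (measurable_fun_bool true); rewrite setTI.
    rewrite (_ : _ @^-1` _ = selected o); first exact: measurable_selected.
    by apply/seteqP; split=> z; [exact: set_mem|exact: mem_set].
  by apply: (observable_measurable If); exact: measurable_epoch_time.
rewrite (_ : _ \_ _ = (fun z => \sum_(0 <= n <oo) g n z) \_ (@tie_free R)).
  apply: (proj1 (measurable_restrictT _ (@measurable_tie_free R))).
  apply: (@ge0_emeasurable_sum _ _ _ (@tie_free R) g xpredT) => // n _.
  exact: measurable_funS (mg n).
apply/funext => z; rewrite !patchE; case: ifPn => // ztf.
by apply: epoch_sum_countable; rewrite inE in ztf.
Qed.

(** The epochs do not depend on the labelling, but the retained observations do, as they
    are the first in an enumeration. They still have equal values of f, by
    [observed_unique]. *)
Lemma epoch_sum_perm s z : bijective s -> tie_free z ->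
  epoch_sum e I f (perm_state s z) = epoch_sum e I f z.
Proof.
move=> bs tf; have [g sg gs] := bs.
have renK o : rename s (rename g o) = o.
  case: o => i r; rewrite /rename/= gs -map_comp map_id_in// => j _ /=; exact: gs.
have eE t : epoch_times e (D (perm_state s z)) t <-> epoch_times e (D z) t.
  split=> -[ o ho]; first by exists (rename s o); apply/observed_perm.
  by exists (rename g o); apply/observed_perm => //; rewrite renK.
rewrite /epoch_sum (_ : epoch_times e (D (perm_state s z)) = epoch_times e (D z)); last first.
  by apply/seteqP; split=> t /eE.
apply: eq_esum => t [te It].
have [ho _] := observation_atP te.
have [ho' _] := observation_atP ((eE t).2 te).
move: ho ho'; set o := observation_at _ _ _; set o' := observation_at _ _ _ => ho ho'.
have o2 : (size o'.2 <= 2)%N.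
  by move: ho'; case: (e) o' => [||||t0] [i [|j [|k [|l r]]]].
rewrite (observable_perm If)//.
have {}ho' := (observed_perm v e z t o' bs).1 ho'.
have [->//|[i [j [ij [[-> ->]|[l [-> ->]]]]]]] := observed_unique v0 tf (Ie It) ho ho'.
- by rewrite (observable_swap If).
- by rewrite (observable_swap2 If).
Qed.

Lemma epoch_sum_perm_invariant : perm_invariant ((epoch_sum e I f) \_ (@tie_free R)).
Proof.
move=> s z bs; rewrite !patchE.
have -> : (perm_state s z \in @tie_free R) = (z \in @tie_free R).
  by apply/idP/idP; rewrite !inE tie_free_perm.
by case: ifPn => // ztf; rewrite epoch_sum_perm//; rewrite inE in ztf.
Qed.

End epoch_sums.

(** * Expected sums over epochs *)

Section time_change.
Context (R : realType) (e : epoch R) (k : R) (phi psi : R -> R)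
  (D D' : nat -> R -> R).
Hypotheses (k0 : (0 < k)%R) (phiK : cancel psi phi).
Hypothesis DD : forall i t, D' i t = (k * D i (phi t))%R.

(** All conditions that define observations are comparisons of distances. *)
Lemma observed_time_change t : observed e D' t = observed e D (phi t).
Proof.
have le i j u u' : (D' i u <= D' j u')%R = (D i (phi u) <= D j (phi u'))%R.
  by rewrite !DD ler_pM2l.
have eqD i j : (D' i t = D' j t) = (D i (phi t) = D j (phi t)).
  by apply/propext; rewrite !DD; split=> [/mulfI|->//]; apply; rewrite gt_eqF.
have ca i : closest_approach D' i t = closest_approach D i (phi t).
  apply/propext; split=> h u; last by rewrite le.
  by have := h (psi u); rewrite le phiK.
have ne i : nearest D' i t = nearest D i (phi t).
  by apply/propext; split=> h j; have := h j; rewrite le.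
have oc l i : only_closer D' l (D' i t) t = only_closer D l (D i (phi t)) (phi t).
  apply/propext; split=> -[h1 h2]; split; rewrite ?(ltNge, le) in h1 *; rewrite // => j.
    by rewrite ltNge -le -ltNge; exact: h2.
  by rewrite ltNge le -ltNge; exact: h2.
apply/funext => -[i s]; case: e => [||||t0]; case: s => [|j [|l [|? ?]]] //=;
by rewrite ?eqD ?ca ?ne ?oc.
Qed.

Lemma epoch_times_time_change t : epoch_times e D' t = epoch_times e D (phi t).
Proof. by rewrite /epoch_times/= observed_time_change. Qed.

Lemma observation_at_time_change t : observation_at e D' t = observation_at e D (phi t).
Proof. by rewrite /observation_at observed_time_change. Qed.

End time_change.

Section observables.
Context (R : realType) (v : R) (a : interference) (alpha B : R).
Hypothesis B0 : (0 < B)%R.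

Definition unit_observable (_ : R) (_ : state R) (_ : observation) : \bar R := 1.

Lemma unit_observableP : observable v unit_observable.
Proof. by split=> //= *; exact: measurable_cst. Qed.

(** The fading variables are almost surely nonnegative; the absolute value makes the rate
    nonnegative and measurable at every state. *)
Definition rate_observable (t : R) (z : state R) (o : observation) : \bar R :=
  B%:E * lne (1 + signal_quality a 0 alpha (fun n => `|(z.2 n).2|%R) (state_dist v z) t o).

Lemma rate_observableP : observable v rate_observable.
Proof.
split=> [t z o|t o mt|s z t o bs o2|z t i j ij|z t l i j ij].
- apply: mule_ge0; first by rewrite lee_fin ltW.
  by rewrite lne_ge0 leeDl// signal_quality_ge0.
- apply: emeasurable_funM => //; apply: (measurableT_comp (@measurable_lne R)).
  apply: emeasurable_funD => //; apply: measurable_signal_quality => // [n|i].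
    apply: measurableT_comp => //; apply: measurableT_comp => //.
    exact: measurable_state_v.
  exact: measurable_state_dist.
- congr (_ * lne (1 + _)); apply: signal_quality_perm => //.
  + by move=> n n3 /=; rewrite n3.
  + by move=> j /=; rewrite ltnNge leq_addl/= addnK.
  + by move=> i; rewrite state_dist_perm.
- by congr (_ * lne (1 + _)); exact: signal_quality_swap.
- by congr (_ * lne (1 + _)); exact: signal_quality_swap2.
Qed.

End observables.

Section expected_sums.
Context d (T : measurableType d) (R : realType) (P : probability T R).
Variables (lam c m : R) (X : nat -> {RV P >-> (R * R)%type})
  (Theta F : nat -> {RV P >-> R}) (lawF : set R -> \bar R).
Hypothesis M : marked_model lam c m X Theta F lawF.
Let c0 : (0 < c)%R := model_c M.
Hypothesis fading_ge0 : \forall w \ae P, forall n, (0 <= m * F n w)%R.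
Variable v : R.
Hypothesis v0 : (0 < v)%R.
Local Notation net := (network_state c m X Theta F v).
Local Notation Dw := (dist v (fun i => X i : T -> R * R) (fun i => Theta i : T -> R)).

(** The scaled network at time t0 + t is the original network at time (t0 + t)/c, scaled. *)
Lemma network_dist t0 w i t :
  state_dist v (net t0 w) i t = (c * Dw w i ((t0 + t) / c))%R.
Proof.
rewrite /state_dist /dist/= /mark addn3/=.
have ct : (t = c * ((t0 + t) / c) - t0)%R by rewrite mulrC divfK ?gt_eqF// addrC addKr.
move: ct; move: ((t0 + t) / c)%R => u ->.
rewrite -[c in RHS]ger0_norm ?ltW// -sqrtr_sqr -sqrtrM ?sqr_ge0//; congr Num.sqrt.
by ring.
Qed.

(** The two clocks: s for the original network, t = c s - t0 for the scaled network started
    at the time t0. *)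
Let clock t0 : cancel (fun s => c * s - t0)%R (fun t => (t0 + t) / c)%R.
Proof. by move=> s; rewrite addrC subrK mulrC mulKf// gt_eqF. Qed.

Let clock' t0 : cancel (fun t => (t0 + t) / c)%R (fun s => c * s - t0)%R.
Proof. by move=> t; rewrite mulrC divfK ?gt_eqF// addrC addKr. Qed.

Lemma epoch_sum_network e I f f0 t0 w :
  (forall s o, f (c * s - t0)%R (net t0 w) o = f0 s w o) ->
  epoch_sum v e I f (net t0 w) =
  \esum_(s in epoch_times e (Dw w) `&` [set s | I (c * s - t0)%R])
     f0 s w (observation_at e (Dw w) s).
Proof.
move=> ff; have DD := network_dist t0 w.
have et t := epoch_times_time_change e c0 (clock t0) DD t.
have oa t := observation_at_time_change e c0 (clock t0) DD t.
rewrite /epoch_sum (reindex_esum (epoch_times e (Dw w) `&` [set s | I (c * s - t0)%R]) _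
  (fun s => c * s - t0)%R).
  by apply: eq_esum => s _; rewrite oa clock ff.
split=> [s [es Is]|s s' _ _|t [te It]].
- by split=> //; rewrite et clock.
- by move=> /(congr1 (fun t => (t0 + t) / c)%R); rewrite !clock.
- exists ((t0 + t) / c)%R; last exact: clock'.
  by split; [rewrite -et|rewrite /= clock'].
Qed.

Lemma tie_free_event t : measurable (net t @^-1` @tie_free R) /\
  P (net t @^-1` @tie_free R) = 1.
Proof.
split; last by apply: (network_tie_free M) => //; rewrite gt_eqF.
apply: mpreimage; [exact: measurable_network_state|exact: measurable_tie_free].
Qed.

Lemma integral_tie_free (f : state R -> \bar R) t :
  \int[P]_w f (net t w) = \int[P]_w (f \_ (@tie_free R)) (net t w).
Proof.
have [mE PE] := tie_free_event t; apply: (integral_eq_off_null mE PE) => w Ew.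
by rewrite patchE mem_set.
Qed.

End expected_sums.

Section invariance.
Context (R : realType) (v : R).
Hypothesis v0 : (0 < v)%R.
Context d1 (T1 : measurableType d1) (P1 : probability T1 R)
  (lam1 c1 m1 : R) (X1 : nat -> {RV P1 >-> (R * R)%type})
  (Theta1 F1 : nat -> {RV P1 >-> R}) (law1 : set R -> \bar R).
Context d2 (T2 : measurableType d2) (P2 : probability T2 R)
  (lam2 c2 m2 : R) (X2 : nat -> {RV P2 >-> (R * R)%type})
  (Theta2 F2 : nat -> {RV P2 >-> R}) (law2 : set R -> \bar R).
Hypotheses (M1 : marked_model lam1 c1 m1 X1 Theta1 F1 law1)
  (M2 : marked_model lam2 c2 m2 X2 Theta2 F2 law2).
Hypothesis same_law : forall B, measurable B ->
  law1 [set x | B (m1 * x)%R] = law2 [set x | B (m2 * x)%R].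
Hypotheses (F1_ge0 : \forall w \ae P1, forall n, (0 <= m1 * F1 n w)%R)
  (F2_ge0 : \forall w \ae P2, forall n, (0 <= m2 * F2 n w)%R).

(** Expected sums depend neither on the model nor on the starting time: this is [transfer]
    for the sum restricted to the configurations without ties. *)
Lemma epoch_sum_invariance e I f t1 t2 : observable v f ->
  (forall t, I t -> observes_at e t) -> measurable I ->
  \int[P1]_w epoch_sum v e I f (network_state c1 m1 X1 Theta1 F1 v t1 w) =
  \int[P2]_w epoch_sum v e I f (network_state c2 m2 X2 Theta2 F2 v t2 w).
Proof.
move=> fP Ie mI.
rewrite (integral_tie_free M1)// (integral_tie_free M2)//.
apply: transfer.
- exact: measurable_network_state.
- exact: measurable_network_state.
- exact: (network_locally_finite_simple M1).
- exact: (network_locally_finite_simple M2).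
- exact: (same_voids_models v v M1 M2).
- exact: measurable_epoch_sum.
- by move=> z; rewrite patchE; case: ifP => // _; exact: epoch_sum_ge0.
- exact: epoch_sum_perm_invariant.
Qed.

End invariance.

Section palm_means.
Context d (T : measurableType d) (R : realType) (P : probability T R).
Variables (lam c m : R) (X : nat -> {RV P >-> (R * R)%type})
  (Theta F : nat -> {RV P >-> R}) (lawF : set R -> \bar R).
Hypothesis M : marked_model lam c m X Theta F lawF.
Let c0 : (0 < c)%R := model_c M.
Hypothesis fading_ge0 : \forall w \ae P, forall n, (0 <= m * F n w)%R.
Variable v : R.
Hypothesis v0 : (0 < v)%R.
Local Notation net := (network_state c m X Theta F v).
Local Notation Dw := (dist v (fun i => X i : T -> R * R) (fun i => Theta i : T -> R)).
Variable e : epoch R.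
Hypothesis he : forall t, observes_at e t.

Definition mean f I := \int[P]_w epoch_sum v e I f (net 0%R w).

Section one_observable.
Variables (f : R -> state R -> observation -> \bar R) (f0 : R -> T -> observation -> \bar R).
Hypothesis fP : observable v f.
Hypothesis ff0 : forall t0 s w o, f (c * s - t0)%R (net t0 w) o = f0 s w o.

Lemma mean_ge0 I : 0 <= mean f I.
Proof. by apply: integral_ge0 => w _; exact: epoch_sum_ge0. Qed.

(** Shifting the window amounts to starting the network at another time. *)
Lemma mean_shift (I : set R) t0 : measurable I -> mean f [set s | I (s - t0)%R] = mean f I.
Proof.
move=> mI.
transitivity (\int[P]_w epoch_sum v e I f (net t0 w)).
  apply: eq_integral => w _.
  rewrite (epoch_sum_network M _ _ (ff0 0%R ^~ w)) (epoch_sum_network M _ _ (ff0 t0 ^~ w)).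
  by congr esum; apply/seteqP; split=> s /=; rewrite subr0.
exact: (epoch_sum_invariance v0 M M).
Qed.

Lemma mean_setU I J : measurable I -> measurable J -> I `&` J = set0 ->
  mean f (I `|` J) = mean f I + mean f J.
Proof.
move=> mI mJ IJ.
have m0 := @measurable_network_state _ _ _ _ c m X Theta F v 0%R.
pose h (I' : set R) w : \bar R := (epoch_sum v e I' f \_ (@tie_free R)) (net 0%R w).
have meanE I' : mean f I' = \int[P]_w h I' w by exact: (integral_tie_free M fading_ge0 v0).
have h0 I' w : 0 <= h I' w.
  by rewrite /h patchE; case: ifP => // _; exact: epoch_sum_ge0.
have mh I' : measurable I' -> measurable_fun setT (h I').
  move=> mI'; apply: (measurableT_comp _ m0).
  by apply: measurable_epoch_sum => // t _; exact: he.
rewrite !meanE; transitivity (\int[P]_w (h I w + h J w)); last first.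
  by apply: ge0_integralD => //; exact: mh.
apply: eq_integral => w _; rewrite /h !patchE; case: ifP => _; last by rewrite adde0.
rewrite /epoch_sum (esumID I); last by move=> t _; exact: (observable_ge0 fP).
have nIJ t : I t -> J t -> False.
  by move=> It Jt; have : (I `&` J) t by []; rewrite IJ.
have -> : epoch_times e (state_dist v (net 0%R w)) `&` (I `|` J) `&` I =
    epoch_times e (state_dist v (net 0%R w)) `&` I.
  by apply/seteqP; split=> t /=; tauto.
have -> // : epoch_times e (state_dist v (net 0%R w)) `&` (I `|` J) `&` ~` I =
    epoch_times e (state_dist v (net 0%R w)) `&` J.
by apply/seteqP; split=> t /=; have := nIJ t; tauto.
Qed.

Lemma mean_mono I J : measurable I -> measurable J -> I `<=` J -> mean f I <= mean f J.
Proof.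
move=> mI mJ IJ; rewrite -(setDUK IJ) mean_setU ?leeDl ?mean_ge0//.
- exact: measurableD.
- by rewrite setDIK.
Qed.

(** The mean over half-open windows is additive in the length by [mean_shift], hence
    linear. The closed window lies between the half-open windows of lengths k and k + eps. *)
Lemma mean_linear (k : R) : (0 < k)%R ->
  mean f `[0%R, k]%classic = k%:E * mean f `[0%R, 1%R[%classic.
Proof.
pose h (k : R) := mean f `[0%R, k[%classic.
have hD a b : (0 < a)%R -> (0 < b)%R -> h (a + b)%R = h a + h b.
  move=> a0 b0; rewrite /h.
  have -> : `[0%R, (a + b)%R[%classic =
      `[0%R, a[%classic `|` [set s | `[0%R, b[%classic (s - a)%R].
    apply/seteqP; split=> s /=; rewrite !in_itv/=.
      move=> /andP[s0 sab]; have [sa|sa] := ltP s a; first by left; rewrite s0.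
      by right; rewrite subr_ge0 sa ltrBlDl.
    move=> [/andP[s0 sa]|/andP[sa sb]]; first by rewrite s0; lra.
    by apply/andP; split; lra.
  rewrite mean_setU ?mean_shift//.
    rewrite [X in measurable X](_ : _ = `[a, (a + b)%R[%classic)//.
    by apply/seteqP; split=> s /=; rewrite !in_itv/= subr_ge0 ltrBlDl.
  by apply/seteqP; split=> s //= [+]; rewrite !in_itv/= => /andP[s0 sa] /andP[as0 _]; lra.
have hlin := additive_linear (fun k _ => mean_ge0 `[0%R, k[%classic) hD.
move=> k0; rewrite -/(h 1%R); apply/eqP; rewrite eq_le; apply/andP; split; last first.
  rewrite -hlin//; apply: mean_mono => //.
  by apply: subset_itvl; rewrite bnd_simp.
have upper eps : (0 < eps)%R -> mean f `[0%R, k]%classic <= k%:E * h 1%R + eps%:E * h 1%R.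
  move=> e0; rewrite -!hlin// -hD//; apply: mean_mono => //.
  by apply: subset_itvl; rewrite bnd_simp ltrDl.
have h0 : 0 <= h 1%R by exact: mean_ge0.
move: upper h0; case: (h 1%R) => [y| |] upper //; last by rewrite gt0_muley ?leey ?lte_fin.
rewrite lee_fin => y0; apply/lee_addgt0Pr => eps e0.
(* The denominator y + 1 avoids a division by y = 0. *)
apply: (le_trans (upper (eps / (y + 1))%R _)).
  by rewrite divr_gt0// ltr_wpDl.
rewrite leeD2l// -EFinM lee_fin -mulrA ler_piMr ?(ltW e0)//.
by rewrite mulrC ler_pdivrMr ?ltr_wpDl// mul1r lerDl.
Qed.

(** The unit window of the original clock is the window [0, c] of the clock of the scaled
    network. *)
Lemma palm_sum : \int[P]_w (\esum_(s in epoch_times e (Dw w) `&` `[0%R, 1%R])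
    f0 s w (observation_at e (Dw w) s)) = c%:E * mean f `[0%R, 1%R[%classic.
Proof.
rewrite -mean_linear//; apply: eq_integral => w _.
rewrite (epoch_sum_network M _ _ (ff0 0%R ^~ w)); congr esum; congr (_ `&` _).
apply/seteqP; split=> s /=; rewrite !in_itv/= subr0.
  by move=> /andP[s0 s1]; rewrite mulr_ge0 ?(ltW c0)//= ler_piMr ?(ltW c0).
by rewrite pmulr_rge0// ger_pMr.
Qed.

End one_observable.

(** The factor c appears in the sum and in the intensity of the epochs, and cancels; by the
    conventions on inverses this includes a null and an infinite intensity. *)
Lemma palm_expectation_mean f f0 : observable v f ->
  (forall t0 s w o, f (c * s - t0)%R (net t0 w) o = f0 s w o) ->
  palm_expectation P (fun w => epoch_times e (Dw w))
    (fun s w => f0 s w (observation_at e (Dw w) s)) =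
  (mean (@unit_observable R) `[0%R, 1%R[%classic)^-1 * mean f `[0%R, 1%R[%classic.
Proof.
move=> fP ff0; rewrite /palm_expectation (palm_sum fP ff0).
rewrite /palm_intensity (palm_sum (f0 := fun _ _ _ => 1) (unit_observableP v))//.
exact: ratio_scale.
Qed.

End palm_means.

(** * Average data rates *)

Section average_rates.
Context d (T : measurableType d) (R : realType) (P : probability T R).
Variables (lam c m : R) (X : nat -> {RV P >-> (R * R)%type})
  (Theta F : nat -> {RV P >-> R}) (lawF : set R -> \bar R).
Hypothesis M : marked_model lam c m X Theta F lawF.
Let c0 : (0 < c)%R := model_c M.
Hypothesis m0 : (0 < m)%R.
Hypothesis fading_ge0 : \forall w \ae P, forall n, (0 <= m * F n w)%R.
Variables (v alpha B : R) (a : interference).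
Hypotheses (v0 : (0 < v)%R) (B0 : (0 < B)%R).
Local Notation net := (network_state c m X Theta F v).
Local Notation Dw := (dist v (fun i => X i : T -> R * R) (fun i => Theta i : T -> R)).
Local Notation rate := (rate_observable v a alpha B).

(** The data rate in the original network, with absolute values as in [rate_observable]. *)
Definition network_rate (s : R) (w : T) (o : observation) : \bar R :=
  B%:E * lne (1 + signal_quality a 0 alpha (fun n => `|F n w|%R) (Dw w) s o).

Lemma rate_network t0 s w o : rate (c * s - t0)%R (net t0 w) o = network_rate s w o.
Proof.
have quality_eq : signal_quality a 0 alpha (fun n => `|((net t0 w).2 n).2|%R)
    (state_dist v (net t0 w)) (c * s - t0)%R o =
    signal_quality a 0 alpha (fun n => `|F n w|%R) (Dw w) s o.
  apply: (signal_quality_scale a alpha o m0 c0) => [n|i|n|i].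
  - exact: normr_ge0.
  - by rewrite /dist sqrtr_ge0.
  - by rewrite /= normrM gtr0_norm.
  - rewrite (network_dist M); congr (_ * Dw w i _)%R.
    by rewrite addrC subrK mulrC mulKf// gt_eqF.
by rewrite /rate_observable quality_eq.
Qed.

Lemma network_rate_fading t w s o : tie_free (net t w) ->
  network_rate s w o =
  B%:E * lne (1 + signal_quality a 0 alpha (fun n => F n w) (Dw w) s o).
Proof.
move=> [_ nn]; have absE : (fun n => `|F n w|%R) = (fun n => F n w).
  by apply/funext => n; rewrite ger0_norm//; have := nn n; rewrite /= pmulr_rge0.
by rewrite /network_rate absE.
Qed.

Lemma average_rate_epoch e : (forall t, observes_at e t) ->
  average_rate P v 0 alpha B X Theta F a e =
  (mean c m X Theta F v e (@unit_observable R) `[0%R, 1%R[%classic)^-1 *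
  mean c m X Theta F v e rate `[0%R, 1%R[%classic.
Proof.
move=> he; rewrite -(palm_expectation_mean M fading_ge0 v0 he (rate_observableP v a alpha B0)
  (fun t0 s w o => rate_network t0 s w o)).
transitivity (palm_expectation P (fun w => epoch_times e (Dw w)) (fun t w => B%:E *
  lne (1 + signal_quality a 0 alpha (fun n => F n w) (Dw w) t (observation_at e (Dw w) t)))).
  by case: e he => //= t /(_ 1%R)/eqP; rewrite oner_eq0.
have [mE PE] := tie_free_event M fading_ge0 v0 0%R.
have sums_eq : \int[P]_w (\esum_(s in epoch_times e (Dw w) `&` `[0%R, 1%R]) (B%:E *
    lne (1 + signal_quality a 0 alpha (fun n => F n w) (Dw w) s (observation_at e (Dw w) s)))) =
    \int[P]_w (\esum_(s in epoch_times e (Dw w) `&` `[0%R, 1%R])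
      network_rate s w (observation_at e (Dw w) s)).
  apply: (integral_eq_off_null mE PE) => w Ew; apply: eq_esum => s _.
  by rewrite (network_rate_fading _ _ Ew).
by rewrite /palm_expectation sums_eq.
Qed.

Lemma nearest_at_perm : perm_invariant [set z : state R | exists i, nearest (state_dist v z) i 0%R].
Proof.
apply: perm_invariant_sub => s z [g sg gs] [i hi]; exists (g i) => k.
by rewrite !state_dist_perm gs.
Qed.

Lemma measurable_nearest_at :
  measurable [set z : state R | exists i, nearest (state_dist v z) i 0%R].
Proof.
rewrite [X in measurable X](_ : _ = \bigcup_i [set z | nearest (state_dist v z) i 0%R]).
  apply: bigcupT_measurable => i.
  by apply: (@measurable_nearest R v (fun=> 0%R)); exact: measurable_cst.
by apply/seteqP; split=> z [i]; [exists i|exists i].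
Qed.

(** At time 0 the distances tend to infinity along the stations, so a nearest one exists;
    the property does not depend on the labelling and is transferred to the time t. *)
Lemma nearest_exists t :
  P (net t @^-1` [set z | exists i, nearest (state_dist v z) i 0%R]) = 1.
Proof.
rewrite (@transfer_set R _ _ _ _ P P (net t) (net 0%R)) //; first last.
- exact: nearest_at_perm.
- exact: measurable_nearest_at.
- exact: (same_voids_models v v M M).
- exact: (network_locally_finite_simple M).
- exact: (network_locally_finite_simple M).
- exact: measurable_network_state.
- exact: measurable_network_state.
apply/probability1_ae.
  by apply: mpreimage; [exact: measurable_network_state|exact: measurable_nearest_at].
apply: filterS (locations_locally_finite M) => w lf.
have [|i _ hi] := @exists_argmin R (fun i => state_dist v (net 0%R w) i 0%R) _ setT (ex_intro _ 0%N I).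
  move=> r; pose k := (Num.truncn (`|r| / c)%R).+1.
  have [N hN] := eventually_outside (lf k); exists N => i Ni.
  rewrite (network_dist M) addr0 mul0r /dist !mulr0 !mul0r !addr0.
  rewrite leNgt; apply/negP => rc; apply: (hN i Ni).
  set x := (X i w).1; set y := (X i w).2.
  have sk : (Num.sqrt (x ^+ 2 + y ^+ 2) <= k%:R)%R.
    have : (Num.sqrt (x ^+ 2 + y ^+ 2) <= `|r| / c)%R.
      by rewrite ler_pdivlMr// mulrC (le_trans (ltW rc))// ler_norm.
    by move/le_trans; apply; rewrite ltW// truncnS_gt.
  have bound (p q : R) : (Num.sqrt (p ^+ 2 + q ^+ 2) <= k%:R)%R -> p \in `[(- k%:R)%R, k%:R].
    move=> h; rewrite in_itv/= -ler_norml; apply: le_trans h.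
    by rewrite -sqrtr_sqr ler_sqrt ?lerDl ?sqr_ge0// addr_ge0// sqr_ge0.
  by split; apply: bound; [exact: sk|rewrite addrC; exact: sk].
by exists i => k; exact: hi.
Qed.

(** With a nearest station at hand, the sum over the window {0} has a single term. *)
Lemma average_rate_typical t :
  average_rate P v 0 alpha B X Theta F a (typical_time t) =
  \int[P]_w epoch_sum v (typical_time t) [set 0%R] rate (net (c * t)%R w).
Proof.
have [mE PE] := tie_free_event M fading_ge0 v0 (c * t)%R.
set E := _ @^-1` _ in mE PE.
(* Without a nearest station the sum is empty, while the rate takes its value at the
   default observation. *)
pose E' := net (c * t)%R @^-1` [set z | exists i, nearest (state_dist v z) i 0%R].
have mE' : measurable E'.
  by apply: mpreimage; [exact: measurable_network_state|exact: measurable_nearest_at].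
apply: (@integral_eq_off_null _ _ _ P _ _ (E `&` E')); first exact: measurableI.
  by rewrite probabilityI_full// nearest_exists.
move=> w [tf [i hi]].
rewrite (epoch_sum_network M _ _ (fun s o => rate_network (c * t)%R s w o)).
rewrite (_ : _ `&` _ = [set t]); last first.
  apply/seteqP; split=> [s [_ /= /eqP]|_ ->].
    by rewrite subr_eq0 => /eqP/mulfI; apply; rewrite gt_eqF.
  split; last by rewrite /= subrr.
  exists (i, [::]) => /= k; have := hi k; rewrite !(network_dist M) addr0.
  by rewrite ler_pM2l// [(c * t)%R]mulrC mulfK// gt_eqF.
rewrite esum_set1; first by rewrite (network_rate_fading _ _ tf).
rewrite -(rate_network (c * t)%R); exact: (observable_ge0 (rate_observableP v a alpha B0)).
Qed.

End average_rates.

Section scale_free.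
Context (R : realType) (v alpha B : R) (a : interference) (e : epoch R).
Hypotheses (v0 : (0 < v)%R) (B0 : (0 < B)%R).
Context d1 (T1 : measurableType d1) (P1 : probability T1 R)
  (lam1 c1 m1 : R) (X1 : nat -> {RV P1 >-> (R * R)%type})
  (Theta1 F1 : nat -> {RV P1 >-> R}) (law1 : set R -> \bar R).
Context d2 (T2 : measurableType d2) (P2 : probability T2 R)
  (lam2 c2 m2 : R) (X2 : nat -> {RV P2 >-> (R * R)%type})
  (Theta2 F2 : nat -> {RV P2 >-> R}) (law2 : set R -> \bar R).
Hypotheses (M1 : marked_model lam1 c1 m1 X1 Theta1 F1 law1)
  (M2 : marked_model lam2 c2 m2 X2 Theta2 F2 law2).
Hypotheses (m1_gt0 : (0 < m1)%R) (m2_gt0 : (0 < m2)%R).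
Hypothesis same_law : forall B, measurable B ->
  law1 [set x | B (m1 * x)%R] = law2 [set x | B (m2 * x)%R].
Hypotheses (F1_ge0 : \forall w \ae P1, forall n, (0 <= m1 * F1 n w)%R)
  (F2_ge0 : \forall w \ae P2, forall n, (0 <= m2 * F2 n w)%R).

(** Both sides are expressed by expected sums over epochs of the scaled networks, which have
    the same law up to relabelling. *)
Theorem average_rate_scale_free :
  average_rate P1 v 0 alpha B X1 Theta1 F1 a e =
  average_rate P2 v 0 alpha B X2 Theta2 F2 a e.
Proof.
have inv f I t1 t2 := epoch_sum_invariance v0 M1 M2 same_law F1_ge0 F2_ge0
  (e := e) (I := I) (f := f) t1 t2.
have rateP := rate_observableP v a alpha B0.
have mI : measurable (`[0%R, 1%R[%classic : set R) by exact: measurable_itv.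
have [[t et]|he] : (exists t, e = typical_time t) \/ (forall t, observes_at e t).
  by case: (e) => [||||t]; [right|right|right|right|left; exists t].
  rewrite et (average_rate_typical M1)// (average_rate_typical M2)// -et.
  apply: (inv _ [set 0%R] _ _ rateP); last exact: measurable_set1.
  by move=> s ->; rewrite et.
rewrite (average_rate_epoch M1)// (average_rate_epoch M2)//; congr (_^-1 * _).
  by apply: inv => //; exact: unit_observableP.
exact: inv.
Qed.

End scale_free.

Section fading_laws.
Context (R : realType).
Local Notation leb := (@lebesgue_measure R).
Local Notation RT := (measurableTypeR R).

(** A change of variables x |-> mu x in the density. *)
Lemma exponential_prob_scale (mu : R) (A : set R) : (0 < mu)%R -> measurable A ->
  exponential_prob mu [set x | A (mu * x)%R] = exponential_prob 1%R A.
Proof.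
move=> mu0 mA; pose phi (x : RT) : RT := (mu * x)%R.
have mphi : measurable_fun setT phi by exact: measurable_funM.
pose k : {nonneg R} := NngNum (ltW mu0).
have pdf0 (r x : R) : (0 <= r)%R -> 0 <= (exponential_pdf r x)%:E.
  by move=> r0; rewrite lee_fin exponential_pdf_ge0.
have mpdf r (D : set RT) : measurable_fun D (fun x => (exponential_pdf r x)%:E).
  by apply: measurable_funTS; apply/measurable_EFinP; exact: measurable_exponential_pdf.
have pf := @ge0_integral_pushforward _ _ RT RT R phi mphi leb A
  (fun x => (exponential_pdf 1 x)%:E) mA (mpdf 1%R A) (fun x _ => pdf0 1%R x ler01).
transitivity (mu%:E * \int[leb]_(x in phi @^-1` A) (exponential_pdf 1 (phi x))%:E); last first.
  rewrite -[X in _ * X]pf -[mu]/(k%:num) -ge0_integral_mscale//; last first.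
    by move=> x _; exact: pdf0.
  apply: eq_measure_integral => B mB _.
  have := lebesgue_affine 0 mu0 mB; rewrite /mscale/= /pushforward => <-.
  by congr (_ * leb _); apply/seteqP; split=> x /=; rewrite addr0.
rewrite -ge0_integralZl//; last 4 first.
- exact: mpreimage.
- by apply: measurable_funTS; exact: (measurableT_comp (mpdf 1%R setT) mphi).
- by move=> x _; exact: pdf0.
- by rewrite lee_fin ltW.
apply: eq_integral => x _; rewrite /= -EFinM; congr EFin.
have [x0|x0] := leP 0%R x.
  by rewrite !exponential_pdfE /phi ?mulr_ge0 ?(ltW mu0)// mul1r mulN1r mulNr.
by rewrite !lt0_exponential_pdf ?mulr0// /phi pmulr_rlt0.
Qed.

Lemma exponential_prob_negative (mu : R) : exponential_prob mu [set x : R | (x < 0)%R] = 0.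
Proof.
rewrite /exponential_prob; apply: integral0_eq => x /= x0.
by rewrite lt0_exponential_pdf.
Qed.

End fading_laws.

Section marked_networks.
Context d (T : measurableType d) (R : realType) (P : probability T R).
Variables (lam : R) (X : nat -> {RV P >-> (R * R)%type}) (Theta : nat -> {RV P >-> R}).
Hypotheses (lam0 : (0 < lam)%R) (N : moving_network lam X Theta).

(** The absence of fading is the case of fading variables equal to 1. They are independent
    of everything, as they generate the trivial sigma-algebra. *)
Definition constant_fading (_ : nat) : {RV P >-> R} := mkmfun (measurable_cst (1%R : R)).

Lemma constant_fading_sigma E : sigma_of_family (fun n => constant_fading n : T -> R) E ->
  E = set0 \/ E = setT.
Proof.
apply: (@smallest_sub _ _ _ [set E | E = set0 \/ E = setT]); last first.
  move=> _ [i _ [A _ <-]]; rewrite setTI.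
  have [A1|A1] := pselect (A 1%R); [right|left]; by apply/seteqP; split.
split=> [|A [->|->]|F hF]; first by left.
- by right; rewrite setD0.
- by left; rewrite setDv.
have [[n Fn]|nF] := pselect (exists n, F n = setT).
  by right; apply/seteqP; split=> // w _; exists n => //; rewrite Fn.
left; apply/seteqP; split=> // w [n _]; case: (hF n) => [->//|Fn].
by case: nF; exists n.
Qed.

Lemma constant_fading_event n E : events_of (constant_fading n : T -> R) E ->
  E = set0 \/ E = setT.
Proof.
by move=> h; apply: constant_fading_sigma; apply: sub_sigma_algebra; exists n.
Qed.

Lemma constant_model :
  marked_model lam (Num.sqrt lam) 1 X Theta constant_fading (fun A => \d_(1%R : R) A).
Proof.
split.
- by rewrite sqrtr_gt0.
- by rewrite sqr_sqrtr// ltW.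
- exact: network_poisson N.
- exact: network_angles N.
- exact: network_indep N.
- split=> [i A mA|J E JE].
    rewrite /distribution/= /pushforward.
    have [A1|A1] := pselect (A 1%R).
      rewrite diracE mem_set// (_ : _ @^-1` _ = setT) ?probability_setT//.
      by apply/seteqP; split.
    rewrite diracE memNset// (_ : _ @^-1` _ = set0) ?measure0//.
    by apply/seteqP; split.
  have E01 j : j \in J -> E j = set0 \/ E j = setT.
    by move=> jJ; apply: (@constant_fading_event j); exact: JE.
  have [[j jJ Ej]|nE] := pselect (exists2 j, j \in J & E j = set0).
    rewrite (big_fsetD1 j)//= Ej measure0 mul0e [X in P X](_ : _ = set0) ?measure0//.
    by apply/seteqP; split=> // w /(_ j jJ); rewrite Ej.
  have ET j : j \in J -> E j = setT.
    by move=> jJ; case: (E01 j jJ) => // Ej; case: nE; exists j.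
  rewrite big_seq big1 => [|j jJ]; last by rewrite ET// probability_setT.
  rewrite [X in P X](_ : _ = setT) ?probability_setT//.
  by apply/seteqP; split=> // w _ j jJ; rewrite ET.
- move=> A E _ /constant_fading_sigma[->|->]; first by rewrite setI0 measure0 mule0.
  by rewrite setIT probability_setT mule1.
Qed.

Lemma exponential_model (mu : R) (F : nat -> {RV P >-> R}) : fading_model mu X Theta F ->
  marked_model lam (Num.sqrt lam) mu X Theta F (exponential_prob mu).
Proof.
move=> FM; split.
- by rewrite sqrtr_gt0.
- by rewrite sqr_sqrtr// ltW.
- exact: network_poisson N.
- exact: network_angles N.
- exact: network_indep N.
- exact: fading_law FM.
- exact: fading_indep FM.
Qed.

Lemma exponential_fading_ge0 (mu : R) (F : nat -> {RV P >-> R}) : (0 < mu)%R ->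
  fading_model mu X Theta F -> \forall w \ae P, forall n, (0 <= mu * F n w)%R.
Proof.
move=> mu0 FM; apply: ae_foralln => n.
have mneg : measurable [set x : R | (x < 0)%R].
  by rewrite [X in measurable X](_ : _ = `]-oo, 0%R[%classic)//; apply/seteqP; split=> x /=;
    rewrite in_itv.
have := (fading_law FM).1 n _ mneg; rewrite exponential_prob_negative => h.
have mE : measurable (F n @^-1` [set x : R | (x < 0)%R]) by exact: mpreimage.
apply: filterS (null_ae mE h) => w /= /negP; rewrite -leNgt => Fn.
by rewrite mulr_ge0// ltW.
Qed.

End marked_networks.

Local Close Scope ereal_scope.

Theorem corollary10 (R : realType) (v alpha B lam1 lam2 : R)
    (d1 d2 : measure_display) (T1 : measurableType d1) (T2 : measurableType d2)
    (P1 : probability T1 R) (P2 : probability T2 R)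
    (X1 : nat -> {RV P1 >-> (R * R)%type}) (Theta1 : nat -> {RV P1 >-> R})
    (X2 : nat -> {RV P2 >-> (R * R)%type}) (Theta2 : nat -> {RV P2 >-> R})
    (a : interference) (e : epoch R) :
  0 < v -> 2 <= alpha -> 0 < B -> 0 < lam1 -> 0 < lam2 ->
  moving_network lam1 X1 Theta1 -> moving_network lam2 X2 Theta2 ->
  average_rate P1 v 0 alpha B X1 Theta1 (@no_fading _ T1 R) a e =
  average_rate P2 v 0 alpha B X2 Theta2 (@no_fading _ T2 R) a e
  /\
  forall (mu1 mu2 : R)
    (F1 : nat -> {RV P1 >-> R}) (F2 : nat -> {RV P2 >-> R}),
    0 < mu1 -> 0 < mu2 ->
    fading_model mu1 X1 Theta1 F1 -> fading_model mu2 X2 Theta2 F2 ->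
    average_rate P1 v 0 alpha B X1 Theta1 F1 a e =
    average_rate P2 v 0 alpha B X2 Theta2 F2 a e.
Proof.
move=> v0 _ B0 l1 l2 N1 N2; split=> [|mu1 mu2 F1 F2 mu1_gt0 mu2_gt0 FM1 FM2].
  have fading1 d (T : measurableType d) (P : probability T R) :
      \forall w \ae P, forall n, 0 <= 1 * @constant_fading _ T R P n w.
    by apply: aeW => w n; rewrite mulr_ge0 ?ler01.
  exact: (average_rate_scale_free alpha a e v0 B0 (constant_model l1 N1)
    (constant_model l2 N2) ltr01 ltr01 (fun _ _ => erefl) (fading1 _ _ P1) (fading1 _ _ P2)).
apply: (average_rate_scale_free alpha a e v0 B0 (exponential_model l1 N1 FM1)
  (exponential_model l2 N2 FM2)) => //.
- by move=> A mA; rewrite !exponential_prob_scale.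
- exact: (exponential_fading_ge0 mu1_gt0 FM1).
- exact: (exponential_fading_ge0 mu2_gt0 FM2).
Qed.
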